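(* Let $\Theta:\mathbb{T}\to\mathbb{T}$ be a measurable transformation. Suppose that for every interpolation family $\{E_\gamma:\gamma\in\mathbb{T}\}$ (of norms on $\mathbb{C}^N$, for any $N\ge 1$) we have $$\{E_\gamma:\gamma\in\mathbb{T}\}[0]=\{E_{\Theta(\gamma)}:\gamma\in\mathbb{T}\}[0]$$ (equality of the norms on $\mathbb{C}^N$). Then $\Theta$ is (the boundary value of) an inner function and $\widehat{\Theta}(0)=0$.
   Context: $\mathbb{D}$ is the open unit disc, $\mathbb{T}=\partial\mathbb{D}$, and $m$ is normalized Lebesgue measure on $\mathbb{T}$; $\widehat{\Theta}(0)=\int_{\mathbb{T}}\Theta\,dm$. An interpolation family is a family $E_\gamma=(\mathbb{C}^N,\|\cdot\|_\gamma)$, $\gamma\in\mathbb{T}$, of complex $N$-dimensional normed spaces such that for each $x\in\mathbb{C}^N$ the function $\gamma\mapsto\|x\|_\gamma$ is measurable and $\int_{\mathbb{T}}\log^+\|x\|_\gamma\,dm(\gamma)<\infty$. The interpolated space at $0$, written $E[0]$ or $\{E_\gamma:\gamma\in\mathbb{T}\}[0]$, is $\mathbb{C}^N$ equipped with $$\|x\|_{E[0]}=\inf\Big\{\operatorname*{ess\,sup}_{\gamma\in\mathbb{T}}\|f(\gamma)\|_{E_\gamma}\ :\ f \text{ analytic},\ f(0)=x\Big\},$$ where $f:\mathbb{D}\to\mathbb{C}^N$ ranges over analytic functions whose coordinates belong to the Smirnov class $N^+(\mathbb{D})$, and $f(\gamma)$ denotes the a.e. nontangential boundary value. *)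

(* Defs.v *)
From HB Require Import structures.
From mathcomp Require Import all_boot all_order all_algebra.
From mathcomp Require Import all_classical all_reals all_analysis.
From mathcomp Require Import measurable_realfun ess_sup_inf complex.

Set Implicit Arguments.
Unset Strict Implicit.
Unset Printing Implicit Defensive.

Import Order.TTheory GRing.Theory Num.Theory.
Import numFieldTopology.Exports numFieldNormedType.Exports.
Import Normc.

Local Open Scope classical_set_scope.
Local Open Scope ring_scope.
Local Open Scope complex_scope.

Record circle (R : realType) := Circle {
  circle_val :> R[i];
  circle_valP : normc circle_val == 1 }.

Section circle_measurable.
Variable R : realType.

HB.instance Definition _ := [isSub for @circle_val R].
HB.instance Definition _ := [Choice of circle R by <:].

Definition circle1 : circle R := Circle (introT eqP (normc1 R)).
HB.instance Definition _ := isPointed.Build (circle R) circle1.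

(* [R[i]^o] carries the norm topology of the complex plane; [circle R] gets
   the Borel sigma-algebra of the induced topology. *)
Definition circle_open : set (set (circle R)) :=
  [set @circle_val R @^-1` U | U in [set U : set R[i]^o | open U]].

HB.instance Definition _ := @isMeasurable.Build (sigma_display circle_open)
  (circle R) <<s circle_open >> (@sigma_algebra0 _ setT circle_open)
  (@sigma_algebraC _ circle_open) (@sigma_algebra_bigcup _ setT circle_open).

Lemma normc_expi (t : R) : normc (cos t +i* sin t) == 1.
Proof. by rewrite /= cos2Dsin2 sqrtr1. Qed.

Definition expi (t : measurableTypeR R) : circle R := Circle (normc_expi t).

Lemma continuous_expi : continuous ((fun t => expi t) : R -> R[i]^o).
Proof.
move=> t; apply/cvgrPdist_lt => /= -[e1 e2].
rewrite ltcE /= => /andP[/eqP -> e0].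
have e20 : 0 < e1 / 2 by rewrite divr_gt0.
have /cvgrPdist_lt /(_ _ e20) hc := @continuous_cos R t.
have /cvgrPdist_lt /(_ _ e20) hs := @continuous_sin R t.
near=> x.
have h1 : `|cos t - cos x| < e1 / 2 by near: x.
have h2 : `|sin t - sin x| < e1 / 2 by near: x.
rewrite normc_def ltcR /=.
apply: (@le_lt_trans _ _ (`|cos t - cos x| + `|sin t - sin x|)); last first.
  by rewrite [ltRHS](splitr e1) ltrD.
rewrite -[leRHS]ger0_norm ?addr_ge0 // -sqrtr_sqr ler_wsqrtr //.
rewrite [leRHS]sqrrD !real_normK ?num_real // lerD2r lerDl.
by rewrite mulrn_wge0 // mulr_ge0.
Unshelve. all: by end_near. Qed.

Lemma measurable_expi : measurable_fun [set: measurableTypeR R] expi.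
Proof.
apply: (@measurability _ _ _ _ _ _ (circle_open)) => //.
move=> _ [_ [U oU <-] <-]; rewrite setTI.
apply: open_measurable.
rewrite (_ : _ @^-1` _ =
  ((fun t => expi t) : R -> R[i]^o) @^-1` U) //.
by apply: open_comp => // t _; exact: continuous_expi.
Qed.

HB.instance Definition _ := @isMeasurableFun.Build _ _ (measurableTypeR R)
  (circle R) expi measurable_expi.

Lemma gt0_2pi : 0 < pi *+ 2 :> R.
Proof. by rewrite mulrn_wgt0 // pi_gt0. Qed.

Definition circle_measure : set (circle R) -> \bar R :=
  @distribution _ _ (measurableTypeR R) (circle R) R (uniform_prob gt0_2pi) expi.
HB.instance Definition _ := Probability.on circle_measure.

End circle_measurable.
Arguments circle_measure {R}.

Section interpolation.
Variable R : realType.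
Local Notation C := R[i].
Local Notation m := (@circle_measure R).
Implicit Types (f phi : C -> C) (g : circle R -> C).

(* [circle R] only has the Borel sigma-algebra; Lebesgue measurability of a set
   is membership in its completion for [m]. *)
Definition lebesgue_measurable_map (Theta : circle R -> circle R) :=
  forall B : set (circle R), measurable B ->
    completed_algebra_gen m (Theta @^-1` B).

Definition fourier0 g : C :=
  (\int[m]_gamma complex.Re (g gamma)) +i*
  (\int[m]_gamma complex.Im (g gamma)).

(* log^+; [ln x = 0] for [x <= 0], so [logp 0 = 0] as required. *)
Definition logp (x : R) : R := Num.max 0 (ln x).

Definition disc : set C := [set z | normc z < 1].

Definition holomorphic_disc f :=
  forall z, disc z -> derivable (f : C^o -> C^o) z 1.

Definition stolz (a : R) (gamma : circle R) : set C^o :=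
  [set z | disc z /\ normc (z - circle_val gamma) < a * (1 - normc z)].

(* Nontangential limit: limit inside every Stolz region at [gamma]. *)
Definition nt_cvg f (gamma : circle R) (l : C) := forall a : R, 1 < a ->
  (f : C^o -> C^o) @ within (stolz a gamma) (nbhs (circle_val gamma : C^o)) --> (l : C^o).

Definition boundary_value f g :=
  \forall gamma \ae m, nt_cvg f gamma (g gamma).

Definition logp_mean f (r : R) : \bar R :=
  (\int[m]_gamma (logp (normc (f (r%:C * circle_val gamma))))%:E)%E.

Definition nevanlinna f := holomorphic_disc f /\
  exists M : R, forall r, 0 <= r < 1 -> (logp_mean f r <= M%:E)%E.

(* The class N^+: functions of the Nevanlinna class for which the means of
   log^+|f| over the circles |z| = r converge to the mean of log^+|f| over the
   unit circle, where f is given by its a.e. nontangential limits. *)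
Definition smirnov f := nevanlinna f /\
  exists2 g, boundary_value f g &
    logp_mean f r @[r --> 1^'-] -->
      (\int[m]_gamma (logp (normc (g gamma)))%:E)%E.

Definition inner_fun phi := [/\ holomorphic_disc phi,
  exists M : R, forall z, disc z -> normc (phi z) <= M &
  exists2 g, boundary_value phi g & \forall gamma \ae m, normc (g gamma) = 1].

Definition is_norm N (nu : 'cV[C]_N -> R) := [/\
  forall x, nu x = 0 -> x = 0,
  forall (a : C) x, nu (a *: x) = normc a * nu x &
  forall x y, nu (x + y) <= nu x + nu y].

(* Norms are Borel in [gamma], so that [E \o Theta] has
   Lebesgue measurable norms when [Theta] is Lebesgue measurable. *)
Definition interpolation_family N (E : circle R -> 'cV[C]_N -> R) :=
  (forall gamma, is_norm (E gamma)) /\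
  forall x, measurable_fun setT (fun gamma => E gamma x) /\
    (\int[m]_gamma (logp (E gamma x))%:E < +oo)%E.

(* The norm of [x] in [E[0]]; [g] is the a.e. defined boundary function of the
   analytic function [f]. *)
Definition interp_norm N (E : circle R -> 'cV[C]_N -> R) (x : 'cV[C]_N)
    : \bar R :=
  ereal_inf [set e | exists (f : C -> 'cV[C]_N) (g : circle R -> 'cV[C]_N),
    [/\ forall i, smirnov (fun z => f z i ord0),
        forall i, boundary_value (fun z => f z i ord0)
                                 (fun gamma => g gamma i ord0),
        f 0 = x &
        e = ess_sup m (fun gamma => (E gamma (g gamma))%:E)]].

End interpolation.

(* Main.v *)
(** On C^2 consider the norms max(|x|, K |y - gamma x|). The pair (1, z) shows
    that the vector (1, 0) has norm at most 1 in the interpolated space, so by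
    invariance it also does for the family composed with Theta. Hence there are
    Smirnov functions f1, f2 with f1(0) = 1, f2(0) = 0 and, on the circle,
    |f1| <= 1 + delta and |f2 - Theta f1| <= (1 + delta) / K. By the maximum
    principle in the Smirnov class both functions are bounded in the disc, and
    f1(0) = 1 forces f1 to be close to 1 in L^2 as delta tends to 0. So Theta is
    an L^1 limit of functions f2 in H^infinity vanishing at 0, and the integrals
    of Theta gamma^n vanish for all n >= 0. The Cauchy integral of Theta is then
    its Poisson integral, and has nontangential limits Theta at Lebesgue points.

    Smirnov maximum principle: if |f| <= M on the circle, then the means of
    log+ (|f| / M) over |z| = r tend to 0 as r tends to 1, while they stay bounded
    away from 0 if |f(z0)| > M for some z0. *)

Require Import Defs.
From mathcomp Require Import all_boot all_order all_algebra.
From mathcomp Require Import all_classical all_reals all_analysis.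
From mathcomp Require Import measurable_realfun ess_sup_inf complex.
From mathcomp Require Import ring lra.

Set Implicit Arguments.
Unset Strict Implicit.
Unset Printing Implicit Defensive.

Import Order.TTheory GRing.Theory Num.Theory.
Import numFieldTopology.Exports numFieldNormedType.Exports.
Import Normc.

Local Open Scope classical_set_scope.
Local Open Scope ring_scope.
Local Open Scope complex_scope.

(** * Goursat's argument and the mean value property *)

Section goursat.
Variable R : realType.
Implicit Types (a b c d e s t x y : R).

(** The weight [K] forces [f2] to follow [Theta f1]. Dividing [f2] by [f1] would recover [Theta],
    but [f1] may have zeros; this is why the normalization f1(0) = 1 is turned into closeness to 1
    in mean. With delta = e^2 and K = 1 / e^2 all errors are O(e).

    Two obstacles shape the rest. The infimum defining the interpolated norm yields Smirnov
    functions that are bounded only almost everywhere on the circle, so passing into the disc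
    requires subharmonicity of log+ |f|. It is drawn from the maximum modulus principle for products
    of rotates of f, and so in the end from Cauchy's theorem on a rectangle in logarithmic
    coordinates. Moreover, neither [Theta] nor the boundary functions are known to be Borel: [Theta]
    is replaced by a Borel function [T] equal to it almost everywhere, and the orthogonality
    estimate is made with [f1] and [f2] on circles of radius r < 1. *)

Lemma exists_half_pow (w d : R) : 0 < d -> exists n : nat, w / 2 ^+ n < d.
Proof.
move=> d0; have [w0|w0] := lerP w 0.
  by exists 0%N; rewrite expr0 divr1; exact: le_lt_trans d0.
exists (Num.truncn (w / d)).+1.
rewrite ltr_pdivrMr ?exprn_gt0// mulrC -ltr_pdivrMr//.
apply: lt_trans (truncnS_gt _) _.
by rewrite -natrX ltr_nat ltn_expl.
Qed.

Lemma nested_interval_point (x w : nat -> R) :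
  (forall n, x n <= x n.+1) -> (forall n, x n.+1 + w n.+1 <= x n + w n) ->
  (forall n, 0 <= w n) ->
  exists s, forall n, x n <= s <= x n + w n.
Proof.
move=> x_nd xw_ni w0.
have xnd n k : x n <= x (n + k)%N.
  by elim: k => [|k IH]; rewrite ?addn0// addnS (le_trans IH).
have xwni n k : x (n + k)%N + w (n + k)%N <= x n + w n.
  by elim: k => [|k IH]; rewrite ?addn0// addnS (le_trans (xw_ni _)).
have xub n k : x n <= x k + w k.
  rewrite (le_trans (xnd n k))// addnC (le_trans _ (xwni k n))//.
  by rewrite lerDl.
exists (sup (range x)) => n; apply/andP; split.
  by apply: ub_le_sup; [exists (x 0%N + w 0%N) => _ [k _ <-]|exists n].
by apply: ge_sup; [exists (x 0%N), 0%N|move=> _ [k _ <-]].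
Qed.

(** Goursat's bisection, freed from line integrals: [B] is any function of rectangles [x, y] x
    [u, v] that is additive under vertical and horizontal cuts. If |B| exceeds e' times the squared
    half-perimeter, so it does on one of the four quarters; the nested quarters shrink to a point,
    where the local estimate is contradicted. *)
Lemma rectangle_bisection (B : R -> R -> R -> R -> R) a b c d :
  a <= b -> c <= d ->
  (forall x m y u v, a <= x -> x <= m -> m <= y -> y <= b ->
     c <= u -> u <= v -> v <= d -> B x y u v = B x m u v + B m y u v) ->
  (forall x y u m v, a <= x -> x <= y -> y <= b ->
     c <= u -> u <= m -> m <= v -> v <= d -> B x y u v = B x y u m + B x y m v) ->
  (forall s t, a <= s <= b -> c <= t <= d -> forall e, 0 < e ->
    exists2 dlt, 0 < dlt & forall x y u v, a <= x -> x <= s -> s <= y -> y <= b ->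
      c <= u -> u <= t -> t <= v -> v <= d -> y - x < dlt -> v - u < dlt ->
      `|B x y u v| <= e * ((y - x) + (v - u)) ^+ 2) ->
  B a b c d = 0.
Proof.
move=> ab cd BH BV Bloc.
apply/eqP; rewrite -normr_le0; apply/ler_addgt0Pl => e e0; rewrite addr0.
have [//|Bbig] := lerP.
(* The [+ 1] keeps [K] positive for a degenerate rectangle; e' times the squared half-perimeter is
   then at most e. *)
pose K := ((b - a) + (d - c)) ^+ 2 + 1.
have K0 : 0 < K by rewrite ltr_wpDl// sqr_ge0.
pose e' := e / K; have e'0 : 0 < e' by rewrite divr_gt0.
pose w n : R := (b - a) / 2 ^+ n; pose h n : R := (d - c) / 2 ^+ n.
have wS n : w n.+1 = w n / 2 by rewrite /w exprSr invfM mulrA.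
have hS n : h n.+1 = h n / 2 by rewrite /h exprSr invfM mulrA.
have w0 n : 0 <= w n by rewrite divr_ge0 ?subr_ge0// exprn_ge0.
have h0 n : 0 <= h n by rewrite divr_ge0 ?subr_ge0// exprn_ge0.
(* [q] is the lower left corner of a rectangle of generation n, whose sides are [w n] and [h n]. *)
pose P n (q : R * R) := [/\ a <= q.1, q.1 + w n <= b, c <= q.2, q.2 + h n <= d &
   e' * (w n + h n) ^+ 2 < `|B q.1 (q.1 + w n) q.2 (q.2 + h n)|].
(* [P n q] stands under the existential so that [choice] yields a total function [F]. *)
have step n q : exists q' : R * R, P n q -> [/\ P n.+1 q', q.1 <= q'.1,
   q'.1 + w n.+1 <= q.1 + w n, q.2 <= q'.2 & q'.2 + h n.+1 <= q.2 + h n].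
  have [Pq|nPq] := pselect (P n q); last by exists q.
  case: q Pq => x u [/= ax xb cu ud big].
  apply: contrapT => /forallNP no.
  have := w0 n.+1; have := h0 n.+1; rewrite wS hS => h2 w2.
  pose Q x' u' := `|B x' (x' + w n / 2) u' (u' + h n / 2)|.
  have small x' u' : x <= x' -> x' + w n / 2 <= x + w n ->
     u <= u' -> u' + h n / 2 <= u + h n -> Q x' u' <= e' * (w n + h n) ^+ 2 / 4.
    move=> H1 H2 H3 H4; rewrite leNgt; apply/negP => H5.
    apply: (no (x', u')) => _; rewrite /P /= wS hS; split => //; split => //.
    - lra.
    - lra.
    - lra.
    - lra.
    - move: H5; rewrite /Q; apply: le_lt_trans; rewrite le_eqVlt; apply/orP; left.
      by apply/eqP; field.
  have E x' : x' + w n / 2 + w n / 2 = x' + w n by field.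
  have E' x' : x' + h n / 2 + h n / 2 = x' + h n by field.
  have sumB : B x (x + w n) u (u + h n) =
    B x (x + w n / 2) u (u + h n / 2) +
    B x (x + w n / 2) (u + h n / 2) (u + h n) +
    (B (x + w n / 2) (x + w n) u (u + h n / 2) +
     B (x + w n / 2) (x + w n) (u + h n / 2) (u + h n)).
    rewrite (BH x (x + w n / 2)); [|lra..].
    by rewrite !(BV _ _ u (u + h n / 2) (u + h n)); [|lra..].
  move: big; rewrite sumB ltNge => /negP; apply.
  have S1 : Q x u <= e' * (w n + h n) ^+ 2 / 4 by apply: small; lra.
  have S2 : Q x (u + h n / 2) <= e' * (w n + h n) ^+ 2 / 4 by apply: small; lra.
  have S3 : Q (x + w n / 2) u <= e' * (w n + h n) ^+ 2 / 4 by apply: small; lra.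
  have S4 : Q (x + w n / 2) (u + h n / 2) <= e' * (w n + h n) ^+ 2 / 4
    by apply: small; lra.
  move: S1 S2 S3 S4; rewrite /Q !E !E' => S1 S2 S3 S4.
  rewrite (le_trans (ler_normD _ _))//.
  apply: le_trans (lerD (ler_normD _ _) (ler_normD _ _)) _; lra.
have [F HF] := choice (fun nq : nat * (R * R) => step nq.1 nq.2).
pose q := fix q n := if n is k.+1 then F (k, q k) else (a, c).
have Pq n : P n (q n).
  elim: n => [|n IH]; last by have [] := HF (n, q n) IH.
  have E1 : a + w 0 = b by rewrite /w expr0 divr1 addrCA subrr addr0.
  have E2 : c + h 0 = d by rewrite /h expr0 divr1 addrCA subrr addr0.
  split => //=; rewrite ?E1 ?E2 //.
  apply: le_lt_trans Bbig; rewrite /e' /w /h !expr0 !divr1 mulrAC.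
  by rewrite ler_pdivrMr// ler_wpM2l ?(ltW e0)// lerDl.
have [s Hs] := @nested_interval_point (fun n => (q n).1) w
  (fun n => let: And5 _ h1 _ _ _ := HF (n, q n) (Pq n) in h1)
  (fun n => let: And5 _ _ h1 _ _ := HF (n, q n) (Pq n) in h1) w0.
have [t Ht] := @nested_interval_point (fun n => (q n).2) h
  (fun n => let: And5 _ _ _ h1 _ := HF (n, q n) (Pq n) in h1)
  (fun n => let: And5 _ _ _ _ h1 := HF (n, q n) (Pq n) in h1) h0.
have sab : a <= s <= b.
  have [A1 A2 _ _ _] := Pq 0%N; have /andP[A3 A4] := Hs 0%N.
  by rewrite (le_trans A1 A3) (le_trans A4 A2).
have tcd : c <= t <= d.
  have [_ _ A1 A2 _] := Pq 0%N; have /andP[A3 A4] := Ht 0%N.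
  by rewrite (le_trans A1 A3) (le_trans A4 A2).
have [dl dl0 Hdl] := Bloc s t sab tcd e' e'0.
have [n Hn] := exists_half_pow ((b - a) + (d - c)) dl0.
have wn : w n < dl.
  apply: le_lt_trans Hn; rewrite /w ler_pM2r ?invr_gt0 ?exprn_gt0//.
  by rewrite lerDl subr_ge0.
have hn : h n < dl.
  apply: le_lt_trans Hn; rewrite /h ler_pM2r ?invr_gt0 ?exprn_gt0//.
  by rewrite lerDr subr_ge0.
have [A1 A2 A3 A4 A5] := Pq n.
have /andP[s1 s2] := Hs n; have /andP[t1 t2] := Ht n.
have := Hdl _ _ _ _ A1 s1 s2 A2 A3 t1 t2 A4.
by rewrite ![_ + _ - _]addrAC !subrr !add0r => /(_ wn hn); rewrite leNgt A5.
Qed.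

End goursat.

(** * Closed forms on rectangles *)

Section green.
Variable R : realType.
Implicit Types (a b c d e s t x y : R).
Local Notation mu := (@lebesgue_measure R).
Local Notation RI a b f := (\int[mu]_(x in `[a, b]) (f x : R)).

Lemma integrable_itv a b (f : R -> R) : {in `[a, b], continuous f} ->
  mu.-integrable `[a, b] (EFin \o f).
Proof.
move=> cf; apply: continuous_compact_integrable; first exact: segment_compact.
by apply: continuous_in_subspaceT => x; rewrite inE => /cf.
Qed.

Lemma subitvP a b x y : a <= x -> y <= b -> {subset `[x, y] <= `[a, b]}.
Proof.
move=> ax yb z; rewrite !in_itv/= => /andP[xz zy].
by rewrite (le_trans ax) // (le_trans zy).
Qed.

Lemma Rintegral_split a m b (f : R -> R) : a <= m -> m <= b ->
  {in `[a, b], continuous f} -> RI a b f = RI a m f + RI m b f.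
Proof.
move=> am mb cf.
have := @Rintegral_itvB R f (BLeft a) (BRight b) m (integrable_itv cf).
rewrite !bnd_simp => /(_ am mb) /eqP; rewrite subr_eq => /eqP ->.
rewrite addrC Rintegral_itv_obnd_cbnd//.
apply: (@integrableS _ _ _ mu `[m, b]) => //.
  by apply: subset_itvr; rewrite bnd_simp.
apply: integrable_itv => x xm; apply: cf; exact: subitvP xm.
Qed.

Lemma Rintegral_itv_cst a b k : a <= b -> RI a b (fun=> k) = k * (b - a).
Proof.
move=> ab; rewrite Rintegral_cst//= lebesgue_measure_itv/= lte_fin.
by move: ab; rewrite le_eqVlt => /predU1P[->|->//]; rewrite ltxx subrr.
Qed.

Lemma Rintegral_near_cst a b k e (f : R -> R) : a <= b ->
  {in `[a, b], continuous f} -> (forall x, a <= x <= b -> `|f x - k| <= e) ->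
  `|RI a b f - k * (b - a)| <= e * (b - a).
Proof.
move=> ab cf fk.
have ic u : mu.-integrable `[a, b] (EFin \o (fun=> u : R)).
  by apply: integrable_itv => x _; exact: cst_continuous.
rewrite -(Rintegral_itv_cst k ab) -(@RintegralB _ _ _ mu) //; last exact: integrable_itv.
apply: le_trans (le_normr_Rintegral _ _) _ => //.
  apply: integrable_itv => x xab.
  by apply: cvgB; [exact: cf|exact: cvg_cst].
rewrite -(Rintegral_itv_cst e ab); apply: le_Rintegral => //.
  apply: (@integrable_itv a b (fun x => `|f x - k|)) => x xab.
  by apply: cvg_norm; apply: cvgB; [exact: cf|exact: cvg_cst].
Qed.

(* [P ds + Q dt] has at [(s, t)] a differential that is closed: the coefficient
   [p] is both dP/dt and dQ/ds. *)
Definition closed_form_at (P Q : R -> R -> R) s t := exists p u v, forall e, 0 < e ->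
  exists2 dl : R, 0 < dl & forall x y, `|x - s| < dl -> `|y - t| < dl ->
    `|P x y - P s t - (u * (x - s) + p * (y - t))| <= e * (`|x - s| + `|y - t|) /\
    `|Q x y - Q s t - (p * (x - s) + v * (y - t))| <= e * (`|x - s| + `|y - t|).

Lemma continuous_lipschitz_at (f : R -> R) s dl k : 0 < dl ->
  (forall x, `|x - s| < dl -> `|f x - f s| <= k * `|x - s|) ->
  {for s, continuous f}.
Proof.
move=> dl0 fk; apply/cvgrPdist_le => e e0 /=.
have k0 : 0 < `|k| + 1 by rewrite ltr_wpDl.
near=> x; rewrite distrC.
have xs : `|x - s| < dl.
  by rewrite distrC; near: x; apply: cvgr_dist_lt.
apply: le_trans (fk _ xs) _.
have : `|x - s| <= e / (`|k| + 1).
  by rewrite distrC; near: x; apply: cvgr_dist_le => //; rewrite divr_gt0.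
rewrite ler_pdivlMr// mulrC; apply: le_trans; rewrite ler_wpM2r//.
by rewrite (le_trans (ler_norm _))// lerDl.
Unshelve. all: by end_near. Qed.

(** [P] is only integrated along horizontal sides and [Q] along vertical ones, so continuity in one
    variable is enough. *)
Lemma closed_form_continuous P Q s t : closed_form_at P Q s t ->
  {for s, continuous (P ^~ t)} /\ {for t, continuous (Q s)}.
Proof.
move=> [p [u [v H]]]; have [dl dl0 Hdl] := H 1 ltr01; split.
  apply: (continuous_lipschitz_at (dl := dl) (k := 1 + `|u|)) => // x xs.
  have := Hdl x t xs; rewrite subrr normr0 => /(_ dl0) [+ _].
  rewrite mulr0 !addr0 mul1r => h.
  rewrite -[leLHS](_ : `|(P x t - P s t - u * (x - s)) + u * (x - s)| = _); last first.
    by congr `|_|; ring.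
  by rewrite (le_trans (ler_normD _ _))// mulrDl mul1r lerD// normrM.
apply: (continuous_lipschitz_at (dl := dl) (k := 1 + `|v|)) => // x xs.
have := Hdl s x; rewrite subrr normr0 => /(_ dl0 xs) [_ +].
rewrite mulr0 !add0r mul1r => h.
rewrite -[leLHS](_ : `|(Q s x - Q s t - v * (x - t)) + v * (x - t)| = _); last first.
  by congr `|_|; ring.
by rewrite (le_trans (ler_normD _ _))// mulrDl mul1r lerD// normrM.
Qed.

Lemma dist_le_length (x y s z : R) : x <= s -> s <= y -> x <= z -> z <= y ->
  `|z - s| <= y - x.
Proof. by move=> *; rewrite ler_norml; apply/andP; split; lra. Qed.

Lemma add_quarters (e n p q : R) : p <= e / 4 * n -> q <= e / 4 * n ->
  p + q <= e / 2 * n.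
Proof. by move=> *; lra. Qed.

(** The coefficients are differentiable at each point but not C^1, so the double integral of Green's
    formula is replaced by bisection. On a small rectangle around (s, t) the linear parts of [P] and
    [Q] contribute nothing to the circulation and the remainders are small against the squared
    half-perimeter. *)
Lemma green_rectangle (P Q : R -> R -> R) a b c d : a <= b -> c <= d ->
  (forall s t, a <= s <= b -> c <= t <= d -> closed_form_at P Q s t) ->
  RI a b (P ^~ c) - RI a b (P ^~ d) + (RI c d (Q b) - RI c d (Q a)) = 0.
Proof.
move=> ab cd PQ.
pose B x y u v := RI x y (P ^~ u) - RI x y (P ^~ v) + (RI u v (Q y) - RI u v (Q x)).
have cP x y u : a <= x -> y <= b -> c <= u <= d -> {in `[x, y], continuous (P ^~ u)}.
  move=> ax yb ucd z; rewrite in_itv/= => /andP[xz zy].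
  have zab : a <= z <= b by rewrite (le_trans ax) //= (le_trans zy).
  by have [] := closed_form_continuous (PQ z u zab ucd).
have cQ x u v : c <= u -> v <= d -> a <= x <= b -> {in `[u, v], continuous (Q x)}.
  move=> cu vd xab z; rewrite in_itv/= => /andP[uz zv].
  have zcd : c <= z <= d by rewrite (le_trans cu) //= (le_trans zv).
  by have [] := closed_form_continuous (PQ x z xab zcd).
apply: (@rectangle_bisection R B a b c d ab cd).
- move=> x m y u v ax xm my yb cu uv vd; rewrite /B.
  have ucd : c <= u <= d by rewrite cu (le_trans uv).
  have vcd : c <= v <= d by rewrite vd (le_trans cu).
  rewrite (Rintegral_split xm my (cP _ _ _ ax yb ucd)).
  rewrite (Rintegral_split xm my (cP _ _ _ ax yb vcd)).
  by ring.
- move=> x y u m v ax xy yb cu um mv vd; rewrite /B.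
  have xab : a <= x <= b by rewrite ax (le_trans xy).
  have yab : a <= y <= b by rewrite yb (le_trans ax).
  rewrite (Rintegral_split um mv (cQ _ _ _ cu vd xab)).
  rewrite (Rintegral_split um mv (cQ _ _ _ cu vd yab)).
  by ring.
move=> s t sab tcd e e0.
have [p [k1 [k2 H]]] := PQ s t sab tcd.
have e4 : 0 < e / 4 by rewrite divr_gt0.
have [dl dl0 Hdl] := H _ e4.
exists dl => // x y u v ax xs sy yb cu ut tv vd yx vu.
have xy : x <= y by exact: le_trans sy.
have uv : u <= v by exact: le_trans tv.
have ucd : c <= u <= d by rewrite cu (le_trans uv).
have vcd : c <= v <= d by rewrite vd (le_trans cu).
have xab : a <= x <= b by rewrite ax (le_trans xy).
have yab : a <= y <= b by rewrite yb (le_trans ax).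
pose z := (y - x) + (v - u).
have uu : u <= u <= v by rewrite lexx.
have vv : u <= v <= v by rewrite lexx uv.
have xx : x <= x <= y by rewrite lexx.
have yy : x <= y <= y by rewrite lexx xy.
have nearE z1 z2 : x <= z1 <= y -> u <= z2 <= v ->
   `|z1 - s| < dl /\ `|z2 - t| < dl /\ `|z1 - s| + `|z2 - t| <= z.
  move=> /andP[A1 A2] /andP[A3 A4]; have B1 := dist_le_length xs sy A1 A2.
  have B2 := dist_le_length ut tv A3 A4.
  split; [exact: le_lt_trans yx|split; [exact: le_lt_trans vu|exact: lerD]].
(* The coefficient [k1] cancels between the lower and the upper side; two errors of e / 4 remain. *)
have hP z1 : x <= z1 <= y -> `|P z1 u - P z1 v - p * (u - v)| <= e / 2 * z.
  move=> z1xy.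
  have [A1 [A2 A3]] := nearE z1 u z1xy uu.
  have [A4 [A5 A6]] := nearE z1 v z1xy vv.
  have [C1 _] := Hdl _ _ A1 A2; have [C2 _] := Hdl _ _ A1 A5.
  rewrite (_ : _ - _ = (P z1 u - P s t - (k1 * (z1 - s) + p * (u - t))) -
     (P z1 v - P s t - (k1 * (z1 - s) + p * (v - t)))); last by ring.
  rewrite (le_trans (ler_normB _ _))//.
  have D1 := le_trans C1 (ler_wpM2l (ltW e4) A3).
  have D2 := le_trans C2 (ler_wpM2l (ltW e4) A6).
  exact: add_quarters D1 D2.
have hQ z1 : u <= z1 <= v -> `|Q y z1 - Q x z1 - p * (y - x)| <= e / 2 * z.
  move=> z1uv.
  have [A1 [A2 A3]] := nearE x z1 xx z1uv.
  have [A4 [A5 A6]] := nearE y z1 yy z1uv.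
  have [_ C1] := Hdl _ _ A1 A2; have [_ C2] := Hdl _ _ A4 A5.
  rewrite (_ : _ - _ = (Q y z1 - Q s t - (p * (y - s) + k2 * (z1 - t))) -
     (Q x z1 - Q s t - (p * (x - s) + k2 * (z1 - t)))); last by ring.
  rewrite (le_trans (ler_normB _ _))//.
  have D1 := le_trans C1 (ler_wpM2l (ltW e4) A3).
  have D2 := le_trans C2 (ler_wpM2l (ltW e4) A6).
  exact: add_quarters D2 D1.
rewrite /B -!(@RintegralB _ _ _ mu)//; try by apply: integrable_itv; (exact: cP || exact: cQ).
have I1 : `|RI x y (fun z1 => P z1 u - P z1 v) - p * (u - v) * (y - x)| <= e / 2 * z * (y - x).
  apply: Rintegral_near_cst => // z1 z1xy.
  by apply: (@continuousB _ R^o R^o (P ^~ u) (P ^~ v)); apply: (cP x y).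
have I2 : `|RI u v (fun z1 => Q y z1 - Q x z1) - p * (y - x) * (v - u)| <= e / 2 * z * (v - u).
  apply: Rintegral_near_cst => // z1 z1xy.
  by apply: (@continuousB _ R^o R^o (Q y) (Q x)); apply: (cQ _ u v).
(* The main terms p (u - v) (y - x) and p (y - x) (v - u) cancel, because [P] and [Q] share the
   coefficient [p]. *)
rewrite (_ : _ + _ = (RI x y (fun z1 => P z1 u - P z1 v) - p * (u - v) * (y - x)) +
   (RI u v (fun z1 => Q y z1 - Q x z1) - p * (y - x) * (v - u))); last by ring.
rewrite (le_trans (ler_normD _ _))//.
apply: le_trans (lerD I1 I2) _.
rewrite (_ : _ + _ = e / 2 * z ^+ 2); last by rewrite /z; ring.
by rewrite ler_wpM2r ?sqr_ge0// ler_pdivrMr// ler_peMr ?(ltW e0)// ler1n.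
Qed.
End green.

Lemma derivable_expansion (K : numFieldType) (f : K^o -> K^o) (x : K) :
  derivable f x 1 <->
  exists l : K, forall e : K, 0 < e -> exists2 d : K, 0 < d &
    forall h : K, `|h| < d -> `|f (x + h) - f x - l * h| <= e * `|h|.
Proof.
split=> [df|[l Hl]].
  exists ('D_1 f x) => e e0.
  have /cvgrPdist_le /(_ e e0) : h^-1 *: (f (h *: (1 : K^o) + x) - f x) @[h --> 0^'] --> 'D_1 f x.
    exact: df.
  move=> /(@nbhs_ballP K K^o) [d /= d0 Hd].
  exists d => // h hd.
  have [->|h0] := eqVneq h 0; first by rewrite addr0 subrr mulr0 subr0 normr0 mulr0.
  have := Hd h; rewrite /ball /= sub0r normrN => /(_ hd h0).
  rewrite /GRing.scale /= mulr1 [h + x]addrC -(ler_pM2r (_ : 0 < `|h|)) ?normr_gt0//.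
  rewrite -normrM mulrBl mulrAC mulVf// mul1r distrC.
  by congr (`|_| <= _).
apply/cvg_ex; exists (l : K^o); apply/cvgrPdist_le => e e0.
have [d d0 Hd] := Hl e e0.
apply/(@nbhs_ballP K K^o); exists d => //= h.
rewrite /ball /= sub0r normrN => hd h0.
rewrite /GRing.scale /= mulr1 [h + x]addrC -(ler_pM2r (_ : 0 < `|h|)) ?normr_gt0//.
rewrite -normrM mulrBl mulrAC mulVf// mul1r distrC.
exact: Hd.
Qed.

(** * Modulus, complex derivative and exponential *)

Section complex_basics.
Variable R : realType.
Local Notation C := R[i].
Implicit Types (z w h l : C) (f g : C -> C).

Lemma normcR (r : R) : normc r%:C = `|r|.
Proof. by rewrite /= expr0n addr0 sqrtr_sqr. Qed.

Lemma normCE z : `|z| = (normc z)%:C. Proof. by []. Qed.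

Lemma normc_ge0 z : 0 <= normc z.
Proof. by case: z => a b; exact: sqrtr_ge0. Qed.
Hint Extern 0 (is_true (0 <= normc _)) => exact: normc_ge0 : core.

Lemma normcB z w : normc (z - w) = normc (w - z).
Proof. by rewrite -normcN opprB. Qed.

Lemma normcMr (r : R) z : normc (r%:C * z) = `|r| * normc z.
Proof. by rewrite normcM normcR. Qed.

Lemma normc_sqr z : normc z ^+ 2 = complex.Re z ^+ 2 + complex.Im z ^+ 2.
Proof. by case: z => a b; rewrite /= sqr_sqrtr// addr_ge0 ?sqr_ge0. Qed.

Lemma Re_le_normc z : `|complex.Re z| <= normc z.
Proof.
by case: z => a b /=; rewrite -sqrtr_sqr ler_wsqrtr// lerDl sqr_ge0.
Qed.

Lemma Im_le_normc z : `|complex.Im z| <= normc z.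
Proof.
by case: z => a b /=; rewrite -sqrtr_sqr ler_wsqrtr// lerDr sqr_ge0.
Qed.

Lemma normc_le_ReIm z : normc z <= `|complex.Re z| + `|complex.Im z|.
Proof.
rewrite -ler_sqr ?nnegrE ?addr_ge0// normc_sqr sqrrD !real_normK ?num_real//.
by rewrite lerD2r lerDl mulrn_wge0// mulr_ge0.
Qed.

Lemma normc_triangle z w v : normc (z - v) <= normc (z - w) + normc (w - v).
Proof. by rewrite (le_trans _ (le_normcD _ _))// addrA subrK. Qed.

Lemma normc_sub_ge z w : normc z - normc w <= normc (z - w).
Proof. by rewrite lerBlDr (le_trans _ (le_normcD _ _))// subrK. Qed.

Lemma normcX z n : normc (z ^+ n) = normc z ^+ n.
Proof. by elim: n => [|n IH]; rewrite ?expr0 ?normc1// !exprS normcM IH. Qed.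

Lemma normc_eq0 z : (normc z == 0) = (z == 0).
Proof.
by apply/eqP/eqP => [/eq0_normc//|->]; exact: normc0.
Qed.

Lemma normc_gt0 z : z != 0 -> 0 < normc z.
Proof. by move=> z0; rewrite lt_def normc_eq0 z0 normc_ge0. Qed.

Lemma gt0_complexR (e : C) : 0 < e -> exists2 r : R, 0 < r & e = r%:C.
Proof.
case: e => a b; rewrite ltcE /= => /andP[/eqP -> a0].
by exists a.
Qed.

Lemma nbhs_normcP z (A : set C) :
  nbhs (z : C^o) A <-> exists2 e : R, 0 < e & forall w, normc (w - z) < e -> A w.
Proof.
split=> [/(@nbhs_ballP C C^o) [e /= e0 H]|[e e0 H]].
  have [r r0 er] := gt0_complexR e0; exists r => // w wz; apply: H.
  by rewrite /ball /= er normCE ltcR normcB.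
apply/(@nbhs_ballP C C^o); exists e%:C; first by rewrite /= ltcR.
by move=> w; rewrite /ball /= normCE ltcR normcB; exact: H.
Qed.

(** Complex differentiability with real tolerances. In [R[i]] a positive element is a positive real
    embedded in the plane, which [derivable_cderiv] unwraps once and for all. *)
Definition cderiv f z l := forall e : R, 0 < e -> exists2 d : R, 0 < d &
  forall h, normc h < d -> normc (f (z + h) - f z - l * h) <= e * normc h.

Lemma derivable_cderiv f z :
  derivable (f : C^o -> C^o) z 1 <-> exists l, cderiv f z l.
Proof.
rewrite derivable_expansion; split=> -[l H]; exists l => e e0.
  have [|d] := H e%:C; first by rewrite ltcR.
  move/gt0_complexR=> [r r0 ->] {}H; exists r => // h hr.
  have := H h; rewrite !normCE ltcR => /(_ hr).
  by rewrite -rmorphM lecR.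
have [r r0 ->] := gt0_complexR e0.
have [d d0 {}H] := H r r0; exists d%:C; first by rewrite ltcR.
by move=> h; rewrite !normCE ltcR -rmorphM lecR; exact: H.
Qed.

Lemma cderiv_continuous f z l : cderiv f z l -> forall e : R, 0 < e ->
  exists2 d : R, 0 < d & forall w, normc (w - z) < d -> normc (f w - f z) < e.
Proof.
move=> /(_ 1 ltr01) [d d0 H] e e0.
have K0 : 0 < normc l + 1 by rewrite ltr_wpDl.
exists (Num.min d (e / (normc l + 1))).
  by rewrite lt_min d0 divr_gt0.
move=> w; rewrite lt_min => /andP[wd]; rewrite ltr_pdivlMr// => we.
have := H _ wd; rewrite [z + _]addrC subrK mul1r => H1.
rewrite -[f w - f z](subrK (l * (w - z))); apply: le_lt_trans (le_normcD _ _) _.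
by apply: le_lt_trans we; rewrite normcM [leRHS]mulrDr mulr1 [leRHS]addrC [normc l * _]mulrC lerD2r.
Qed.

(* [cexp s t = e^(s + i t)]: the mean value property is derived for the function
   [f (cexp s t)], which turns circles into segments. *)
Definition cexp (s t : R) : C := (expR s)%:C * circle_val (expi t).

Lemma normc_expiE (t : R) : normc (circle_val (expi t)) = 1.
Proof. exact/eqP/circle_valP. Qed.

Lemma normc_circle (u : circle R) : normc (circle_val u) = 1.
Proof. exact/eqP/circle_valP. Qed.

Lemma normc_cexp s t : normc (cexp s t) = expR s.
Proof. by rewrite normcMr normc_expiE mulr1 ger0_norm// expR_ge0. Qed.

Lemma expiD (s t : R) : circle_val (expi (s + t)) = circle_val (expi s) * circle_val (expi t).
Proof.
by apply/eqP; rewrite eq_complex /= cosD sinD [sin s * cos t + _]addrC !eqxx.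
Qed.

Lemma cexpD (s t s' t' : R) : cexp (s + s') (t + t') = cexp s t * cexp s' t'.
Proof. by rewrite /cexp expRD expiD rmorphM mulrACA. Qed.

Lemma real_expansion (f : R -> R) (l e : R) : is_derive (0 : R^o) 1 (f : R^o -> R^o) l -> 0 < e ->
  exists2 d : R, 0 < d & forall h : R, `|h| < d -> `|f h - f 0 - l * h| <= e * `|h|.
Proof.
move=> df e0.
have /cvgrPdist_le /(_ e e0) : h^-1 *: (f (h *: (1 : R^o) + 0) - f 0) @[h --> (0:R)^'] --> l.
  by have := @ex_derive _ _ _ _ _ _ _ df; rewrite /derivable -(@derive_val _ _ _ _ _ _ _ df).
move=> /(@nbhs_ballP R R^o) [d /= d0 Hd].
exists d => // h hd.
have [->|h0] := eqVneq h 0; first by rewrite subrr mulr0 subr0 normr0 mulr0.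
have := Hd h; rewrite /ball /= sub0r normrN => /(_ hd h0).
rewrite /GRing.scale /= mulr1 addr0 -(ler_pM2r (_ : 0 < `|h|)) ?normr_gt0//.
by rewrite -normrM mulrBl mulrAC mulVf// mul1r distrC.
Qed.

Lemma cexp_expansion (e : R) : 0 < e -> exists2 d : R, 0 < d & forall a b : R,
  `|a| < d -> `|b| < d -> normc (cexp a b - 1 - (a +i* b)) <= e * (`|a| + `|b|).
Proof.
move=> e0.
(* The three terms of the decomposition below cost e/6 |a|, 4 e/6 |b| and e/6 |b|. The bound by 1
   gives |e^a - 1| <= 2 |a| and e^a <= 2. *)
have e60 : 0 < Num.min 1 (e / 6) by rewrite lt_min ltr01 divr_gt0.
have [d1 d10 H1] := real_expansion (is_derive_expR (0 : R)) e60.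
have [d2 d20 H2] := real_expansion (is_derive_cos (0 : R)) e60.
have [d3 d30 H3] := real_expansion (is_derive_sin (0 : R)) e60.
move: e60 H1 H2 H3; set m := Num.min 1 (e / 6) => m0.
have m1 : m <= 1 by rewrite ge_min lexx.
have m6 : m <= e / 6 by rewrite ge_min lexx orbT.
rewrite expR0 cos0 sin0 => H1 H2 H3.
pose d := Num.min (Num.min d1 d2) (Num.min d3 (m / 2)).
have d0 : 0 < d by rewrite !lt_min d10 d20 d30 divr_gt0.
exists d => // a b; rewrite !lt_min => /andP[/andP[a1 _] /andP[_ am]].
move=> /andP[/andP[_ b2] /andP[b3 bm]].
have {}H1 := H1 _ a1; have {}H2 := H2 _ b2; have {}H3 := H3 _ b3.
have ea : `|expR a - 1| <= 2 * `|a|.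
  rewrite -[expR a - 1](subrK (1 * a)) (le_trans (ler_normD _ _))// mul1r.
  rewrite mul1r in H1; apply: le_trans (lerD H1 (lexx _)) _.
  by rewrite mulr_natl mulr2n lerD2r ler_piMl.
have ea2 : `|expR a| <= 2.
  rewrite -[expR a](subrK 1) (le_trans (ler_normD _ _))// normr1.
  apply: le_trans (lerD ea (lexx _)) _; lra.
(* e^(a+ib) - 1 - (a+ib) = (e^a - 1 - a) + e^a (e^(ib) - 1 - ib) + (e^a - 1) ib. *)
rewrite (_ : _ - _ = (expR a - 1 - 1 * a)%:C +
  (expR a)%:C * ((cos b - 1 - - 0 * b) +i* (sin b - 0 - 1 * b)) +
  (expR a - 1)%:C * (0 +i* b)); last first.
  by apply/eqP; rewrite eq_complex /=; apply/andP; split; apply/eqP; ring.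
apply: le_trans (le_normcD _ _) _; apply: le_trans (lerD (le_normcD _ _) (lexx _)) _.
rewrite !normcMr normcR.
have B1 : normc ((cos b - 1 - - 0 * b) +i* (sin b - 0 - 1 * b)) <= 2 * (m * `|b|).
  apply: le_trans (normc_le_ReIm _) _; rewrite /= mulr_natl mulr2n.
  by apply: lerD; [exact: H2|exact: H3].
have B2 : normc (0 +i* b) = `|b| by rewrite /= expr0n add0r sqrtr_sqr.
rewrite B2.
have C1 : `|expR a - 1 - 1 * a| <= e / 6 * `|a|.
  by apply: le_trans H1 _; rewrite ler_wpM2r.
have C2 : `|expR a| * normc ((cos b - 1 - - 0 * b) +i* (sin b - 0 - 1 * b)) <= e / 6 * 4 * `|b|.
  apply: le_trans (_ : 2 * (2 * (m * `|b|)) <= _).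
    by apply: ler_pM.
  rewrite !mulrA -[2 * 2]natrM ler_wpM2r//; lra.
have C3 : `|expR a - 1| * `|b| <= e / 6 * `|b|.
  rewrite ler_wpM2r// (le_trans ea)//; lra.
apply: le_trans (lerD (lerD C1 C2) C3) _.
have ea0 : 0 <= e * `|a| by rewrite mulr_ge0// ltW.
have eb0 : 0 <= e * `|b| by rewrite mulr_ge0// ltW.
lra.
Qed.

End complex_basics.
#[global] Hint Extern 0 (is_true (0 <= normc _)) => exact: normc_ge0 : core.

(** * Mean value property by Cauchy's theorem in logarithmic coordinates *)

Section mean_value.
Variable R : realType.
Local Notation C := R[i].
Implicit Types (z w h l : C) (f g : C -> C) (s t : R).
Local Notation mu := (@lebesgue_measure R).
Local Notation RI a b f := (\int[mu]_(x in `[a, b]) (f x : R)).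

(** With w = s + it the form is the imaginary part of f(e^w) dw. Its closedness is the
    Cauchy-Riemann equations for f(e^w), whose derivative is l e^w. *)
Lemma closed_form_cexp f s t l : cderiv f (cexp s t) l ->
  closed_form_at (fun x y => complex.Im (f (cexp x y)))
                 (fun x y => complex.Re (f (cexp x y))) s t.
Proof.
move=> fl; pose r := expR s; have r0 : 0 < r by exact: expR_gt0.
exists (complex.Re (l * cexp s t)), (complex.Im (l * cexp s t)),
  (- complex.Im (l * cexp s t)) => e e0.
have e10 : 0 < e / (4 * r) by rewrite divr_gt0// mulr_gt0.
have [d1 d10 H1] := fl _ e10.
have k0 : 0 < 2 * (normc l * r + 1).
  by rewrite mulr_gt0// ltr_wpDl// mulr_ge0// ltW.
have e20 : 0 < Num.min 1 (e / (2 * (normc l * r + 1))).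
  by rewrite lt_min ltr01 divr_gt0.
have [d2 d20 H2] := cexp_expansion e20.
have d30 : 0 < d1 / (4 * r) by rewrite divr_gt0// mulr_gt0.
exists (Num.min d2 (d1 / (4 * r))); first by rewrite lt_min d20.
move=> x y; rewrite !lt_min => /andP[xs1 xs2] /andP[yt1 yt2].
set a := x - s in xs1 xs2 *; set b := y - t in yt1 yt2 *.
have Ez : cexp x y = cexp s t * cexp a b.
  by rewrite -cexpD /a /b; congr cexp; ring.
have H2ab := H2 _ _ xs1 yt1.
set n := `|a| + `|b| in H2ab *.
have n0 : 0 <= n by rewrite addr_ge0.
have nE : normc (a +i* b) <= n by exact: normc_le_ReIm.
have E1 : normc (cexp a b - 1) <= 2 * n.
  rewrite -[cexp a b - 1](subrK (a +i* b)) (le_trans (le_normcD _ _))//.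
  rewrite mulr_natl mulr2n; apply: lerD => //; apply: le_trans H2ab _.
  by rewrite ler_piMl// ge_min lexx.
have Ed : cexp x y = cexp s t + cexp s t * (cexp a b - 1) by rewrite Ez; ring.
have hd : normc (cexp s t * (cexp a b - 1)) <= r * (2 * n).
  by rewrite normcM normc_cexp ler_wpM2l// ltW.
have hd1 : normc (cexp s t * (cexp a b - 1)) < d1.
  apply: le_lt_trans hd _; rewrite mulrA -ltr_pdivlMl ?mulr_gt0//.
  apply: lt_le_trans (ltrD xs2 yt2) _.
  by rewrite le_eqVlt; apply/orP; left; apply/eqP; field; rewrite gt_eqF.
have main : normc (f (cexp x y) - f (cexp s t) - l * cexp s t * (a +i* b)) <= e * n.
  rewrite (_ : _ - _ = (f (cexp x y) - f (cexp s t) - l * (cexp s t * (cexp a b - 1))) +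
     l * cexp s t * (cexp a b - 1 - (a +i* b))); last by ring.
  apply: le_trans (le_normcD _ _) _.
  have A1 : normc (f (cexp x y) - f (cexp s t) - l * (cexp s t * (cexp a b - 1))) <= e / 2 * n.
    rewrite Ed; apply: le_trans (H1 _ hd1) _.
    apply: le_trans (ler_wpM2l (ltW e10) hd) _.
    by rewrite le_eqVlt; apply/orP; left; apply/eqP; field; rewrite gt_eqF.
  have A2 : normc (l * cexp s t * (cexp a b - 1 - (a +i* b))) <= e / 2 * n.
    rewrite normcM [normc (l * _)]normcM normc_cexp -/r.
    apply: le_trans (ler_wpM2l _ H2ab) _; first by rewrite mulr_ge0// ltW.
    rewrite mulrA ler_wpM2r//.
    apply: le_trans (_ : (normc l * r) * (e / (2 * (normc l * r + 1))) <= _).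
      rewrite ler_wpM2l//; first by rewrite mulr_ge0// ltW.
      by rewrite ge_min lexx orbT.
    rewrite mulrA ler_pdivrMr// (_ : e / 2 * _ = e * (normc l * r + 1)); last by field.
    by rewrite mulrC ler_wpM2l ?(ltW e0)// lerDl.
  apply: le_trans (lerD A1 A2) _.
  by rewrite -mulrDl -splitr.
have Eab : l * cexp s t * (a +i* b) =
  (complex.Re (l * cexp s t) * a - complex.Im (l * cexp s t) * b) +i*
  (complex.Im (l * cexp s t) * a + complex.Re (l * cexp s t) * b).
  case: (l * cexp s t) => p q /=.
  by apply/eqP; rewrite eq_complex /= [p * b + _]addrC !eqxx.
rewrite Eab in main; split.
  apply: le_trans main; apply: le_trans (Im_le_normc _).
  by case: (f (cexp x y)) => ? ?; case: (f (cexp s t)) => ? ?.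
apply: le_trans main; apply: le_trans (Re_le_normc _).
by case: (f (cexp x y)) => ? ?; case: (f (cexp s t)) => ? ?; rewrite /= mulNr.
Qed.

Lemma expi2pi s : cexp s (pi *+ 2) = cexp s 0.
Proof.
have H := @sin2pi R; have H' := @cos2pi R.
by congr (_ * _); apply/eqP; rewrite eq_complex /= H H' cos0 sin0 !eqxx.
Qed.

Lemma cexp_ln (r : R) t : 0 < r -> cexp (ln r) t = r%:C * circle_val (expi t).
Proof. by move=> r0; rewrite /cexp lnK. Qed.

Lemma holomorphic_cderiv f z : holomorphic_disc f -> normc z < 1 -> exists l, cderiv f z l.
Proof. by move=> hf z1; apply/derivable_cderiv; exact: hf. Qed.

(** Cauchy's theorem on the rectangle [s1, ln r] x [0, 2 pi]: the sides t = 0 and t = 2 pi cancel by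
    periodicity, so the integral of Re f is the same on the circles of radii e^s1 and r. On a circle
    close to 0 it is nearly 2 pi Re f(0). *)
Lemma mean_value_itv f (r : R) : holomorphic_disc f -> 0 <= r < 1 ->
  RI 0 (pi *+ 2) (fun t => complex.Re (f (r%:C * circle_val (expi t)))) =
  complex.Re (f 0) * (pi *+ 2).
Proof.
move=> hf /andP[]; rewrite le_eqVlt => /predU1P[<- _|r0 r1].
  under eq_Rintegral do rewrite mul0r.
  by rewrite Rintegral_itv_cst ?subr0// ltW// gt0_2pi.
have p0 := ltW (@gt0_2pi R).
have s0 : ln r < 0 by rewrite ln_lt0// r0.
pose Q s t := complex.Re (f (cexp s t)).
have cf s t : s < 0 -> closed_form_at (fun x y => complex.Im (f (cexp x y))) Q s t.
  move=> sn; have [|l fl] := @holomorphic_cderiv f (cexp s t) hf; last exact: closed_form_cexp fl.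
  by rewrite normc_cexp expR_lt1.
transitivity (RI 0 (pi *+ 2) (Q (ln r))).
  by apply: eq_Rintegral => t _; rewrite /Q cexp_ln.
apply/eqP; rewrite -subr_eq0 -normr_le0; apply/ler_addgt0Pl => e e0; rewrite addr0.
have e10 : 0 < e / (pi *+ 2) by rewrite divr_gt0// gt0_2pi.
have [l0 fl0] : exists l, cderiv f 0 l by apply: holomorphic_cderiv; rewrite ?normc0.
have [d d0 Hd] := cderiv_continuous fl0 e10.
(* On the inner circle, of radius e^s1 <= d / 2, [f] is within e / (2 pi) of [f 0]. *)
pose s1 := Num.min (ln r) (ln (d / 2)).
have s1r : s1 <= ln r by rewrite ge_min lexx.
have s1d : expR s1 < d.
  apply: le_lt_trans (_ : d / 2 < d); last by lra.
  rewrite -[leRHS]lnK ?posrE ?divr_gt0// ler_expR ge_min lexx orbT//.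
have := @green_rectangle R (fun x y => complex.Im (f (cexp x y))) Q s1 (ln r) 0 (pi *+ 2) s1r p0.
move=> /(_ _)/wrap[].
  by move=> s t /andP[_ ss] _; apply: cf; exact: le_lt_trans s0.
under [X in _ - X]eq_Rintegral do rewrite expi2pi.
rewrite subrr add0r => /eqP; rewrite subr_eq0 => /eqP ->.
have : e = e / (pi *+ 2) * (pi *+ 2 - 0).
  by rewrite subr0 divfK// gt_eqF// gt0_2pi.
move=> ->; rewrite -{1}[pi *+ 2 in X in _ * X]subr0; apply: Rintegral_near_cst => //.
  move=> t _; have [|_ //] := closed_form_continuous (cf s1 t _).
  exact: le_lt_trans s0.
move=> t _; apply/ltW; have := Hd (cexp s1 t); rewrite subr0 normc_cexp => /(_ s1d).
apply: le_lt_trans; apply: le_trans (Re_le_normc _).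
by rewrite /Q; case: (f (cexp _ _)) => ? ?; case: (f 0).
Qed.

End mean_value.

(** * Continuity, angles and compactness on the circle *)

Section circle_facts.
Variable R : realType.
Local Notation C := R[i].
Implicit Types (z w h l : C) (f g : C -> C) (s t : R) (u : circle R).

Lemma circle_eq u v : circle_val u = circle_val v -> u = v.
Proof. exact: val_inj. Qed.

(** [circle R] carries a sigma-algebra but no topology, so continuity is expressed through chord
    lengths. *)
Definition circle_continuous (k : circle R -> R) := forall u (e : R), 0 < e ->
  exists2 d : R, 0 < d & forall v, normc (circle_val v - circle_val u) < d ->
    `|k v - k u| < e.

Lemma measurable_circle_continuous k : circle_continuous k ->
  measurable_fun setT k.
Proof.
move=> ck; apply: (@measurability _ _ _ _ setT k _ (RGenOpens.measurableE R)).
move=> _ [_ [a [b ->]] <-]; rewrite setTI.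
apply: sub_sigma_algebra.
(* A union of open discs whose trace on the circle is mapped into ]a, b[; this trace is the whole
   preimage, by continuity at the centres. *)
pose U := [set w : C^o | exists u (d : R), normc (w - circle_val u) < d /\
  forall v, normc (circle_val v - circle_val u) < d -> a < k v < b].
exists U.
  rewrite /= openE => w [u [d [wd H]]]; apply/nbhs_normcP.
  exists (d - normc (w - circle_val u)); first by rewrite subr_gt0.
  move=> w' w'w; exists u, d; split => //.
  by apply: le_lt_trans (normc_triangle _ w _) _; rewrite -ltrBrDr.
apply/seteqP; split => u /=.
  move=> [v [d [ud H]]]; rewrite in_itv/=; exact: H.
rewrite in_itv/= => /andP[ak kb].
have e0 : 0 < Num.min (k u - a) (b - k u) by rewrite lt_min !subr_gt0 ak.
have [d d0 H] := ck u _ e0; exists u, d; split.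
  by rewrite subrr normc0.
by move=> v /H; rewrite lt_min !ltr_norml => /andP[/andP[A1 A2] /andP[A3 A4]]; lra.
Qed.

(** The angle in [0, 2 pi[, spelled out with [acos] on half circles so that its measurability can be
    read off the formula. *)
Definition arg u : R :=
  let x := complex.Re (circle_val u) in let y := complex.Im (circle_val u) in
  if 0 < y then acos x else if y < 0 then pi *+ 2 - acos x
  else if 0 < x then 0 else pi.

Lemma circle_sqr u : complex.Re (circle_val u) ^+ 2 + complex.Im (circle_val u) ^+ 2 = 1.
Proof. by rewrite -normc_sqr normc_circle expr1n. Qed.

Lemma circle_Re_bound u : -1 <= complex.Re (circle_val u) <= 1.
Proof. by rewrite -ler_norml (le_trans (Re_le_normc _))// normc_circle. Qed.

Lemma expi_arg u : expi (arg u) = u.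
Proof.
apply: circle_eq; apply/eqP; rewrite eq_complex /=.
have := circle_sqr u; have := circle_Re_bound u; rewrite /arg.
set x := complex.Re _; set y := complex.Im _ => xb xy.
have acosx : cos (acos x) = x by rewrite acosK// in_itv.
have sinx : sin (acos x) = `|y|.
  by rewrite sin_acos// -xy [_ + y ^+ 2]addrC addrK sqrtr_sqr.
have [y0|y0|y0] := ltgtP y 0.
- rewrite cosB sinB cos2pi sin2pi acosx sinx ltr0_norm// .
  by rewrite mul1r mul0r addr0 mul0r mul1r sub0r opprK !eqxx.
- by rewrite acosx sinx gtr0_norm// !eqxx.
move: xy; rewrite y0 expr0n addr0 => /eqP; rewrite sqrf_eq1 => /orP[] /eqP ->.
  by rewrite ltr01 cos0 sin0 !eqxx.
by rewrite ltr0N1 cospi sinpi !eqxx.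
Qed.

Lemma arg_bound u : 0 <= arg u <= pi *+ 2.
Proof.
have := acos_ge0 (circle_Re_bound u); have := acos_lepi (circle_Re_bound u).
have := @pi_ge0 R; rewrite /arg.
case: ifP => _; first lra.
case: ifP => _; first lra.
case: ifP => _; lra.
Qed.

Lemma arg_expi t : 0 < t -> t < pi *+ 2 -> t != pi -> arg (expi t) = t.
Proof.
move=> t0 t2 tp; rewrite /arg /=.
have [tpi|tpi] := ltP t pi.
  by rewrite sin_gt0_pi ?t0// cosK// in_itv/= !ltW.
have tpi' : pi < t by rewrite lt_def tp.
have st : sin t < 0.
  rewrite -[t](subrK pi) sinDpi oppr_lt0; apply: sin_gt0_pi; rewrite subr_gt0 tpi' /=; lra.
rewrite ltNge (ltW st) /= st.
rewrite (_ : cos t = cos (pi *+ 2 - t)).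
  rewrite cosK; first by lra.
  by rewrite in_itv/=; apply/andP; split; lra.
by rewrite cosB cos2pi sin2pi mul1r mul0r addr0.
Qed.

Lemma polar_form z : exists2 t, 0 <= t <= pi *+ 2 & z = (normc z)%:C * circle_val (expi t).
Proof.
have [->|z0] := eqVneq z 0.
  by exists 0; rewrite ?normc0 ?mul0r// lexx ltW// gt0_2pi.
have nz : (normc z)%:C != 0 by rewrite (inj_eq (@complexI _)) normc_eq0.
have n1 : normc (z / (normc z)%:C) == 1.
  by rewrite normcM normcV normcR ger0_norm// mulfV// normc_eq0.
exists (arg (Circle n1)); first exact: arg_bound.
by rewrite expi_arg /= mulrC divfK.
Qed.

Lemma normc_expi_sub s t :
  normc (circle_val (expi s) - circle_val (expi t)) = normc (circle_val (expi (s - t)) - 1).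
Proof.
have -> : circle_val (expi s) = circle_val (expi (s - t)) * circle_val (expi t).
  by rewrite -expiD subrK.
by rewrite -{2}[circle_val (expi t)]mul1r -mulrBl normcM normc_expiE mulr1.
Qed.

Lemma expi_near1 (e : R) : 0 < e ->
  exists2 d : R, 0 < d & forall h : R, `|h| < d -> normc (circle_val (expi h) - 1) < e.
Proof.
move=> e0; have [d d0 H] := cexp_expansion (@ltr01 R).
have e30 : 0 < e / 3 by rewrite divr_gt0.
exists (Num.min d (e / 3)); first by rewrite lt_min d0.
move=> h; rewrite lt_min => /andP[hd he].
have := H 0 h; rewrite normr0 => /(_ d0 hd); rewrite add0r mul1r.
rewrite /cexp expR0 mul1r => H1.
rewrite -[_ - 1](subrK (0 +i* h)); apply: le_lt_trans (le_normcD _ _) _.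
apply: le_lt_trans (lerD H1 (normc_le_ReIm _)) _.
rewrite /= normr0 add0r; lra.
Qed.

Lemma continuous_circle_expi k : circle_continuous k ->
  continuous ((fun t => k (expi t)) : R -> R).
Proof.
move=> ck t; apply/cvgrPdist_lt => e e0.
have [d d0 H] := ck (expi t) e e0; have [d' d'0 H'] := expi_near1 d0.
near=> s; rewrite distrC; apply: H; rewrite normc_expi_sub; apply: H'.
by rewrite distrC; near: s; apply: cvgr_dist_lt.
Unshelve. all: by end_near. Qed.

Lemma circle_bounded k : circle_continuous k -> exists M, forall u, `|k u| <= M.
Proof.
move=> ck.
have [|c _ H] := @EVT_max R (fun t => `|k (expi t)|) 0 (pi *+ 2) (ltW (gt0_2pi R)).
  apply: continuous_subspaceT => t; apply: cvg_norm.
  exact: (continuous_circle_expi ck).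
exists `|k (expi c)| => u; rewrite -[u in X in X <= _]expi_arg; apply: H.
by rewrite in_itv/= arg_bound.
Qed.

(** Heine's theorem; the compact set is the parameter interval [0, 2 pi], since every point of the
    circle is [expi (arg u)]. *)
Lemma circle_uniform k (e : R) : circle_continuous k -> 0 < e ->
  exists2 d : R, 0 < d & forall u v, normc (circle_val v - circle_val u) < d ->
    `|k v - k u| < e.
Proof.
move=> ck e0; have e20 : 0 < e / 2 by rewrite divr_gt0.
pose P (d t : R) := forall v, normc (circle_val v - circle_val (expi t)) < d ->
  `|k v - k (expi t)| < e.
have /compact_near_coveringP := @segment_compact R 0 (pi *+ 2).
move=> /(_ R (0^'+) P _) cov.
have near0 : \forall d \near 0^'+, `[0, pi *+ 2]%classic `<=` P d.
  apply: cov => t _; have [d d0 H] := ck (expi t) _ e20.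
  have d20 : 0 < d / 2 by rewrite divr_gt0.
  have [d' d'0 H'] := expi_near1 d20.
  exists ([set s | `|t - s| < d'], [set x | x < d / 2]).
    split; first by apply/nbhs_ballP; exists d'.
    exact: nbhs_right_lt.
  move=> [s x] /= [st xd] v vx.
  have A1 : normc (circle_val (expi s) - circle_val (expi t)) < d / 2.
    by rewrite normc_expi_sub; apply: H'; rewrite distrC.
  have A2 : `|k (expi s) - k (expi t)| < e / 2 by apply: H; lra.
  have A3 : `|k v - k (expi t)| < e / 2.
    apply: H; apply: le_lt_trans (normc_triangle _ (circle_val (expi s)) _) _.
    have := lt_trans vx xd; lra.
  rewrite -[_ - _](subrKA (k (expi t))).
  apply: le_lt_trans (ler_normD _ _) _; rewrite [ltRHS]splitr.
  by apply: ltrD => //; rewrite distrC.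
near (0:R)^'+ => d.
have H : `[0, pi *+ 2]%classic `<=` P d by near: d.
exists d => // u v uv.
have := H (arg u); rewrite /P expi_arg; apply => //.
by rewrite /= in_itv/= arg_bound.
Unshelve. all: by end_near. Qed.

(** The closed disc is the image of the compact rectangle [0, r] x [0, 2 pi] under polar
    coordinates. *)
Lemma disc_EVT (F : C -> R) (r : R) : 0 <= r ->
  (forall z, normc z <= r -> forall e : R, 0 < e -> exists2 d : R, 0 < d &
     forall w, normc (w - z) < d -> `|F w - F z| < e) ->
  exists2 z0, normc z0 <= r & forall z, normc z <= r -> F z <= F z0.
Proof.
move=> r0 cF.
pose A : set (R * R) := `[0, r]%classic `*` `[0, pi *+ 2]%classic.
pose g (p : R * R) := F (p.1%:C * circle_val (expi p.2)).
have nA p : A p -> normc (p.1%:C * circle_val (expi p.2)) <= r.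
  by rewrite normcMr normc_expiE mulr1 => -[/=]; rewrite !in_itv/= => /andP[p0 pr] _; rewrite ger0_norm.
have [|||p pA H] := @compact_EVT_max (R * R)%type R g A.
- by exists (0, 0); split; rewrite /= in_itv/= lexx//= ltW// gt0_2pi.
- by apply: compact_setX; exact: segment_compact.
- apply: continuous_in_subspaceT => -[x t]; rewrite inE => /nA xtr.
  apply/cvgrPdist_lt => e e0; have [d d0 Hd] := cF _ xtr e e0.
  have x0 : 0 < `|x| + 1 by rewrite ltr_wpDl.
  have d20 : 0 < d / 2 by rewrite divr_gt0.
  have [d' d'0 Hd'] := expi_near1 (divr_gt0 d20 x0).
  exists ([set s | `|x - s| < d / 2], [set s | `|t - s| < d']).
    by split; apply/nbhs_ballP; [exists (d / 2)|exists d'].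
  move=> [x' t'] [/= xx' tt']; rewrite distrC; apply: Hd.
  rewrite [X in normc X](_ : _ = (x' - x)%:C * circle_val (expi t') +
     x%:C * (circle_val (expi t') - circle_val (expi t))); last first.
    by rewrite rmorphB; ring.
  apply: le_lt_trans (le_normcD _ _) _; rewrite !normcMr normc_expiE mulr1 normc_expi_sub.
  have H1 : normc (circle_val (expi (t' - t)) - 1) < d / 2 / (`|x| + 1).
    by apply: Hd'; rewrite distrC.
  rewrite [ltRHS](splitr d); apply: ltr_leD; first by rewrite distrC.
  apply: le_trans (ler_wpM2l (normr_ge0 x) (ltW H1)) _.
  by rewrite mulrCA ler_piMr ?(ltW d20)// ler_pdivrMr// mul1r lerDl.
exists (p.1%:C * circle_val (expi p.2)); first by apply: nA; rewrite inE in pA.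
move=> z zr; have [t tb ->] := polar_form z.
apply: (H (normc z, t)); rewrite inE; split; rewrite /= in_itv//=.
by rewrite normc_ge0.
Qed.

End circle_facts.

(** * Maximum modulus principle *)

Section max_modulus.
Variable R : realType.
Local Notation C := R[i].
Implicit Types (z w h l : C) (f g : C -> C) (s t : R) (u : circle R).
Local Notation mu := (@lebesgue_measure R).
Local Notation RI a b f := (\int[mu]_(x in `[a, b]) (f x : R)).

Lemma holomorphic_cst l : holomorphic_disc (fun=> l).
Proof. by move=> z _; exact: derivable_cst. Qed.

Lemma holomorphic_id : holomorphic_disc (fun z : C => z).
Proof. by move=> z _; exact: derivable_id. Qed.

Lemma holomorphicD f g : holomorphic_disc f -> holomorphic_disc g ->
  holomorphic_disc (fun z => f z + g z).
Proof.
by move=> hf hg z zD; apply: (@derivableD _ C^o C^o); [exact: hf|exact: hg].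
Qed.

Lemma holomorphicM f g : holomorphic_disc f -> holomorphic_disc g ->
  holomorphic_disc (fun z => f z * g z).
Proof.
by move=> hf hg z zD; apply: (@derivableM _ C^o); [exact: hf|exact: hg].
Qed.

Lemma holomorphicX n : holomorphic_disc (fun z : C => z ^+ n).
Proof.
elim: n => [|n IH].
  have -> : (fun z : C => z ^+ 0) = (fun=> 1) by apply/funext => z; rewrite expr0.
  exact: holomorphic_cst.
have -> : (fun z : C => z ^+ n.+1) = (fun z => z * z ^+ n).
  by apply/funext => z; rewrite exprS.
exact: (holomorphicM holomorphic_id IH).
Qed.

Lemma holomorphic_prod (F : nat -> C -> C) n : (forall k, holomorphic_disc (F k)) ->
  holomorphic_disc (fun z => \prod_(k < n) F k z).
Proof.
move=> hF; elim: n => [|n IH].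
  have -> : (fun z : C => \prod_(k < 0) F k z) = (fun=> 1).
    by apply/funext => z; rewrite big_ord0.
  exact: holomorphic_cst.
have -> : (fun z : C => \prod_(k < n.+1) F k z) = (fun z => \prod_(k < n) F k z * F n z).
  by apply/funext => z; rewrite big_ord_recr.
exact: (holomorphicM IH (hF n)).
Qed.

Lemma holomorphic_affine f a b : holomorphic_disc f ->
  (forall w, normc w < 1 -> normc (a + b * w) < 1) ->
  holomorphic_disc (fun w => f (a + b * w)).
Proof.
move=> hf ab w w1; have [l fl] := holomorphic_cderiv hf (ab w w1).
apply/derivable_cderiv; exists (l * b) => e e0.
have K0 : 0 < normc b + 1 by rewrite ltr_wpDl.
have [d d0 H] := fl _ (divr_gt0 e0 K0).
exists (d / (normc b + 1)); first by rewrite divr_gt0.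
move=> h; rewrite ltr_pdivlMr// => hd.
have bh : normc (b * h) <= normc h * (normc b + 1).
  by rewrite normcM mulrC ler_wpM2l// lerDl.
have := H (b * h) (le_lt_trans bh hd).
rewrite mulrDr addrA mulrA => /le_trans; apply.
apply: le_trans (ler_wpM2l _ bh) _; first by rewrite divr_ge0// ltW.
by rewrite mulrCA divfK ?gt_eqF// mulrC.
Qed.

Lemma holomorphic_continuous f z : holomorphic_disc f -> normc z < 1 ->
  forall e : R, 0 < e -> exists2 d : R, 0 < d &
    forall w, normc (w - z) < d -> normc (f w - f z) < e.
Proof. by move=> hf /(holomorphic_cderiv hf)[l] /cderiv_continuous. Qed.

Lemma ReB z w : complex.Re (z - w) = complex.Re z - complex.Re w.
Proof. by case: z; case: w. Qed.

Lemma ImB z w : complex.Im (z - w) = complex.Im z - complex.Im w.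
Proof. by case: z; case: w. Qed.

Lemma normc_rcircle (r : R) u : 0 <= r -> normc (r%:C * circle_val u) = r.
Proof. by move=> r0; rewrite normcMr normc_circle mulr1 ger0_norm. Qed.

Lemma circle_continuous_comp f (r : R) (q : C -> R) : holomorphic_disc f -> 0 <= r < 1 ->
  (forall z w, `|q z - q w| <= normc (z - w)) ->
  circle_continuous (fun u => q (f (r%:C * circle_val u))).
Proof.
move=> hf /andP[r0 r1] hq u e e0.
have [|d d0 H] := holomorphic_continuous hf (_ : normc (r%:C * circle_val u) < 1) e0.
  by rewrite normc_rcircle.
exists d => // v vu; apply: le_lt_trans (hq _ _) _; apply: H.
rewrite -mulrBr normcMr ger0_norm//; apply: le_lt_trans vu.
by rewrite ler_piMl// ltW.
Qed.

Lemma Re_lip z w : `|complex.Re z - complex.Re w| <= normc (z - w).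
Proof. by rewrite -ReB Re_le_normc. Qed.

Lemma Im_lip z w : `|complex.Im z - complex.Im w| <= normc (z - w).
Proof. by rewrite -ImB Im_le_normc. Qed.

Lemma normc_lip z w : `|normc z - normc w| <= normc (z - w).
Proof.
by rewrite ler_norml normc_sub_ge andbT lerNl opprB normcB normc_sub_ge.
Qed.

Lemma mean_value_le f (r B : R) : holomorphic_disc f -> 0 <= r < 1 ->
  (forall u, complex.Re (f (r%:C * circle_val u)) <= B) -> complex.Re (f 0) <= B.
Proof.
move=> hf r01 fB.
rewrite -(ler_pM2r (gt0_2pi R)) -(mean_value_itv hf r01).
rewrite -[X in B * X]subr0 -Rintegral_itv_cst ?(ltW (gt0_2pi R))//.
apply: le_Rintegral => //; apply: integrable_itv => t _.
  by apply: (continuous_circle_expi (circle_continuous_comp hf r01 Re_lip)).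
exact: cst_continuous.
Qed.

Lemma sqr_near (x e : R) : 0 < e -> exists2 d : R, 0 < d &
  forall y : R, `|y - x| < d -> `|y ^+ 2 - x ^+ 2| < e.
Proof.
move=> e0; have /cvgrPdist_lt /(_ e e0) := @exprn_continuous R 2 x.
move=> /(@nbhs_ballP R R^o) [d /= d0 H]; exists d => // y yx.
by rewrite distrC; apply: H; rewrite /ball /= distrC.
Qed.

Lemma ReD z w : complex.Re (z + w) = complex.Re z + complex.Re w.
Proof. by case: z; case: w. Qed.

Lemma ReM2 z : complex.Re (2%:R * z) = 2 * complex.Re z.
Proof. by rewrite !mulr_natl !mulr2n ReD. Qed.

Lemma ReM_conj z w : complex.Re (conjc z * w) =
  complex.Re z * complex.Re w + complex.Im z * complex.Im w.
Proof. by case: z => a b; case: w => c d /=; rewrite mulNr opprK. Qed.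

Lemma normc_sqrD z w :
  normc (z + w) ^+ 2 = normc z ^+ 2 + 2 * complex.Re (conjc z * w) + normc w ^+ 2.
Proof. by rewrite ReM_conj !normc_sqr; case: z => a b; case: w => c d /=; ring. Qed.

(** Perturb |f|^2 to F = |f|^2 + e |z|^2, so that a maximum point z1 of [F] is interior. With c =
    f(z1) and |f|^2 >= 2 Re (conj c f) - |c|^2, maximality bounds the real part of the holomorphic
    function [k] on a circle strictly below its value 2 |c|^2 at the centre, against the mean value
    property. *)
Lemma max_modulus f (r B : R) z0 : holomorphic_disc f -> 0 <= r < 1 ->
  (forall z, normc z = r -> normc (f z) <= B) -> normc z0 <= r -> normc (f z0) <= B.
Proof.
move=> hf /andP[r0 r1] fB z0r; rewrite leNgt; apply/negP => Bf.
have B0 : 0 <= B.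
  by apply: le_trans (fB r%:C _); rewrite ?normc_ge0// normcR ger0_norm.
have B2 : B ^+ 2 < normc (f z0) ^+ 2 by rewrite ltr_pXn2r ?nnegrE.
(* Half of the gap: on |z| = r one has F <= B^2 + e < |f z0|^2 <= F z0, so no maximum lies there. *)
pose e := (normc (f z0) ^+ 2 - B ^+ 2) / 2.
have e0 : 0 < e by rewrite divr_gt0// subr_gt0.
pose F z := normc (f z) ^+ 2 + e * normc z ^+ 2.
have [|z1 z1r z1max] := @disc_EVT R F r r0.
  move=> z zr e1 e10.
  have e20 : 0 < e1 / 2 by rewrite divr_gt0.
  have [d1 d10 H1] := sqr_near (normc (f z)) e20.
  have [d2 d20 H2] := sqr_near (normc z) (divr_gt0 e20 e0).
  have [d3 d30 H3] := holomorphic_continuous hf (le_lt_trans zr r1) d10.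
  exists (Num.min d2 d3); first by rewrite lt_min d20.
  move=> w; rewrite lt_min => /andP[w2 w3].
  have A1 := H1 _ (le_lt_trans (normc_lip _ _) (H3 _ w3)).
  have A2 := H2 _ (le_lt_trans (normc_lip _ _) w2).
  rewrite /F opprD addrACA -mulrBr (le_lt_trans (ler_normD _ _))//.
  rewrite [ltRHS]splitr; apply: ltrD => //.
  by rewrite normrM gtr0_norm// mulrC -ltr_pdivlMr.
have Fz1 := z1max z0 z0r.
have {}z1r : normc z1 < r.
  rewrite lt_neqAle z1r andbT; apply/negP => /eqP z1E.
  have := fB _ z1E => f1B.
  have h1 : normc (f z1) ^+ 2 <= B ^+ 2 by rewrite ler_pXn2r ?nnegrE.
  have h2 : normc z1 ^+ 2 <= 1 by rewrite expr_le1 // z1E ltW.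
  have h3 : e * normc z1 ^+ 2 <= e by rewrite ler_piMr// ltW.
  have h4 : 0 <= e * normc z0 ^+ 2 by rewrite mulr_ge0// ?sqr_ge0// ltW.
  move: Fz1; rewrite /F => Fz1; have : e = (normc (f z0) ^+ 2 - B ^+ 2) / 2 by [].
  lra.
pose d := r - normc z1; have d0 : 0 < d by rewrite subr_gt0.
pose c := f z1.
pose k w := 2%:R * conjc c * f (z1 + d%:C * w) + 2%:R * (e * d)%:C * conjc z1 * w.
have inr w : normc w <= 1 -> normc (z1 + d%:C * w) <= r.
  move=> w1; rewrite (le_trans (le_normcD _ _))// normcMr gtr0_norm//.
  by rewrite -lerBrDl -/d ler_piMr// ltW.
have hk : holomorphic_disc k.
  have hfz : holomorphic_disc (fun w => f (z1 + d%:C * w)).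
    by apply: holomorphic_affine => // w /ltW/inr /le_lt_trans; apply.
  exact: (holomorphicD (holomorphicM (@holomorphic_cst (2%:R * conjc c)) hfz)
    (holomorphicM (@holomorphic_cst (2%:R * (e * d)%:C * conjc z1)) holomorphic_id)).
have h01 : 0 <= (2^-1 : R) < 1 by apply/andP; split; lra.
(* On |w| = 1/2 the perturbation contributes e d^2 / 4, which is the gain over 2 |c|^2. *)
have := @mean_value_le k 2^-1 (2 * normc c ^+ 2 - e * d ^+ 2 / 4) hk h01.
have ReK w : complex.Re (k w) = 2 * complex.Re (conjc c * f (z1 + d%:C * w)) +
    2 * e * complex.Re (conjc z1 * (d%:C * w)).
  rewrite /k -!mulrA -mulrDr ReM2 ReD mulrDr; congr (_ + 2 * _).
  by rewrite !ReM_conj; case: (z1) => a b; case: w => w1 w2 /=; ring.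
have Rek0 : complex.Re (k 0) = 2 * normc c ^+ 2.
  rewrite ReK !mulr0 addr0 -/c ReM_conj normc_sqr !expr2.
  by rewrite addr0.
rewrite Rek0 => /(_ _)/wrap[]; last first.
  have : 0 < e * d ^+ 2 / 4 by rewrite divr_gt0// mulr_gt0// exprn_gt0.
  lra.
move=> u; set w := _ * circle_val u.
have nw : normc w = 2^-1 by rewrite /w normc_rcircle//; lra.
have := z1max _ (inr w _); rewrite nw => /(_ _)/wrap[]; first lra.
rewrite ReK /F normc_sqrD normcMr nw -/c ger0_norm; last exact: ltW.
set x := f _; set y := complex.Re (conjc z1 * _).
have : 0 <= normc (- c + x) ^+ 2 by exact: sqr_ge0.
rewrite normc_sqrD normcN (_ : complex.Re (conjc (- c) * x) = - complex.Re (conjc c * x)); last first.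
  by rewrite !ReM_conj; case: (c) => ? ? /=; ring.
set X := complex.Re _; rewrite exprMn => A1 A2.
have : e * (normc z1 ^+ 2 + 2 * y + d ^+ 2 * 2^-1 ^+ 2) =
  e * normc z1 ^+ 2 + 2 * e * y + e * d ^+ 2 / 4 by field.
lra.
Qed.
End max_modulus.

(** * Integration on the circle *)

Section circle_integral.
Variable R : realType.
Local Notation C := R[i].
Implicit Types (z w h l : C) (f g : C -> C) (s t : R) (u : circle R).
Local Notation mu := (@lebesgue_measure R).
Local Notation m := (@circle_measure R).
Local Notation RI a b f := (\int[mu]_(x in `[a, b]) (f x : R)).

Lemma circle_integral_ge0 (F : circle R -> \bar R) : measurable_fun setT F ->
  (forall u, 0 <= F u)%E ->
  (\int[m]_u F u = ((pi *+ 2)^-1)%:E * \int[mu]_(t in `[0%R, (pi *+ 2)%R]) F (expi t))%E.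
Proof.
move=> mF F0.
rewrite (@ge0_integral_distribution _ _ _ _ _ (uniform_prob (gt0_2pi R)) (@expi R) F mF)//.
rewrite (@integral_uniform R 0 (pi *+ 2) (gt0_2pi R) (F \o @expi R)) ?subr0//.
  by apply: measurableT_comp => //; exact: measurable_expi.
by move=> t; exact: F0.
Qed.

Lemma circle_measureT : m setT = 1%E.
Proof. exact: (@probability_setT _ _ _ m). Qed.

(** The class in which circle integrals are manipulated: unlike integrability, it is stable under
    products. *)
Definition bounded_mfun (k : circle R -> R) := measurable_fun setT k /\ exists M, forall u, `|k u| <= M.

Lemma circle_continuous_bmf k : circle_continuous k -> bounded_mfun k.
Proof. by move=> ck; split; [exact: measurable_circle_continuous|exact: circle_bounded]. Qed.

Lemma bounded_mfun_integrable k : bounded_mfun k -> m.-integrable setT (EFin \o k).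
Proof.
move=> [mk [M kM]]; apply: measurable_bounded_integrable => //.
  exact: (eq_ind_r (fun x => x < +oo)%E (ltry 1) circle_measureT).
exists M; split; first by rewrite num_real.
by move=> x Mx u _; rewrite /= (le_trans (kM u))// ltW.
Qed.

Lemma bounded_mfun_cst r : bounded_mfun (fun=> r).
Proof. by split; [exact: measurable_cst|exists `|r|]. Qed.

Lemma bounded_mfunD k k' : bounded_mfun k -> bounded_mfun k' -> bounded_mfun (fun u => k u + k' u).
Proof.
move=> [mk [M kM]] [mk' [M' kM']]; split; first exact: measurable_funD.
by exists (M + M') => u; rewrite (le_trans (ler_normD _ _))// lerD.
Qed.

Lemma bounded_mfunN k : bounded_mfun k -> bounded_mfun (fun u => - k u).
Proof.
move=> [mk [M kM]]; split; first exact: measurableT_comp.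
by exists M => u; rewrite normrN.
Qed.

Lemma bounded_mfunB k k' : bounded_mfun k -> bounded_mfun k' -> bounded_mfun (fun u => k u - k' u).
Proof. by move=> bk bk'; apply: bounded_mfunD => //; exact: bounded_mfunN. Qed.

Lemma bounded_mfunM k k' : bounded_mfun k -> bounded_mfun k' -> bounded_mfun (fun u => k u * k' u).
Proof.
move=> [mk [M kM]] [mk' [M' kM']]; split; first exact: measurable_funM.
by exists (M * M') => u; rewrite normrM ler_pM.
Qed.

Lemma bounded_mfun_norm k : bounded_mfun k -> bounded_mfun (fun u => `|k u|).
Proof.
move=> [mk [M kM]]; split; first exact: measurableT_comp.
by exists M => u; rewrite normr_id.
Qed.

Lemma bounded_mfun_max k k' : bounded_mfun k -> bounded_mfun k' -> bounded_mfun (fun u => Num.max (k u) (k' u)).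
Proof.
move=> [mk [M kM]] [mk' [M' kM']]; split; first exact: measurable_maxr.
exists (Num.max M M') => u; rewrite le_max.
by case: (leP (k u) (k' u)) => _; rewrite ?kM ?kM' ?orbT.
Qed.

Lemma bounded_mfun_min k k' : bounded_mfun k -> bounded_mfun k' -> bounded_mfun (fun u => Num.min (k u) (k' u)).
Proof.
move=> [mk [M kM]] [mk' [M' kM']]; split; first exact: measurable_minr.
exists (Num.max M M') => u; rewrite le_max.
by case: (leP (k u) (k' u)) => _; rewrite ?kM ?kM' ?orbT.
Qed.

Lemma circle_integral_cst r : \int[m]_u (r : R) = r.
Proof.
rewrite Rintegral_cst//; transitivity (r * 1); last exact: mulr1.
by congr (_ * _); exact: (congr1 fine circle_measureT).
Qed.

Lemma circle_integral k : bounded_mfun k ->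
  \int[m]_u k u = (pi *+ 2)^-1 * RI 0 (pi *+ 2) (fun t => k (expi t)).
Proof.
move=> bk; have [mk [M kM]] := bk.
have ik : mu.-integrable `[0, pi *+ 2] (EFin \o (fun t => k (expi t))).
  apply: measurable_bounded_integrable => //=.
  - by rewrite lebesgue_measure_itv/= lte_fin gt0_2pi -EFinB ltry.
  - by apply: measurable_funTS; apply: measurableT_comp => //; exact: measurable_expi.
  - exists M; split; first by rewrite num_real.
    by move=> x Mx t _; rewrite /= (le_trans (kM _))// ltW.
(* Adding the bound [M] makes the integrand nonnegative, as [circle_integral_ge0] requires. *)
have -> : \int[m]_u k u = \int[m]_u (k u + M) - M.
  rewrite RintegralD ?circle_integral_cst ?addrK//; first exact: bounded_mfun_integrable.
  exact: (bounded_mfun_integrable (bounded_mfun_cst M)).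
have ic (r : R) : mu.-integrable `[0, pi *+ 2] (EFin \o (fun=> r)).
  by apply: integrable_itv => t _; exact: cst_continuous.
have -> : RI 0 (pi *+ 2) (fun t => k (expi t)) =
    RI 0 (pi *+ 2) (fun t => k (expi t) + M) - M * (pi *+ 2).
  rewrite (@RintegralD _ _ _ mu)// [X in _ = _ + X - _](_ : _ = M * (pi *+ 2)) ?addrK//.
  by rewrite Rintegral_itv_cst ?subr0// ltW// gt0_2pi.
rewrite mulrBr mulrCA mulVf ?gt_eqF ?gt0_2pi// mulr1; congr (_ - _).
rewrite /Rintegral (circle_integral_ge0 (F := fun u => (k u + M)%:E)).
- rewrite fineM//; apply: integrable_fin_num => //.
  exact: (integrableD _ ik (ic M)).
- by apply/measurable_EFinP; exact: measurable_funD.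
- by move=> u; rewrite lee_fin -lerBlDr sub0r; have := kM u; rewrite ler_norml => /andP[].
Qed.

Lemma measurable_circle_Re : measurable_fun setT (fun u => complex.Re (circle_val u)).
Proof.
apply: measurable_circle_continuous => u e e0; exists e => // v.
exact: le_lt_trans (Re_lip _ _).
Qed.

Lemma measurable_circle_Im : measurable_fun setT (fun u => complex.Im (circle_val u)).
Proof.
apply: measurable_circle_continuous => u e e0; exists e => // v.
exact: le_lt_trans (Im_lip _ _).
Qed.

Lemma measurable_arg : measurable_fun setT (@arg R).
Proof.
(* [acos] is continuous on the open interval only. [arg] calls it where y is nonzero, hence where x
   lies in ]-1, 1[. *)
pose ac : R -> R := (@acos R) \_ `]-1, 1[.
have mac : measurable_fun setT ac.
  apply/(measurable_restrictT _ _).1 => //.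
  apply: open_continuous_measurable_fun; first exact: interval_open.
  by move=> x; rewrite inE/= in_itv/= => /continuous_acos.
have mx := measurable_circle_Re; have my := measurable_circle_Im.
pose x u := complex.Re (circle_val u); pose y u := complex.Im (circle_val u).
rewrite (_ : @arg R = fun u => if 0 < y u then ac (x u) else
   if y u < 0 then pi *+ 2 - ac (x u) else if 0 < x u then 0 else pi); last first.
  apply/funext => u; rewrite /arg -/(x u) -/(y u).
  have [y0|] := eqVneq (y u) 0; first by rewrite y0 ltxx.
  move=> y0; suff -> : ac (x u) = acos (x u) by [].
  rewrite /ac patchE ifT// inE/= in_itv/= -ltr_norml.
  rewrite -(@ltr_pXn2r _ 2) ?nnegrE// expr1n real_normK ?num_real//.
  by rewrite -(circle_sqr u) ltrDl lt_def sqrf_eq0 y0 sqr_ge0.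
have mcst (r : R) : measurable_fun setT (fun _ : circle R => r) by exact: measurable_cst.
have mxc : measurable_fun setT (fun u => ac (x u)) by exact: measurableT_comp.
apply: measurable_fun_ifT => //; first exact: measurable_fun_ltr.
apply: measurable_fun_ifT => //; first exact: measurable_fun_ltr.
  exact: measurable_funB.
by apply: measurable_fun_ifT => //; first exact: measurable_fun_ltr.
Qed.

(** Null sets of angles give null sets of the circle. The Borel set covering [B] is a preimage under
    [arg]; the angles 0, pi and 2 pi, not covered by [arg_expi], are added to [N]. *)
Lemma circle_negligible (B : set (circle R)) (N : set R) : measurable N -> mu N = 0%E ->
  (forall t, 0 < t < pi *+ 2 -> t != pi -> B (expi t) -> N t) -> m.-negligible B.
Proof.
move=> mN N0 BN.
pose N2 := N `|` ([set 0] `|` ([set pi] `|` [set pi *+ 2])).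
have mN2 : measurable N2 by do ! apply: measurableU.
have n1 (r : R) : mu.-negligible [set r].
  by apply/negligibleP => //; exact: lebesgue_measure_set1.
have muN2 : mu N2 = 0%E.
  apply: measure_negligible => //; apply: negligibleU; first by exists N; split.
  by do 2 (apply: negligibleU; first exact: n1).
have mA : measurable (@arg R @^-1` N2).
  by rewrite -[X in measurable X]setTI; exact: measurable_arg.
exists (@arg R @^-1` N2); split => //; last first.
  move=> u Bu /=; have /andP[a0 a2] := arg_bound u.
  have [->|an0] := eqVneq (arg u) 0; first by right; left.
  have [->|anp] := eqVneq (arg u) pi; first by right; right; left.
  have [->|an2] := eqVneq (arg u) (pi *+ 2); first by right; right; right.
  left; apply: BN => //; last by rewrite expi_arg.
  by rewrite !lt_neqAle a0 a2 an2 eq_sym an0.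
have -> : m (@arg R @^-1` N2) = (\int[m]_u (\1_(@arg R @^-1` N2) u)%:E)%E.
  by rewrite integral_indic// setIT.
apply/eqP; rewrite eq_le integral_ge0 ?andbT; last by move=> *; rewrite lee_fin.
rewrite circle_integral_ge0; [|exact/measurable_EFinP/measurable_indic|by move=> *; rewrite lee_fin].
rewrite (_ : integral _ _ _ = 0%E) ?mule0//.
apply/eqP; rewrite eq_le integral_ge0 ?andbT; last by move=> *; rewrite lee_fin.
have I0 : (\int[mu]_(t in `[0%R, (pi *+ 2)%R]) (\1_N2 t)%:E = 0)%E.
  rewrite integral_indic//=; apply: (@subset_measure0 _ _ _ mu _ N2) => //.
  exact: measurableI.
rewrite -[leRHS]I0; apply: ge0_le_integral => //=.
- apply/measurable_EFinP/measurable_funTS.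
  by apply: measurableT_comp; [exact: measurable_indic|exact: measurable_expi].
- exact/measurable_EFinP/measurable_funTS/measurable_indic.
move=> t; rewrite in_itv/= => /andP[t0 t2]; rewrite lee_fin !indicE.
case: (boolP (t \in N2)) => tN; first by case: (_ \in _).
rewrite (_ : _ \in _ = false)//; apply/negbTE; apply: contra tN.
rewrite !inE /= => aN.
have [->|an0] := eqVneq t 0; first by right; left.
have [->|anp] := eqVneq t pi; first by right; right; left.
have [->|an2] := eqVneq t (pi *+ 2); first by right; right; right.
move: aN; rewrite arg_expi//; first by rewrite lt_neqAle eq_sym an0.
by rewrite lt_neqAle an2.
Qed.

End circle_integral.

(** * Integrals of functions known off a null set *)

Section integral_ae.
Context d (T : measurableType d) (R : realType) (nu : {measure set T -> \bar R}).
Import HBNNSimple.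

(** [f] and [g] are arbitrary because boundary functions may fail to be Borel. The integral is a
    supremum over simple functions below [f], and cutting a simple function off on [N] does not
    change its integral. *)
Lemma ge0_integral_le_ae (N : set T) (f g : T -> \bar R) :
  measurable N -> nu N = 0%E ->
  (forall x, 0 <= f x)%E -> (forall x, 0 <= g x)%E -> (forall x, ~ N x -> f x <= g x)%E ->
  (\int[nu]_x f x <= \int[nu]_x g x)%E.
Proof.
move=> mN N0 f0 g0 fg; rewrite !ge0_integralTE//.
apply: ge_ereal_sup => _ [h hf <-].
have mNC : measurable (~` N) by exact: measurableC.
rewrite -integralT_nnsfun.
have -> : (\int[nu]_x (h x)%:E = \int[nu]_x (proj_nnsfun h mNC x)%:E)%E.
  apply: ae_eq_integral => //; try exact/measurable_EFinP.
  exists N; split => // x /=; apply: contra_notP => nNx _.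
  by rewrite /= mindicE mem_set// mulr1.
rewrite integralT_nnsfun; apply: ereal_sup_ubound; exists (proj_nnsfun h mNC) => // x /=.
rewrite mindicE; case: (boolP (x \in ~` N)) => [|_]; last by rewrite mulr0.
by rewrite inE /= mulr1 => /fg; apply: le_trans.
Qed.

Lemma integral_eq_ae (N : set T) (f g : T -> \bar R) :
  measurable N -> nu N = 0%E -> (forall x, ~ N x -> f x = g x) ->
  (\int[nu]_x f x = \int[nu]_x g x)%E.
Proof.
move=> mN N0 fg; rewrite [LHS]integralE [RHS]integralE.
congr (_ - _)%E; apply/eqP; rewrite eq_le; apply/andP; split;
  apply: (ge0_integral_le_ae mN N0) => // x /fg fgx; rewrite ?funeposE ?funenegE fgx//.
Qed.
End integral_ae.

(** * Means of complex functions on the circle *)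

Section circle_mean.
Variable R : realType.
Local Notation C := R[i].
Implicit Types (z w h l : C) (f : C -> C) (s t : R) (u : circle R) (g : circle R -> C).
Local Notation m := (@circle_measure R).

Definition bounded_cmfun g := bounded_mfun (fun u => complex.Re (g u)) /\ bounded_mfun (fun u => complex.Im (g u)).

Lemma ImD z w : complex.Im (z + w) = complex.Im z + complex.Im w.
Proof. by case: z; case: w. Qed.

Lemma ReM z w : complex.Re (z * w) = complex.Re z * complex.Re w - complex.Im z * complex.Im w.
Proof. by case: z; case: w. Qed.

Lemma ImM z w : complex.Im (z * w) = complex.Re z * complex.Im w + complex.Im z * complex.Re w.
Proof. by case: z; case: w. Qed.

Lemma bounded_cmfun_cst z : bounded_cmfun (fun=> z). Proof. by split; exact: bounded_mfun_cst. Qed.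

Lemma bounded_cmfunD g g' : bounded_cmfun g -> bounded_cmfun g' -> bounded_cmfun (fun u => g u + g' u).
Proof.
move=> [r i] [r' i']; split.
  by rewrite (_ : (fun _ => _) = fun u => complex.Re (g u) + complex.Re (g' u)); [exact: bounded_mfunD|apply/funext => u; rewrite ReD].
by rewrite (_ : (fun _ => _) = fun u => complex.Im (g u) + complex.Im (g' u)); [exact: bounded_mfunD|apply/funext => u; rewrite ImD].
Qed.

Lemma bounded_cmfunM g g' : bounded_cmfun g -> bounded_cmfun g' -> bounded_cmfun (fun u => g u * g' u).
Proof.
move=> [r i] [r' i']; split.
  rewrite (_ : (fun _ => _) = fun u => complex.Re (g u) * complex.Re (g' u) - complex.Im (g u) * complex.Im (g' u)); last by apply/funext => u; rewrite ReM.
  by apply: bounded_mfunB; exact: bounded_mfunM.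
rewrite (_ : (fun _ => _) = fun u => complex.Re (g u) * complex.Im (g' u) + complex.Im (g u) * complex.Re (g' u)); last by apply/funext => u; rewrite ImM.
by apply: bounded_mfunD; exact: bounded_mfunM.
Qed.

Lemma bounded_cmfunB g g' : bounded_cmfun g -> bounded_cmfun g' -> bounded_cmfun (fun u => g u - g' u).
Proof.
move=> bg bg'; rewrite (_ : (fun _ => _) = fun u => g u + (-1) * g' u).
  by apply: bounded_cmfunD => //; apply: bounded_cmfunM => //; exact: bounded_cmfun_cst.
by apply/funext => u; rewrite mulN1r.
Qed.

Lemma bounded_cmfunX g n : bounded_cmfun g -> bounded_cmfun (fun u => g u ^+ n).
Proof.
move=> bg; elim: n => [|n IH].
  by rewrite (_ : (fun _ => _) = fun=> 1); [exact: bounded_cmfun_cst|apply/funext => u; rewrite expr0].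
rewrite (_ : (fun _ => _) = fun u => g u * g u ^+ n); [exact: bounded_cmfunM|].
by apply/funext => u; rewrite exprS.
Qed.

Lemma bounded_cmfun_circle : bounded_cmfun (@circle_val R).
Proof.
split; apply: circle_continuous_bmf => u e e0; exists e => // v.
  exact: le_lt_trans (Re_lip _ _).
exact: le_lt_trans (Im_lip _ _).
Qed.

Lemma bounded_cmfun_conj g : bounded_cmfun g -> bounded_cmfun (fun u => conjc (g u)).
Proof.
move=> [r i]; split.
  by rewrite (_ : (fun _ => _) = fun u => complex.Re (g u))//; apply/funext => u; case: (g u).
rewrite (_ : (fun _ => _) = fun u => - complex.Im (g u)); first exact: bounded_mfunN.
by apply/funext => u; case: (g u).
Qed.

Lemma bounded_cmfun_holomorphic f (r : R) : holomorphic_disc f -> 0 <= r < 1 ->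
  bounded_cmfun (fun u => f (r%:C * circle_val u)).
Proof.
by move=> hf r01; split; apply: circle_continuous_bmf;
  [exact: (circle_continuous_comp hf r01 (@Re_lip R))|exact: (circle_continuous_comp hf r01 (@Im_lip R))].
Qed.

Lemma bounded_mfun_normc g : bounded_cmfun g -> bounded_mfun (fun u => normc (g u)).
Proof.
move=> [[mr [M rM]] [mi [M' iM]]]; split; last first.
  exists (M + M') => u; rewrite ger0_norm ?normc_ge0// (le_trans (normc_le_ReIm _))//.
  exact: lerD.
rewrite (_ : (fun _ => _) = fun u => Num.sqrt (complex.Re (g u) ^+ 2 + complex.Im (g u) ^+ 2)).
  apply: measurableT_comp => //; first by apply: continuous_measurable_fun; exact: sqrt_continuous.
  by apply: measurable_funD; apply: measurable_funX.
by apply/funext => u; rewrite -normc_sqr sqrtr_sqr ger0_norm ?normc_ge0.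
Qed.

Lemma circle_integralD k k' : bounded_mfun k -> bounded_mfun k' ->
  \int[m]_u (k u + k' u) = \int[m]_u k u + \int[m]_u k' u.
Proof. by move=> bk bk'; rewrite RintegralD//; exact: bounded_mfun_integrable. Qed.

Lemma circle_integralB k k' : bounded_mfun k -> bounded_mfun k' ->
  \int[m]_u (k u - k' u) = \int[m]_u k u - \int[m]_u k' u.
Proof. by move=> bk bk'; rewrite RintegralB//; exact: bounded_mfun_integrable. Qed.

Lemma circle_integralZ r k : bounded_mfun k -> \int[m]_u (r * k u) = r * \int[m]_u k u.
Proof. by move=> bk; rewrite RintegralZl//; exact: bounded_mfun_integrable. Qed.

Lemma le_circle_integral k k' : bounded_mfun k -> bounded_mfun k' -> (forall u, k u <= k' u) ->
  \int[m]_u k u <= \int[m]_u k' u.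
Proof. by move=> bk bk' kk'; apply: le_Rintegral => //; exact: bounded_mfun_integrable. Qed.

Lemma fourier0D g g' : bounded_cmfun g -> bounded_cmfun g' ->
  fourier0 (fun u => g u + g' u) = fourier0 g + fourier0 g'.
Proof.
move=> [r i] [r' i']; rewrite /fourier0.
under eq_Rintegral do rewrite ReD.
under [X in _ +i* X = _]eq_Rintegral do rewrite ImD.
by rewrite !circle_integralD.
Qed.

Lemma fourier0Z z g : bounded_cmfun g -> fourier0 (fun u => z * g u) = z * fourier0 g.
Proof.
move=> [r i]; rewrite /fourier0.
under eq_Rintegral do rewrite ReM.
under [X in _ +i* X = _]eq_Rintegral do rewrite ImM.
have bz (a : R) k : bounded_mfun k -> bounded_mfun (fun u => a * k u).
  by move=> bk; apply: bounded_mfunM => //; exact: bounded_mfun_cst.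
rewrite circle_integralB ?circle_integralD; try exact: bz.
rewrite !circle_integralZ//.
by case: z => a b; apply/eqP; rewrite eq_complex /= !eqxx.
Qed.

Lemma fourier0B g g' : bounded_cmfun g -> bounded_cmfun g' ->
  fourier0 (fun u => g u - g' u) = fourier0 g - fourier0 g'.
Proof.
move=> bg bg'; rewrite -mulN1r -fourier0Z// -fourier0D//; last first.
  by apply: bounded_cmfunM => //; exact: bounded_cmfun_cst.
by congr fourier0; apply/funext => u; rewrite mulN1r.
Qed.

(** The factor 2 comes from bounding the real and imaginary parts separately. *)
Lemma normc_fourier0_le g k : bounded_cmfun g -> bounded_mfun k -> (forall u, normc (g u) <= k u) ->
  normc (fourier0 g) <= 2 * \int[m]_u k u.
Proof.
move=> [r i] bk gk; rewrite (le_trans (normc_le_ReIm _))// mulr_natl mulr2n /fourier0 /=.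
apply: lerD.
  apply: le_trans (le_normr_Rintegral _ _) _ => //; first exact: bounded_mfun_integrable.
  apply: le_circle_integral => //; first exact: bounded_mfun_norm.
  by move=> u; apply: le_trans (gk u); exact: Re_le_normc.
apply: le_trans (le_normr_Rintegral _ _) _ => //; first exact: bounded_mfun_integrable.
apply: le_circle_integral => //; first exact: bounded_mfun_norm.
by move=> u; apply: le_trans (gk u); exact: Im_le_normc.
Qed.

Lemma mean_value f (r : R) : holomorphic_disc f -> 0 <= r < 1 ->
  fourier0 (fun u => f (r%:C * circle_val u)) = f 0.
Proof.
move=> hf r01; have [br bi] := bounded_cmfun_holomorphic hf r01.
have MV F : holomorphic_disc F -> \int[m]_u complex.Re (F (r%:C * circle_val u)) = complex.Re (F 0).
  move=> hF; rewrite circle_integral; last by have [] := bounded_cmfun_holomorphic hF r01.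
  by rewrite mean_value_itv// mulrC mulfK// gt_eqF// gt0_2pi.
rewrite /fourier0 MV//.
(* The imaginary part of f is the real part of -i f. *)
have hF : holomorphic_disc (fun z => (0 -i* 1) * f z).
  by exact: (holomorphicM (@holomorphic_cst R (0 -i* 1)) hf).
have E z : complex.Re ((0 -i* 1) * z) = complex.Im z.
  by rewrite ReM /= mul0r sub0r mulN1r opprK.
have := MV _ hF; rewrite E.
under eq_Rintegral do rewrite E.
by move=> ->; case: (f 0).
Qed.

(** The function f(z) z^n vanishes at 0, including for n = 0 since f(0) = 0; on the circle of radius
    r it carries an extra factor r^n, which is cancelled. *)
Lemma mean_value_expn f (r : R) n : holomorphic_disc f -> f 0 = 0 -> 0 < r < 1 ->
  fourier0 (fun u => f (r%:C * circle_val u) * circle_val u ^+ n) = 0.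
Proof.
move=> hf f00 /andP[r0 r1]; have r01 : 0 <= r < 1 by rewrite ltW.
have hF : holomorphic_disc (fun z => f z * z ^+ n) := holomorphicM hf (@holomorphicX R n).
have rn0 : (r%:C ^+ n : C) != 0.
  by rewrite expf_neq0// (inj_eq (@complexI _)) gt_eqF.
have := mean_value hF r01; rewrite f00 mul0r => H.
apply: (mulfI rn0); rewrite mulr0 -fourier0Z.
  rewrite -[RHS]H; congr fourier0; apply/funext => u; rewrite exprMn; ring.
by apply: bounded_cmfunM; [exact: bounded_cmfun_holomorphic|apply: bounded_cmfunX; exact: bounded_cmfun_circle].
Qed.
End circle_mean.

(** * Maximum principle for the Smirnov class *)

Section logp_riemann.
Variable R : realType.
Local Notation C := R[i].
Implicit Types (z w h l : C) (f : C -> C) (s t : R) (u : circle R) (g : circle R -> C).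
Local Notation mu := (@lebesgue_measure R).
Local Notation RI a b f := (\int[mu]_(x in `[a, b]) (f x : R)).

Lemma logp_ge0 (x : R) : 0 <= logp x.
Proof. by rewrite /logp le_max lexx. Qed.

Lemma logp_le1 (x : R) : x <= 1 -> logp x = 0.
Proof. by move=> x1; apply/max_idPl; exact: ln_le0. Qed.

Lemma logp_ge1 (x : R) : 1 <= x -> logp x = ln x.
Proof. by move=> x1; apply/max_idPr; exact: ln_ge0. Qed.

Lemma ln_le_sub1 (x : R) : 0 < x -> ln x <= x - 1.
Proof.
move=> x0; have := @expR_ge1Dx R (ln x); rewrite lnK// => ?; lra.
Qed.

Lemma logp_sub_le (x y : R) : 0 <= y -> y <= x -> logp x - logp y <= x - y.
Proof.
move=> y0 yx; have [x1|x1] := leP x 1.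
  by rewrite (logp_le1 x1) (logp_le1 (le_trans yx x1)) subrr subr_ge0.
rewrite (logp_ge1 (ltW x1)).
have [y1|y1] := leP y 1.
  rewrite (logp_le1 y1) subr0; apply: le_trans (ln_le_sub1 _) _; last by rewrite lerD2l lerN2.
  exact: lt_trans x1.
have yp : 0 < y by exact: lt_trans y1.
have xp : 0 < x by exact: lt_trans x1.
rewrite (logp_ge1 (ltW y1)) -ln_div ?posrE//.
apply: le_trans (ln_le_sub1 _) _; first by rewrite divr_gt0.
have -> : x / y - 1 = (x - y) / y by field; rewrite gt_eqF.
by rewrite ler_pdivrMr// ler_peMr ?subr_ge0// ltW.
Qed.

Lemma logp_lip (x y : R) : 0 <= x -> 0 <= y -> `|logp x - logp y| <= `|x - y|.
Proof.
have le_logp (a b : R) : 0 <= a -> a <= b -> logp a <= logp b.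
  move=> a0 ab; have [b1|b1] := leP b 1.
    by rewrite (logp_le1 b1) (logp_le1 (le_trans ab b1)).
  have [a1|a1] := leP a 1; first by rewrite (logp_le1 a1) logp_ge0.
  rewrite (logp_ge1 (ltW b1)) (logp_ge1 (ltW a1)) ler_ln// posrE.
    exact: lt_trans a1.
  exact: lt_trans b1.
wlog yx : x y / y <= x => [H x0 y0|x0 y0].
  have [yx|/ltW xy] := leP y x; first exact: H.
  by rewrite distrC [leRHS]distrC; exact: H.
rewrite [leRHS]ger0_norm ?subr_ge0// ger0_norm ?subr_ge0 ?le_logp//.
exact: logp_sub_le.
Qed.

Lemma le_expR_logp (x : R) : 0 <= x -> x <= expR (logp x).
Proof.
move=> x0; have [x1|x1] := leP x 1.
  by rewrite (logp_le1 x1) expR0.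
by rewrite (logp_ge1 (ltW x1)) lnK// posrE (lt_trans _ x1).
Qed.

(** Splits log+ x into a part bounded by ln M, to which dominated convergence applies, and the
    excess log+ (x / M). *)
Lemma logp_div (x M : R) : 0 <= x -> 1 <= M ->
  logp (x / M) = logp x - Num.min (logp x) (ln M).
Proof.
move=> x0 M1; have M0 : 0 < M by exact: lt_le_trans M1.
have [x1|x1] := leP x 1.
  rewrite (logp_le1 x1) (min_idPl (ln_ge0 M1)) subrr logp_le1//.
  by rewrite ler_pdivrMr// mul1r (le_trans x1).
have xp : 0 < x by exact: lt_trans x1.
rewrite (logp_ge1 (ltW x1)); have [xM|xM] := leP x M.
  rewrite logp_le1 ?ler_pdivrMr ?mul1r//.
  by rewrite (min_idPl _) ?subrr// ler_ln.
rewrite logp_ge1 ?ler_pdivlMr ?mul1r ?ltW// ln_div//.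
by rewrite (min_idPr _)// ler_ln// ltW.
Qed.

(** The starting angle [s] is arbitrary and the bound does not depend on it. One e pays for the
    Riemann sum on the grid through 0, the other for moving the points s + j h to that grid. *)
Lemma riemann_sum_le (k : R -> R) (d e : R) n s : continuous k ->
  (forall t, k (t + pi *+ 2) = k t) ->
  (forall t t', `|t - t'| < d -> `|k t - k t'| < e) ->
  (0 < n)%N -> pi *+ 2 / n%:R < d -> 0 <= s ->
  \sum_(j < n) k (s + j%:R * (pi *+ 2 / n%:R)) <=
    n%:R * ((pi *+ 2)^-1 * RI 0 (pi *+ 2) k + e *+ 2).
Proof.
move=> ck per unif n0 hd s0; set h := pi *+ 2 / n%:R in hd *.
have nR : 0 < n%:R :> R by rewrite ltr0n.
have h0 : 0 < h by rewrite divr_gt0// gt0_2pi.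
have nh : n%:R * h = pi *+ 2 by rewrite /h mulrCA mulfV ?mulr1// gt_eqF.
pose a j := k (j%:R * h).
(* By periodicity, a sum over n consecutive grid points does not depend on the first of them. *)
have shift i : \sum_(j < n) a (i + j)%N = \sum_(j < n) a j.
  elim: i => [//|i IH]; rewrite -IH.
  apply: (@addrI _ (a i)).
  have -> : a i + \sum_(j < n) a (i.+1 + j)%N = \sum_(j < n.+1) a (i + j)%N.
    rewrite [RHS]big_ord_recl /= addn0; congr (_ + _); apply: eq_bigr => j _.
    by rewrite /bump /= add1n addSnnS.
  rewrite big_ord_recr /= addrC; congr (_ + _).
  by rewrite /a natrD mulrDl nh per.
have block J : h * (\sum_(j < J) a j) <= RI 0 (J%:R * h) k + e * (J%:R * h).
  elim: J => [|J IH].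
    by rewrite big_ord0 !mul0r !mulr0 addr0 set_itv1 Rintegral_set1.
  have Jh : 0 <= J%:R * h by rewrite mulr_ge0// ltW.
  have EJ : J.+1%:R * h = J%:R * h + h by rewrite -natr1 mulrDl mul1r.
  have JJ : J%:R * h <= J.+1%:R * h by rewrite EJ lerDl ltW.
  rewrite big_ord_recr /= mulrDr (@Rintegral_split _ 0 (J%:R * h) (J.+1%:R * h))//.
  have -> : RI 0 (J%:R * h) k + RI (J%:R * h) (J.+1%:R * h) k + e * (J.+1%:R * h) =
     (RI 0 (J%:R * h) k + e * (J%:R * h)) + (RI (J%:R * h) (J.+1%:R * h) k + e * h).
    by rewrite EJ; ring.
  apply: lerD => //.
  have := @Rintegral_near_cst R _ _ (a J) e k JJ.
  rewrite EJ [_ + h - _]addrAC subrr add0r => /(_ _ _)/wrap[].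
    by move=> t _; exact: ck.
  move=> t /andP[t1 t2]; apply/ltW/unif; rewrite ger0_norm ?subr_ge0//.
  by apply: le_lt_trans hd; rewrite lerBlDr addrC.
  rewrite ler_norml => /andP[H _]; rewrite [h * _]mulrC; lra.
have sum_le : \sum_(j < n) a j <= n%:R * ((pi *+ 2)^-1 * RI 0 (pi *+ 2) k + e).
  rewrite -(ler_pM2l h0); apply: le_trans (block n) _.
  rewrite nh /h -(ler_pM2l nR) le_eqVlt; apply/orP; left; apply/eqP.
  have aux (p I q : R) : p != 0 -> q != 0 ->
      q * (I + e * p) = q * (p / q * (q * (p^-1 * I + e))).
    by move=> p0 q0; field; rewrite p0 q0.
  by apply: aux; rewrite gt_eqF// gt0_2pi.
(* The last grid point before [s], at distance less than h. *)
pose i := Num.truncn (s / h).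
have /andP[i1 i2] : i%:R * h <= s < i%:R * h + h.
  have := @truncn_itv R (s / h); rewrite divr_ge0 ?(ltW h0)// => /(_ isT).
  by rewrite -/i ler_pdivlMr// ltr_pdivrMr// -natr1 mulrDl mul1r.
apply: le_trans (_ : \sum_(j < n) (a (i + j)%N + e) <= _).
  apply: ler_sum => j _; rewrite /a natrD mulrDl.
  have := unif (s + j%:R * h) (i%:R * h + j%:R * h).
  rewrite opprD addrACA subrr addr0 ger0_norm ?subr_ge0// => /(_ _)/wrap[].
    by apply: lt_trans hd; rewrite ltrBlDr addrC.
  rewrite ltr_norml => /andP[_]; lra.
rewrite big_split /= shift sumr_const card_ord mulr2n addrA mulrDr -[e *+ n]mulr_natl.
by rewrite lerD2r.
Qed.

End logp_riemann.

(** * Lower bound for means of log+ |f| and radial limits *)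

Section logp_means.
Variable R : realType.
Local Notation C := R[i].
Implicit Types (z w h l : C) (f : C -> C) (s t : R) (u : circle R) (g : circle R -> C).
Local Notation m := (@circle_measure R).

Lemma expi_per t : expi (t + pi *+ 2) = expi t :> circle R.
Proof.
apply: circle_eq; have := @expi2pi R 0; rewrite /cexp expR0 !mul1r => E.
by rewrite expiD E -expiD addr0.
Qed.

Lemma normc_prod (F : nat -> C) n : normc (\prod_(j < n) F j) = \prod_(j < n) normc (F j).
Proof. by elim: n => [|n IH]; rewrite ?big_ord0 ?normc1// !big_ord_recr /= normcM IH. Qed.

Lemma circle_continuous_logp f (r : R) : holomorphic_disc f -> 0 <= r < 1 ->
  circle_continuous (fun u => logp (normc (f (r%:C * circle_val u)))).
Proof.
move=> hf r01; apply: (circle_continuous_comp (q := fun z => logp (normc z)) hf r01) => z w.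
exact: le_trans (logp_lip (normc_ge0 z) (normc_ge0 w)) (normc_lip _ _).
Qed.

(* Subharmonicity of log+|f|, by the maximum modulus principle for
   [prod_(j < k) f (z e^(2 pi i j / (N k)))]: the factors range over an arc on
   which |f| > 1 when [z = z0], while on |z| = r the product is controlled by a
   Riemann sum of log+|f|. *)
Lemma logp_mean_lower_bound f z0 : holomorphic_disc f -> normc z0 < 1 -> 1 < normc (f z0) ->
  exists2 c : R, 0 < c & forall r, normc z0 <= r < 1 ->
    c <= \int[m]_u logp (normc (f (r%:C * circle_val u))).
Proof.
move=> hf z1 fz1.
pose q := (1 + normc (f z0)) / 2.
have q1 : 1 < q by rewrite /q; lra.
have qf : 0 < normc (f z0) - q by rewrite /q; lra.
have [d d0 Hd] := holomorphic_continuous hf z1 qf.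
have [d' d'0 Hd'] := expi_near1 d0.
(* An arc of length 2 pi / N starting at z0 stays where |f| >= q. *)
pose N := (Num.truncn (pi *+ 2 / d')).+1.
have N0 : 0 < N%:R :> R by rewrite ltr0n.
have Nd : pi *+ 2 / N%:R < d'.
  by rewrite ltr_pdivrMr// mulrC -ltr_pdivrMr// truncnS_gt.
have arc s : `|s| < d' -> q <= normc (f (z0 * circle_val (expi s))).
  move=> /Hd' sd.
  have zd : normc (z0 * circle_val (expi s) - z0) < d.
    rewrite -[X in _ - X]mulr1 -mulrBr normcM; apply: le_lt_trans sd.
    by rewrite ler_piMl// ltW.
  have := Hd _ zd; have := normc_sub_ge (f z0) (f (z0 * circle_val (expi s))).
  by rewrite normcB; lra.
(* [q] and [N] do not depend on r. With M factors and a grid of n = N M points, q^M <= |P(z0)| <=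
   exp (N M (U + e)), and M, which depends on r and e, cancels. *)
exists (ln q / N%:R); first by rewrite divr_gt0// ln_gt0.
move=> r /andP[zr r1]; have r0 : 0 <= r by exact: le_trans zr.
have r01 : 0 <= r < 1 by rewrite r0.
pose k u := logp (normc (f (r%:C * circle_val u))).
have ck : circle_continuous k := circle_continuous_logp hf r01.
set U := \int[m]_u _.
apply/ler_addgt0Pl => e e0.
have e20 : 0 < e / 2 by rewrite divr_gt0.
have [d1 d10 Hd1] := circle_uniform ck e20.
have [d2 d20 Hd2] := expi_near1 d10.
pose M := (Num.truncn (pi *+ 2 / d2)).+1.
have M0 : 0 < M%:R :> R by rewrite ltr0n.
pose n := (N * M)%N.
have n0 : (0 < n)%N by rewrite muln_gt0.
have nE : n%:R = N%:R * M%:R :> R by rewrite natrM.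
pose h := pi *+ 2 / n%:R : R.
have h0 : 0 < h by rewrite divr_gt0 ?gt0_2pi// ltr0n.
have hd : h < d2.
  rewrite /h ltr_pdivrMr ?ltr0n// mulrC -ltr_pdivrMr// (lt_le_trans (truncnS_gt _))//.
  by rewrite ler_nat leq_pmull.
have Mh : M%:R * h = pi *+ 2 / N%:R.
  by rewrite /h nE invfM mulrCA [_^-1 * M%:R^-1]mulrC mulVKf// gt_eqF.
pose P z := \prod_(j < M) f (0 + circle_val (expi (j%:R * h)) * z).
have hP : holomorphic_disc P.
  apply: (@holomorphic_prod R (fun j z => f (0 + circle_val (expi (j%:R * h)) * z))) => j.
  by apply: holomorphic_affine => // w w1; rewrite add0r normcM normc_expiE mul1r.
have Riem s : 0 <= s -> \sum_(j < n) k (expi (s + j%:R * h)) <= n%:R * (U + e).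
  move=> s0; have := @riemann_sum_le R (fun t => k (expi t)) d2 (e / 2) n s.
  rewrite -circle_integral; last exact: circle_continuous_bmf.
  rewrite -[e / 2 *+ 2]mulr_natr divfK//; apply => //.
  - exact: continuous_circle_expi.
  - by move=> t; rewrite expi_per.
  - move=> t t' tt'; apply: Hd1; rewrite normc_expi_sub; exact: Hd2.
have PB z : normc z = r -> normc (P z) <= expR (n%:R * (U + e)).
  move=> nz; have [s /andP[s0 _]] := polar_form z; rewrite nz => zE.
  rewrite /P (normc_prod (fun j => f (0 + circle_val (expi (j%:R * h)) * z))).
  apply: le_trans (_ : expR (\sum_(j < M) k (expi (s + j%:R * h))) <= _).
    rewrite expR_sum; apply: ler_prod => j _; rewrite normc_ge0 /=.
    rewrite add0r zE mulrCA -expiD addrC; exact: le_expR_logp.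
  (* The M factors sit at the first M of the n grid points, and the other terms of the Riemann sum
     are nonnegative. *)
  rewrite ler_expR; apply: le_trans (Riem s s0).
  have Mn : (M <= n)%N by rewrite leq_pmull.
  rewrite -(big_mkord xpredT (fun j => k (expi (s + j%:R * h)))).
  rewrite -(big_mkord xpredT (fun j => k (expi (s + j%:R * h)))).
  rewrite (@big_cat_nat _ _ _ M 0 n)//= lerDl.
  by apply: sumr_ge0 => j _; exact: logp_ge0.
have := max_modulus hP r01 PB zr.
have Pz0 : q ^+ M <= normc (P z0).
  rewrite /P (normc_prod (fun j => f (0 + circle_val (expi (j%:R * h)) * z0))).
  rewrite -{1}(card_ord M) -prodr_const; apply: ler_prod => j _.
  rewrite (ltW (lt_trans ltr01 q1)) /= add0r mulrC; apply: arc.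
  rewrite ger0_norm; last by rewrite mulr_ge0 // ltW.
  apply: (le_lt_trans _ Nd); rewrite -Mh.
  by rewrite ler_wpM2r ?(ltW h0)// ler_nat ltnW.
move=> /(le_trans Pz0).
have q0 : 0 < q by exact: lt_trans q1.
rewrite -{1}[q]lnK ?posrE// -expRM_natl ler_expR nE -mulrA mulrCA ler_pM2l//.
by rewrite [N%:R * _]mulrC -ler_pdivrMr// [e + U]addrC.
Qed.

(** A sequence of radii, as dominated convergence needs countably many functions. The offset 2 makes
    the first radius 1/2 instead of 0. *)
Definition radius n : R := 1 - n.+2%:R^-1.

Lemma radius_gt0 n : 0 < radius n.
Proof. by rewrite subr_gt0 invf_lt1// ltr1n. Qed.

Lemma radius_lt1 n : radius n < 1.
Proof. by rewrite gtrBl invr_gt0. Qed.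

Lemma radius01 n : 0 <= radius n < 1.
Proof. by rewrite radius_lt1 ltW// radius_gt0. Qed.

Lemma radius_near (e : R) : 0 < e -> exists N, forall n, (N <= n)%N -> 1 - radius n < e.
Proof.
move=> e0; exists (Num.truncn e^-1) => n Nn.
rewrite /radius opprB addrCA subrr addr0 invf_plt ?posrE//.
by apply: lt_trans (truncnS_gt _) _; rewrite ltr_nat.
Qed.

Lemma radius_cvg : radius n @[n --> \oo] --> (1 : R)^'-.
Proof.
move=> A [e /= e0 HA]; have [N HN] := radius_near e0.
exists N => // n /= Nn; apply: HA; last exact: radius_lt1.
by rewrite /ball /= ger0_norm ?subr_ge0 ?(ltW (radius_lt1 n))//; exact: HN.
Qed.

Lemma nt_cvgP f u l : nt_cvg f u l <-> forall a : R, 1 < a -> forall e : R, 0 < e ->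
  exists2 d : R, 0 < d & forall z, normc z < 1 ->
    normc (z - circle_val u) < a * (1 - normc z) -> normc (z - circle_val u) < d ->
    normc (f z - l) < e.
Proof.
split=> [H a a1 e e0|H a a1].
  have : nbhs (l : C^o) [set w | normc (w - l) < e] by apply/nbhs_normcP; exists e.
  move=> /(H a a1) /nbhs_normcP [d d0 Hd]; exists d => // z z1 za zd.
  exact: (Hd z zd).
move=> A /nbhs_normcP [e e0 He]; have [d d0 Hd] := H a a1 e e0.
apply/nbhs_normcP; exists d => // z zd [z1 za]; apply: He; exact: Hd.
Qed.

(** Along a radius |z - u| = 1 - |z|, so the radius lies in the Stolz region of aperture 2. *)
Lemma nt_cvg_radius f u l : nt_cvg f u l -> forall e : R, 0 < e -> exists N,
  forall n, (N <= n)%N -> normc (f ((radius n)%:C * circle_val u) - l) < e.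
Proof.
move=> /nt_cvgP /(_ 2 (ltr1n _ 2)) H e e0; have [d d0 Hd] := H e e0.
have [N HN] := radius_near d0; exists N => n Nn.
have E : normc ((radius n)%:C * circle_val u - circle_val u) = 1 - radius n.
  rewrite -[X in _ - X]mul1r -mulrBl -(rmorphB (real_complex R)) normcMr normc_circle mulr1.
  by rewrite distrC ger0_norm// subr_ge0 ltW// radius_lt1.
apply: Hd; rewrite ?normc_rcircle ?E ?radius_lt1 ?(ltW (radius_gt0 n))//; last exact: HN.
by have := radius_lt1 n; lra.
Qed.

(** Identifies almost everywhere the boundary function hidden in [smirnov] with one given
    separately. *)
Lemma nt_cvg_unique f u l l' : nt_cvg f u l -> nt_cvg f u l' -> l = l'.
Proof.
move=> fl fl'; apply/eqP; rewrite -subr_eq0 -normc_eq0; apply/eqP/le_anti.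
rewrite normc_ge0 andbT; apply/ler_addgt0Pl => e e0; rewrite addr0.
have e20 : 0 < e / 2 by rewrite divr_gt0.
have [N HN] := nt_cvg_radius fl e20; have [N' HN'] := nt_cvg_radius fl' e20.
have A := HN _ (leq_maxl N N'); have B := HN' _ (leq_maxr N N').
rewrite (le_trans (normc_triangle _ (f ((radius (maxn N N'))%:C * circle_val u)) _))//.
rewrite [leRHS]splitr; apply: lerD; last exact: ltW.
by rewrite normcB ltW.
Qed.
End logp_means.

Section smirnov_maximum_principle.
Variable R : realType.
Local Notation C := R[i].
Implicit Types (z w h l : C) (f : C -> C) (s t : R) (u : circle R) (g : circle R -> C).
Local Notation m := (@circle_measure R).

Lemma min_lip (a b c : R) : `|Num.min a c - Num.min b c| <= `|a - b|.
Proof.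
rewrite !minEle; case: (leP a c) => ac; case: (leP b c) => bc //.
- have := ler_norm (a - b); have := ler_norm (b - a); rewrite distrC ler_norml.
  by move=> h1 h2; apply/andP; split; lra.
- have := ler_norm (a - b); have := ler_norm (b - a); rewrite distrC ler_norml.
  by move=> h1 h2; apply/andP; split; lra.
- by rewrite subrr normr0.
Qed.

Lemma EFin_circle_integral (k : circle R -> R) : bounded_mfun k ->
  (\int[m]_u (k u)%:E)%E = (\int[m]_u k u)%:E.
Proof.
by move=> bk; rewrite /Rintegral fineK//; apply: integrable_fin_num => //; exact: bounded_mfun_integrable.
Qed.

(** By [logp_div] the mean is that of U - W, where W is U = log+ |f| truncated at ln M. The means of
    U converge to the boundary mean by the Smirnov condition, those of W by dominated convergence,
    and both limits agree because the truncation is invisible on the boundary, where |g| <= M. *)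
Lemma smirnov_logp_mean f g (M e : R) : smirnov f -> boundary_value f g -> 1 <= M ->
  (\forall u \ae m, normc (g u) <= M) -> 0 < e ->
  exists N, forall n, (N <= n)%N ->
    \int[m]_u logp (normc (f ((radius R n)%:C * circle_val u)) / M) < e.
Proof.
move=> [[hf _] [g' bg' cv]] bg M1 gM e0.
have [Z [mZ Z0 HZ]] : \forall u \ae m, nt_cvg f u (g' u) /\ normc (g' u) <= M.
  apply: filterS3 bg' bg gM => u fg' fg gu; split => //.
  by rewrite (nt_cvg_unique fg' fg).
have lnM := ln_ge0 M1.
pose U n u := logp (normc (f ((radius R n)%:C * circle_val u))).
pose W n u := Num.min (U n u) (ln M).
have bU n : bounded_mfun (U n).
  by apply: circle_continuous_bmf; exact: (circle_continuous_logp hf (radius01 R n)).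
have bW n : bounded_mfun (W n) by apply: bounded_mfun_min => //; exact: bounded_mfun_cst.
(* [g'] is arbitrary on the null set [Z]; setting [G] to 0 there makes it a Borel limit of the
   [W n]. *)
pose G : circle R -> R := (fun u => logp (normc (g' u))) \_ (~` Z).
have mZC : measurable (~` Z) by exact: measurableC.
have G0 u : 0 <= G u by rewrite /G patchE; case: ifP => // _; exact: logp_ge0.
have WG u : ~ Z u -> W n u @[n --> \oo] --> G u.
  move=> Zu; have [fu gu] : nt_cvg f u (g' u) /\ normc (g' u) <= M.
    by apply: contrapT => H; apply: Zu; exact: HZ.
  have -> : G u = Num.min (logp (normc (g' u))) (ln M).
    rewrite /G patchE mem_set//; apply/esym/min_idPl.
    have [g1|g1] := leP (normc (g' u)) 1; first by rewrite logp_le1.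
    rewrite (logp_ge1 (ltW g1)) ler_ln// posrE; first exact: lt_trans g1.
    exact: lt_le_trans M1.
  apply/cvgrPdist_lt => e1 e10; have [N HN] := nt_cvg_radius fu e10.
  exists N => // n /= Nn; rewrite distrC; apply: le_lt_trans (HN n Nn).
  apply: le_trans (min_lip _ _ _) _.
  exact: le_trans (logp_lip (normc_ge0 _) (normc_ge0 _)) (normc_lip _ _).
have mG : measurable_fun setT G.
  apply/(measurable_restrictT _ mZC).
  apply: (@measurable_fun_cvg _ _ _ (~` Z) W).
    by move=> n; apply: measurable_funTS; have [] := bW n.
  by move=> u Zu; have := WG u Zu; rewrite /G patchE mem_set.
have cWG : (\int[m]_u (W n u)%:E)%E @[n --> \oo] --> (\int[m]_u (G u)%:E)%E.
  have [] // := @dominated_convergence _ (circle R) R m setT measurableT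
    (fun n u => (W n u)%:E) (fun u => (G u)%:E) (fun=> (ln M)%:E)
    (fun n => (measurable_EFinP _ _).2 (bW n).1) ((measurable_EFinP _ _).2 mG) _
    (bounded_mfun_integrable (bounded_mfun_cst (ln M))).
    exists Z; split => // u; apply: contra_notP => /WG WGu _.
    by apply: cvg_EFin => //; exact: nearW.
  apply: nearW => u n _; rewrite /= lee_fin ger0_norm; first by rewrite ge_min lexx orbT.
  by rewrite le_min logp_ge0.
have GM u : `|G u| <= ln M.
  have [Zu|Zu] := pselect (Z u).
    by rewrite /G patchE ifF ?normr0//; apply/negbTE; rewrite notin_setE => /(_ Zu).
  rewrite ger0_norm//; have : G u <= ln M; last by [].
  apply: (cvgr_to_le (WG u Zu)); apply: nearW => n.
  by rewrite ge_min lexx orbT.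
have bG : bounded_mfun G by split => //; exists (ln M).
have cU : (\int[m]_u (U n u)%:E)%E @[n --> \oo] --> (\int[m]_u (G u)%:E)%E.
  rewrite -(@integral_eq_ae _ _ _ m Z (fun u => (logp (normc (g' u)))%:E))//; last first.
    by move=> u Zu; rewrite /G patchE mem_set.
  exact: (cvg_comp _ _ (@radius_cvg R) cv).
move: cWG cU; rewrite EFin_circle_integral// => cWG cU.
have {}cWG : \int[m]_u W n u @[n --> \oo] --> \int[m]_u G u by exact: (fine_cvg cWG).
have {}cU : \int[m]_u U n u @[n --> \oo] --> \int[m]_u G u by exact: (fine_cvg cU).
have cUW : \int[m]_u U n u - \int[m]_u W n u @[n --> \oo] --> (0 : R).
  by rewrite -(subrr (\int[m]_u G u)); exact: cvgB.
have /cvgrPdist_lt/(_ e e0) [N _ HN] := cUW.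
exists N => n /HN; rewrite /= sub0r normrN => /ltr_normlW.
rewrite -circle_integralB//; congr (_ < _).
by apply: eq_Rintegral => u _; rewrite logp_div.
Qed.

Lemma smirnov_bounded f g (M : R) : smirnov f -> boundary_value f g -> 1 <= M ->
  (\forall u \ae m, normc (g u) <= M) -> forall z, normc z < 1 -> normc (f z) <= M.
Proof.
move=> sf bg M1 gM z z1; rewrite leNgt; apply/negP => Mf.
have M0 : 0 < M by exact: lt_le_trans M1.
pose F w := (M^-1)%:C * f w.
have FE w : normc (F w) = normc (f w) / M.
  by rewrite normcMr ger0_norm 1?mulrC// invr_ge0 ltW.
have hF : holomorphic_disc F.
  have [[hf _] _] := sf; exact: (holomorphicM (@holomorphic_cst R (M^-1)%:C) hf).
have F1 : 1 < normc (F z) by rewrite FE ltr_pdivlMr// mul1r.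
have [c c0 Hc] := logp_mean_lower_bound hF z1 F1.
have [N HN] := smirnov_logp_mean sf bg M1 gM c0.
have z10 : 0 < 1 - normc z by rewrite subr_gt0.
have [N' HN'] := radius_near z10.
pose n := maxn N N'.
have := HN n (leq_maxl _ _); rewrite ltNge => /negP; apply.
have := Hc (radius R n); rewrite radius_lt1 andbT.
have := HN' n (leq_maxr _ _) => rn.
under eq_Rintegral do rewrite FE.
by apply; lra.
Qed.

End smirnov_maximum_principle.

(** * Cauchy and Poisson integrals, Fatou's theorem *)

Section poisson.
Variable R : realType.
Local Notation C := R[i].
Implicit Types (z w h l : C) (f : C -> C) (s t : R) (u : circle R) (g : circle R -> C).
Local Notation m := (@circle_measure R).

Lemma normc_conj z : normc (conjc z) = normc z.
Proof. by case: z => a b /=; rewrite sqrrN. Qed.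

Lemma conjcM z w : conjc (z * w) = conjc z * conjc w.
Proof. exact: rmorphM. Qed.

Lemma conjc1B z : conjc (1 - z) = 1 - conjc z.
Proof. by rewrite [LHS]rmorphB rmorph1. Qed.

Lemma circle_conj u : conjc (circle_val u) * circle_val u = 1.
Proof.
have := circle_sqr u; case: (circle_val u) => a b /= E.
apply/eqP; rewrite eq_complex /= mulNr opprK -!expr2 E eqxx /=.
by apply/eqP; ring.
Qed.

Lemma holomorphic_inv1B : holomorphic_disc (fun w : C => (1 - w)^-1).
Proof.
move=> w w1; apply: (@derivableV _ _ (fun w : C^o => 1 - w : C^o)).
  apply/eqP => /eqP; rewrite subr_eq0 => /eqP E; move: w1.
  by rewrite /disc /= -E normc1 ltxx.
exact: (@derivableB _ C^o C^o (fun=> 1) id).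
Qed.

Lemma sub1_neq0 w : normc w < 1 -> 1 - w != 0.
Proof.
move=> w1; rewrite subr_eq0; apply/eqP => E; move: w1.
by rewrite -E normc1 ltxx.
Qed.

Lemma normc_mul_circle z u : normc (z * circle_val u) = normc z.
Proof. by rewrite normcM normc_circle mulr1. Qed.

(** With z = |z| e^(it), this is the restriction to the circle of radius |z| of a function
    holomorphic in the disc. *)
Lemma bounded_cmfun_inv1B z : normc z < 1 -> bounded_cmfun (fun u => (1 - z * circle_val u)^-1).
Proof.
move=> z1; have [t _ zE] := polar_form z.
have hf : holomorphic_disc (fun w => (1 - (0 + circle_val (expi t) * w))^-1).
  apply: (holomorphic_affine holomorphic_inv1B) => w w1.
  by rewrite add0r normcM normc_expiE mul1r.
have n01 : 0 <= normc z < 1 by rewrite normc_ge0.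
rewrite (_ : (fun _ => _) = fun u => (1 - (0 + circle_val (expi t) *
  ((normc z)%:C * circle_val u)))^-1).
  exact: (bounded_cmfun_holomorphic hf n01).
by apply/funext => u; rewrite {1}zE add0r; congr (1 - _)^-1; ring.
Qed.

Lemma normc_inv1B_le w (r : R) : normc w <= r -> r < 1 -> normc (1 - w)^-1 <= (1 - r)^-1.
Proof.
move=> wr r1; rewrite normcV lef_pV2 ?posrE ?subr_gt0//.
  apply: le_trans (normc_sub_ge _ _); rewrite normc1; lra.
by apply: normc_gt0; apply: sub1_neq0; exact: le_lt_trans r1.
Qed.

(** The terms of the geometric series are removed one at a time: each contributes 0, so all the
    tails [A n] are equal, and they are O(|z|^(n+1)). No series is integrated term by term. *)
Lemma fourier0_geometric g (K : R) z : bounded_cmfun g -> (forall u, normc (g u) <= K) ->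
  (forall n, fourier0 (fun u => g u * circle_val u ^+ n.+1) = 0) -> normc z < 1 ->
  fourier0 (fun u => g u * (z * circle_val u / (1 - z * circle_val u))) = 0.
Proof.
move=> bg gK g0 z1.
have cz : bounded_cmfun (fun u => z * circle_val u).
  by apply: bounded_cmfunM; [exact: bounded_cmfun_cst|exact: bounded_cmfun_circle].
have ci := bounded_cmfun_inv1B z1.
have K0 : 0 <= K by apply: le_trans (gK (circle1 R)).
pose A n := fourier0 (fun u => g u * ((z * circle_val u) ^+ n.+1 / (1 - z * circle_val u))).
have cA n : bounded_cmfun (fun u => g u * ((z * circle_val u) ^+ n.+1 / (1 - z * circle_val u))).
  by apply: bounded_cmfunM => //; apply: bounded_cmfunM => //; exact: bounded_cmfunX.
have AS n : A n = A n.+1.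
  have -> : A n = fourier0 (fun u => z ^+ n.+1 * (g u * circle_val u ^+ n.+1) +
     g u * ((z * circle_val u) ^+ n.+2 / (1 - z * circle_val u))).
    congr fourier0; apply/funext => u; rewrite [(_ * _) ^+ n.+2]exprS !exprMn.
    by field; apply: sub1_neq0; rewrite normc_mul_circle.
  have cgu : bounded_cmfun (fun u => g u * circle_val u ^+ n.+1).
    by apply: bounded_cmfunM => //; apply: bounded_cmfunX; exact: bounded_cmfun_circle.
  rewrite fourier0D//; last by apply: bounded_cmfunM => //; exact: bounded_cmfun_cst.
  by rewrite fourier0Z// g0 mulr0 add0r.
have A0 n : A 0%N = A n by elim: n => // n ->; exact: AS.
have -> : fourier0 (fun u => g u * (z * circle_val u / (1 - z * circle_val u))) = A 0%N.
  by congr fourier0; apply/funext => u; rewrite expr1.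
apply/eqP; rewrite -normc_eq0 eq_le normc_ge0 andbT; apply/ler_addgt0Pl => e e0; rewrite addr0.
pose B := 2 * (K * (1 - normc z)^-1) + 1.
have z1' : 0 < 1 - normc z by rewrite subr_gt0.
have B0 : 0 < B by rewrite ltr_wpDl// mulr_ge0// mulr_ge0// invr_ge0 ltW.
have Abound n : normc (A n) <= B * normc z ^+ n.+1.
  apply: le_trans (_ : 2 * \int[m]_u (K * ((1 - normc z)^-1 * normc z ^+ n.+1)) <= _).
    apply: normc_fourier0_le => //; first exact: bounded_mfun_cst.
    move=> u; rewrite !normcM normcX normc_mul_circle; apply: ler_pM => //.
      by rewrite mulr_ge0// exprn_ge0.
    rewrite mulrC ler_wpM2r ?exprn_ge0//; apply: normc_inv1B_le => //.
    by rewrite normc_mul_circle.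
  by rewrite circle_integral_cst /B [X in _ <= X]mulrDl mul1r -!mulrA lerDl exprn_ge0.
have : exists n, normc z ^+ n < e / B.
  have [z0|z0] := eqVneq (normc z) 0; first by exists 1%N; rewrite z0 expr1 divr_gt0.
  have /cvgrPdist_lt /(_ _ (divr_gt0 e0 B0)) [N _ HN] :
      (normc z ^+ n) @[n --> \oo] --> (0 : R).
    by apply: cvg_expr; rewrite ger0_norm.
  by exists N; have := HN N (leqnn N); rewrite sub0r normrN ger0_norm// exprn_ge0.
move=> [n]; rewrite ltr_pdivlMr// mulrC => /ltW; apply: le_trans.
rewrite (A0 n); apply: le_trans (Abound n) _; rewrite ler_wpM2l ?(ltW B0)//.
by rewrite exprS ler_piMl ?exprn_ge0// ltW.
Qed.

Definition poisson z u : R := (1 - normc z ^+ 2) / normc (circle_val u - z) ^+ 2.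

(** The Poisson kernel is the Cauchy kernel plus a series in positive powers of u. Orthogonality to
    these powers kills the second part, so that the Cauchy integral becomes a Poisson integral. *)
Lemma poissonE z u : normc z < 1 -> (poisson z u)%:C =
  (1 - z * conjc (circle_val u))^-1 +
  conjc z * circle_val u / (1 - conjc z * circle_val u).
Proof.
move=> z1; set w := conjc z * circle_val u.
have zw : z * conjc (circle_val u) = conjc w by rewrite /w conjcM conjcK.
have nw : normc w = normc z by rewrite normc_mul_circle normc_conj.
have w1 : 1 - w != 0 by apply: sub1_neq0; rewrite nw.
have w1' : 1 - conjc w != 0 by apply: sub1_neq0; rewrite normc_conj nw.
have nuz : normc (circle_val u - z) = normc (1 - w).
  rewrite -(normc_conj (1 - w)) conjc1B -zw.
  rewrite -[RHS]mulr1 -[X in _ * X](normc_circle u) -normcM mulrBl mul1r.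
  by rewrite -mulrA circle_conj mulr1.
have sq y : ((normc y ^+ 2)%:C : C) = y * conjc y.
  by rewrite -sqr_normc normCE rmorphXn.
have divE (a b : R) : ((a / b)%:C : C) = a%:C / b%:C by exact: (fmorph_div (real_complex R)).
have subE (a : R) : ((1 - a)%:C : C) = 1 - a%:C by rewrite [LHS]rmorphB rmorph1.
rewrite /poisson zw nuz -nw divE subE !sq conjc1B.
by field; rewrite w1 w1'.
Qed.

Lemma poisson_ge0 z u : normc z < 1 -> 0 <= poisson z u.
Proof.
by move=> z1; rewrite divr_ge0 ?sqr_ge0// subr_ge0 expr_le1// ltW.
Qed.

Lemma bounded_cmfun_poisson z : normc z < 1 -> bounded_cmfun (fun u => (poisson z u)%:C).
Proof.
move=> z1; have z1' : normc (conjc z) < 1 by rewrite normc_conj.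
rewrite (_ : (fun _ => _) = fun u => conjc ((1 - conjc z * circle_val u)^-1) +
  conjc z * circle_val u / (1 - conjc z * circle_val u)).
  have ci := bounded_cmfun_inv1B z1'; apply: bounded_cmfunD; first exact: bounded_cmfun_conj.
  apply: bounded_cmfunM => //; apply: bounded_cmfunM; [exact: bounded_cmfun_cst|exact: bounded_cmfun_circle].
apply/funext => u; rewrite poissonE//; congr (_ + _).
by rewrite conjc_inv conjc1B conjcM conjcK.
Qed.

Lemma bounded_mfun_poisson z : normc z < 1 -> bounded_mfun (poisson z).
Proof. by move=> /bounded_cmfun_poisson []. Qed.

Lemma fourier0_circle_expn n : fourier0 (fun u : circle R => circle_val u ^+ n.+1) = 0.
Proof.
have h01 : 0 < (2^-1 : R) < 1 by apply/andP; split; lra.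
have := @mean_value_expn R id 2^-1 n (@holomorphic_id R) erefl h01.
rewrite (_ : (fun _ => _) = fun u : circle R => (2^-1)%:C * circle_val u ^+ n.+1); last first.
  by apply/funext => u; rewrite exprS mulrA.
rewrite fourier0Z; last by apply: bounded_cmfunX; exact: bounded_cmfun_circle.
move=> /eqP; rewrite mulf_eq0 => /orP[/eqP[]/eqP|/eqP//].
by rewrite invr_eq0 pnatr_eq0.
Qed.

(** The kernel has mean 1: it equals 1 + 2 Re q, where [q] has mean 0 by [fourier0_geometric] for
    the constant 1. *)
Lemma fourier0_poisson_cst z l : normc z < 1 -> fourier0 (fun u => (poisson z u)%:C * l) = l.
Proof.
move=> z1; have z1' : normc (conjc z) < 1 by rewrite normc_conj.
pose q u := conjc z * circle_val u / (1 - conjc z * circle_val u).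
have cq : bounded_cmfun q.
  apply: bounded_cmfunM; last exact: bounded_cmfun_inv1B.
  by apply: bounded_cmfunM; [exact: bounded_cmfun_cst|exact: bounded_cmfun_circle].
have q0 : fourier0 q = 0.
  rewrite -[RHS](@fourier0_geometric (fun=> 1) 1 (conjc z))//.
  - by congr fourier0; apply/funext => u; rewrite mul1r.
  - exact: bounded_cmfun_cst.
  - by move=> _; rewrite normc1.
  - move=> n; rewrite -[RHS](fourier0_circle_expn n).
    by congr fourier0; apply/funext => u; rewrite mul1r.
have P1 : \int[m]_u poisson z u = 1.
  have -> : \int[m]_u poisson z u = \int[m]_u (1 + (2 * complex.Re (q u))).
    apply: eq_Rintegral => u _.
    have -> : poisson z u = complex.Re ((poisson z u)%:C) by [].
    have w1 : 1 - conjc z * circle_val u != 0.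
      by apply: sub1_neq0; rewrite normc_mul_circle.
    rewrite poissonE// -/(q u).
    have -> : (1 - z * conjc (circle_val u))^-1 = 1 + conjc (q u).
      rewrite /q !conjcM conjc_inv conjc1B conjcM conjcK.
      field; rewrite -[z]conjcK -conjcM -conjc1B.
      by rewrite conjc_eq0.
    by case: (q u) => a b /=; ring.
  have [bq _] := cq.
  rewrite circle_integralD ?circle_integral_cst; last 2 first.
  - exact: bounded_mfun_cst.
  - by apply: bounded_mfunM => //; exact: bounded_mfun_cst.
  rewrite circle_integralZ//.
  have : complex.Re (fourier0 q) = 0 by rewrite q0.
  by rewrite /fourier0 /= => ->; rewrite mulr0 addr0.
have -> : (fun u => (poisson z u)%:C * l) = (fun u => l * (poisson z u)%:C).
  by apply/funext => u; rewrite mulrC.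
rewrite fourier0Z; last exact: bounded_cmfun_poisson.
have -> : fourier0 (fun u => (poisson z u)%:C) = 1; last by rewrite mulr1.
by rewrite /fourier0 /= P1 circle_integral_cst.
Qed.

Section cauchy_integral.
Variables (T : circle R -> C) (K : R).
Hypothesis bT : bounded_cmfun T.
Hypothesis TK : forall u, normc (T u) <= K.

(** On the circle 1 / (1 - z conj u) = u / (u - z), so this is the Cauchy integral of [T] written
    with respect to [m]. *)
Definition cauchy z := fourier0 (fun u => T u * (1 - z * conjc (circle_val u))^-1).

Lemma bounded_cmfun_inv1B_conj z : normc z < 1 -> bounded_cmfun (fun u => (1 - z * conjc (circle_val u))^-1).
Proof.
move=> z1; have z1' : normc (conjc z) < 1 by rewrite normc_conj.
rewrite (_ : (fun _ => _) = fun u => conjc ((1 - conjc z * circle_val u)^-1)).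
  by apply: bounded_cmfun_conj; exact: bounded_cmfun_inv1B.
by apply/funext => u; rewrite conjc_inv conjc1B conjcM conjcK.
Qed.

Lemma holomorphic_cauchy : holomorphic_disc cauchy.
Proof.
move=> z; rewrite /disc /= => z1; apply/derivable_cderiv.
have K0 : 0 <= K by apply: le_trans (TK (circle1 R)).
pose v u := conjc (circle_val u).
have cv : bounded_cmfun v by apply: bounded_cmfun_conj; exact: bounded_cmfun_circle.
pose I w u := (1 - w * v u)^-1.
have cI w : normc w < 1 -> bounded_cmfun (I w) by exact: bounded_cmfun_inv1B_conj.
have nv w u : normc (w * v u) = normc w.
  by rewrite normcM normc_conj normc_circle mulr1.
exists (fourier0 (fun u => T u * (v u * I z u ^+ 2))) => e e0.
(* Half the distance to the circle: for |h| < d both kernels are bounded by 1 / d. *)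
pose d := (1 - normc z) / 2; have d0 : 0 < d by rewrite divr_gt0// subr_gt0.
pose B := 2 * (K * (d^-1 ^+ 3)) + 1.
have B0 : 0 < B by rewrite ltr_wpDl// mulr_ge0// mulr_ge0// exprn_ge0// invr_ge0 ltW.
exists (Num.min d (e / B)); first by rewrite lt_min d0 divr_gt0.
move=> h; rewrite lt_min => /andP[hd he].
have zh1 : normc (z + h) <= 1 - d.
  apply: le_trans (le_normcD _ _) _; rewrite /d in hd *; lra.
have zh1' : normc (z + h) < 1 by apply: le_lt_trans zh1 _; lra.
have Iz u : normc (I z u) <= d^-1.
  rewrite /I (_ : d = 1 - (1 - d)); last by ring.
  apply: normc_inv1B_le; last by lra.
  rewrite nv /d; lra.
have Izh u : normc (I (z + h) u) <= d^-1.
  rewrite /I (_ : d^-1 = (1 - (1 - d))^-1); last by congr (_^-1); ring.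
  apply: normc_inv1B_le; last by lra.
  by rewrite nv.
(* Applying I(z+h) - I(z) = h v I(z) I(z+h) twice gives the remainder exactly, with the factor
   h^2. *)
have E : cauchy (z + h) - cauchy z - fourier0 (fun u => T u * (v u * I z u ^+ 2)) * h =
   fourier0 (fun u => h ^+ 2 * (T u * (v u ^+ 2 * I z u ^+ 2 * I (z + h) u))).
  rewrite [fourier0 _ * h]mulrC -fourier0Z; last first.
    by apply: bounded_cmfunM => //; apply: bounded_cmfunM => //; apply: bounded_cmfunX; exact: cI.
  rewrite -!fourier0B; last first.
  - by apply: bounded_cmfunM => //; exact: cI.
  - by apply: bounded_cmfunM => //; exact: cI.
  - by apply: bounded_cmfunM; [exact: bounded_cmfun_cst|apply: bounded_cmfunM => //; apply: bounded_cmfunM => //; apply: bounded_cmfunX; exact: cI].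
  - by apply: bounded_cmfunB; apply: bounded_cmfunM => //; exact: cI.
  congr fourier0; apply/funext => u; rewrite /I -/(v u).
  have n1 : 1 - z * v u != 0 by apply: sub1_neq0; rewrite nv.
  have n2 : 1 - (z + h) * v u != 0 by apply: sub1_neq0; rewrite nv.
  by field; rewrite n1 n2.
rewrite E fourier0Z; last first.
  apply: bounded_cmfunM => //; apply: bounded_cmfunM; last exact: cI.
  by apply: bounded_cmfunM; apply: bounded_cmfunX => //; exact: cI.
rewrite normcM normcX expr2 [e * _]mulrC -mulrA ler_wpM2l//.
apply: le_trans (_ : normc h * B <= _).
  rewrite ler_wpM2l// (le_trans (_ : _ <= 2 * \int[m]_u (K * d^-1 ^+ 3)))//.
    apply: normc_fourier0_le => //; last 2 first.
    - exact: bounded_mfun_cst.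
    - move=> u; rewrite normcM [normc (_ * I (z + h) u)]normcM [normc (_ ^+ 2 * _)]normcM !normcX normc_conj normc_circle expr1n mul1r.
      apply: ler_pM => //; first by rewrite mulr_ge0 ?exprn_ge0.
      rewrite [d^-1 ^+ 3]exprSr; apply: ler_pM => //; first exact: sqr_ge0.
      by rewrite lerXn2r ?nnegrE// invr_ge0 ltW.
    apply: bounded_cmfunM => //; apply: bounded_cmfunM; last exact: cI.
    by apply: bounded_cmfunM; apply: bounded_cmfunX => //; exact: cI.
  by rewrite circle_integral_cst lerDl.
by move: he; rewrite ltr_pdivlMr// => /ltW.
Qed.

Hypothesis T0 : forall n, fourier0 (fun u => T u * circle_val u ^+ n) = 0.

Lemma cauchy_poisson z : normc z < 1 -> cauchy z = fourier0 (fun u => (poisson z u)%:C * T u).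
Proof.
move=> z1; have z1' : normc (conjc z) < 1 by rewrite normc_conj.
have H := @fourier0_geometric T K (conjc z) bT TK (fun n => T0 n.+1) z1'.
rewrite /cauchy -[LHS]addr0 -H -fourier0D.
- by congr fourier0; apply/funext => u; rewrite poissonE//; ring.
- by apply: bounded_cmfunM => //; exact: bounded_cmfun_inv1B_conj.
apply: bounded_cmfunM => //; apply: bounded_cmfunM; last exact: bounded_cmfun_inv1B.
by apply: bounded_cmfunM; [exact: bounded_cmfun_cst|exact: bounded_cmfun_circle].
Qed.

Lemma cauchy_sub_le z l : normc z < 1 ->
  normc (cauchy z - l) <= 2 * \int[m]_u (poisson z u * normc (T u - l)).
Proof.
move=> z1; have cl : bounded_cmfun (fun u => T u - l) by apply: bounded_cmfunB => //; exact: bounded_cmfun_cst.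
have cP := bounded_cmfun_poisson z1.
rewrite cauchy_poisson// -{1}(fourier0_poisson_cst l z1) -fourier0B; last 2 first.
- exact: bounded_cmfunM.
- by apply: bounded_cmfunM => //; exact: bounded_cmfun_cst.
apply: normc_fourier0_le.
- by apply: bounded_cmfunB; apply: bounded_cmfunM => //; exact: bounded_cmfun_cst.
- by apply: bounded_mfunM; [exact: bounded_mfun_poisson|exact: bounded_mfun_normc].
by move=> u; rewrite -mulrBr normcMr ger0_norm ?poisson_ge0.
Qed.

End cauchy_integral.
End poisson.

(** * Lebesgue points and nontangential limits of the Poisson integral *)

Section fatou.
Variable R : realType.
Local Notation C := R[i].
Implicit Types (z w h l : C) (f : C -> C) (s t : R) (u : circle R) (g : circle R -> C).
Local Notation m := (@circle_measure R).
Local Notation mu := (@lebesgue_measure R).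

Lemma normc_expiN s : normc (circle_val (expi (- s)) - 1) = normc (circle_val (expi s) - 1).
Proof.
rewrite -[RHS]normc_conj; congr normc.
by apply/eqP; rewrite eq_complex /= cosN sinN oppr0 !addr0 !eqxx.
Qed.

Lemma expi_neq1 s : 0 < s < pi *+ 2 -> 0 < normc (circle_val (expi s) - 1).
Proof.
move=> /andP[s0 s2]; apply: normc_gt0; rewrite subr_eq0 eq_complex /=; apply/negP => /andP[/eqP c1 _].
have sp : 0 < s / 2 < pi by apply/andP; split; lra.
have := sin_gt0_pi sp => s20.
have := cos_mulr2n (s / 2); rewrite -[s / 2 *+ 2]mulr_natr divfK// c1.
have := cos2Dsin2 (s / 2) => E1 E2.
have : 0 < sin (s / 2) ^+ 2 by rewrite exprn_gt0.
rewrite -mulr_natl in E2; lra.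
Qed.

(** Short chords from e^(it) could come from angles near t or from angles differing by nearly 2 pi.
    As t is interior, |s - t| stays below M < 2 pi: near 0 the expansion of sin gives the
    inequality, and on the remaining compact range chords are at least [k]. *)
Lemma chord_lower_bound t : 0 < t < pi *+ 2 -> exists2 k : R, 0 < k &
  forall s, 0 <= s <= pi *+ 2 -> normc (circle_val (expi s) - circle_val (expi t)) < k ->
    `|s - t| <= 2 * normc (circle_val (expi s) - circle_val (expi t)).
Proof.
move=> /andP[t0 t2].
have h0 : 0 < 2^-1 :> R by [].
have [d d0 Hd] := real_expansion (is_derive_sin (0 : R)) h0.
have near_bound s : `|s| < d -> `|s| <= 2 * normc (circle_val (expi s) - 1).
  move=> sd; have := Hd s sd; rewrite sin0 cos0 subr0 mul1r => H.
  have : `|s| <= `|sin s - s| + `|sin s|.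
    by rewrite -[X in `|X| <= _](subKr (sin s)) distrC (le_trans (ler_normB _ _))// addrC distrC.
  have := Im_le_normc (circle_val (expi s) - 1); rewrite ImB /= subr0; lra.
pose M := Num.max t (pi *+ 2 - t).
have M2 : M < pi *+ 2 by rewrite gt_max t2 /=; lra.
have [k k0 Hk] : exists2 k : R, 0 < k & forall s, d <= `|s| -> `|s| <= M ->
    k <= normc (circle_val (expi s) - 1).
  have [dM|Md] := leP d M; last first.
    by exists 1 => // s ds sM; have := le_lt_trans (le_trans ds sM) Md; rewrite ltxx.
  have ck : circle_continuous (fun u => normc (circle_val u - 1)).
    move=> u e e0; exists e => // v; apply: le_lt_trans.
    apply: le_trans (normc_lip _ _) _.
    by rewrite opprB addrA subrK.
  have [|c cdM Hc] := @EVT_min R (fun s => normc (circle_val (expi s) - 1)) d M dM.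
    apply: continuous_subspaceT; exact: (continuous_circle_expi ck).
  exists (normc (circle_val (expi c) - 1)).
    apply: expi_neq1; move: cdM; rewrite in_itv/= => /andP[dc cM].
    by rewrite (lt_le_trans d0 dc) (le_lt_trans cM).
  move=> s ds sM; have [s0|s0] := leP 0 s.
    by apply: Hc; rewrite in_itv/= -(ger0_norm s0) ds.
  rewrite -(normc_expiN s); apply: Hc; rewrite in_itv/=.
  by rewrite -(ltr0_norm s0) ds.
exists k => // s /andP[s0 s2]; rewrite normc_expi_sub => sk.
apply: near_bound; rewrite ltNge; apply/negP => ds.
move: sk; rewrite ltNge => /negP; apply; apply: Hk => //.
by rewrite /M le_max ler_norml ler_norml; case: (leP s t) => st; apply/orP; [left|right]; apply/andP; split; lra.
Qed.

Lemma bounded_mfun_chord u (r : R) : bounded_mfun (fun v => (normc (circle_val v - circle_val u) < r)%R%:R).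
Proof.
split; last by exists 1 => v; rewrite ger0_norm ?ler0n// lern1 leq_b1.
rewrite (_ : (fun _ => _) = fun v => if normc (circle_val v - circle_val u) < r then 1 else 0).
  apply: measurable_fun_ifT; [|exact: measurable_cst|exact: measurable_cst].
  apply: measurable_fun_ltr; last exact: measurable_cst.
  by have [] := bounded_mfun_normc (bounded_cmfunB (bounded_cmfun_circle R) (bounded_cmfun_cst (circle_val u))).
by apply/funext => v; case: ifP.
Qed.

(** Lebesgue points of [T] for arcs measured by their chords. An arc of chord radius r has measure
    of order r, whence e * r in place of an average. *)
Definition chord_lebesgue_pt (T : circle R -> C) u := forall e : R, 0 < e ->
  exists2 k : R, 0 < k & forall r : R, 0 < r -> r <= k ->
    \int[m]_v (normc (T v - T u) * (normc (circle_val v - circle_val u) < r)%R%:R) <= e * r.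

Lemma lebesgue_pt_ball (f : R -> R) t (e : R) : lebesgue_pt f t -> 0 < e ->
  exists2 k : R, 0 < k & forall r : R, 0 < r -> r < k ->
    (\int[mu]_(y in ball t r) `|(f y - f t)%:E| <= (e * r)%:E)%E.
Proof.
move=> ft e0; have e20 : 0 < e / 2 by rewrite divr_gt0.
have : nbhs (0 : \bar R) [set x | (x < (e / 2)%:E)%E].
  by apply: (@open_nbhs_nbhs (\bar R)); split; [exact: open_ereal_lt_ereal|rewrite /= lte_fin].
move=> /ft [k /= k0 Hk]; exists k => // r r0 rk.
have : (davg f t r < (e / 2)%:E)%E.
  by apply: Hk => //; rewrite /ball /= sub0r normrN gtr0_norm.
move=> /ltW; rewrite /davg /iavg (lebesgue_measure_ball _ (ltW r0)) inver.
rewrite mulrn_eq0 /= gt_eqF// lee_pdivrMl ?mulrn_wgt0// -EFinM.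
rewrite (_ : r *+ 2 * (e / 2) = e * r)//.
by rewrite -mulr_natr; field.
Qed.

(** Lebesgue differentiation on the line is applied to the real and imaginary parts of T(e^(it)),
    and the exceptional angles are carried over by [circle_negligible]. *)
Lemma ae_chord_lebesgue_pt (T : circle R -> C) : bounded_cmfun T ->
  \forall u \ae m, chord_lebesgue_pt T u.
Proof.
move=> bT; have [[mre [Kre Hre]] [mim [Kim Him]]] := bT.
pose re t := complex.Re (T (expi t)); pose im t := complex.Im (T (expi t)).
have me : measurable_fun setT (@expi R) by exact: measurable_expi.
have mre' : measurable_fun setT re by exact: (measurableT_comp mre me).
have mim' : measurable_fun setT im by exact: (measurableT_comp mim me).
have li (f : R -> R) K : measurable_fun setT f -> (forall t, `|f t| <= K) -> locally_integrable setT f.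
  move=> mf fK; split => //; first exact: openT.
  move=> A _ cA; have mA := compact_measurable cA.
  have : mu.-integrable A (EFin \o f).
    apply: measurable_bounded_integrable => //.
    - exact: compact_finite_measure.
    - exact: measurable_funTS.
    - by exists K; split; [rewrite num_real|move=> x Kx t _; rewrite /= (le_trans (fK t))// ltW].
  by move=> /integrableP[].
have [N1 [mN1 N10 HN1]] := lebesgue_differentiation (li _ _ mre' (fun t => Hre (expi t))).
have [N2 [mN2 N20 HN2]] := lebesgue_differentiation (li _ _ mim' (fun t => Him (expi t))).
have N0 : mu (N1 `|` N2) = 0%E.
  apply: measure_negligible; first exact: measurableU.
  by apply: negligibleU; apply/negligibleP.
apply: (circle_negligible (measurableU _ _ mN1 mN2) N0) => t t02 tp; apply: contra_notP => Nt.
have lre : lebesgue_pt re t by apply: contrapT => H; apply: Nt; left; exact: HN1.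
have lim : lebesgue_pt im t by apply: contrapT => H; apply: Nt; right; exact: HN2.
move=> e e0; have e20 : 0 < e / 2 by rewrite divr_gt0.
have [k1 k10 H1] := lebesgue_pt_ball lre e20.
have [k2 k20 H2] := lebesgue_pt_ball lim e20.
have [k3 k30 H3] := chord_lower_bound t02.
(* Chords below r <= k3 correspond to angles within 2 r of t, and r <= k1 / 4 ensures 2 r < k1;
   likewise for k2. *)
exists (Num.min (k1 / 4) (Num.min (k2 / 4) k3)).
  by rewrite !lt_min k30 !divr_gt0.
move=> r r0; rewrite !le_min => /andP[rk1 /andP[rk2 rk3]].
have bF : bounded_mfun (fun v => normc (T v - T (expi t)) *
    (normc (circle_val v - circle_val (expi t)) < r)%R%:R).
  apply: bounded_mfunM; last exact: bounded_mfun_chord.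
  by apply: bounded_mfun_normc; apply: bounded_cmfunB => //; exact: bounded_cmfun_cst.
rewrite -lee_fin -EFin_circle_integral// circle_integral_ge0; last 2 first.
- by apply/measurable_EFinP; have [] := bF.
- by move=> v; rewrite lee_fin mulr_ge0.
rewrite lee_pdivrMl ?gt0_2pi//.
pose G s := (`|(re s - re t)%:E| + `|(im s - im t)%:E|)%E.
have mB : measurable (ball t (2 * r)) by exact: measurable_ball.
have mdre : measurable_fun setT (fun s => `|(re s - re t)%:E|%E).
  by apply: measurableT_comp => //; apply/measurable_EFinP; apply: measurable_funB => //; exact: measurable_cst.
have mdim : measurable_fun setT (fun s => `|(im s - im t)%:E|%E).
  by apply: measurableT_comp => //; apply/measurable_EFinP; apply: measurable_funB => //; exact: measurable_cst.
have mG : measurable_fun setT G by exact: emeasurable_funD.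
have IG : (\int[mu]_(s in ball t (2 * r)) G s <= (e * (2 * r))%:E)%E.
  rewrite ge0_integralD//=; try exact: measurable_funTS.
  rewrite (_ : e * (2 * r) = e / 2 * (2 * r) + e / 2 * (2 * r)); last by field.
  have r20 : 0 < 2 * r by rewrite mulr_gt0.
  rewrite EFinD; apply: leeD; [apply: H1|apply: H2] => //; lra.
apply: le_trans (_ : (e * (2 * r))%:E <= _)%E; last first.
  rewrite -EFinM lee_fin mulrCA ler_wpM2r ?mulr_ge0 ?(ltW e0) ?(ltW r0)//.
  by rewrite (le_trans (@pi_ge2 R))// mulr2n lerDl pi_ge0.
apply: le_trans IG; rewrite [leRHS]integral_mkcond.
apply: le_trans (_ : (\int[mu]_(s in `[0%R, (pi *+ 2)%R]) (G \_ (ball t (2 * r))) s <= _)%E).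
  apply: ge0_le_integral => //=.
  - by move=> s _; rewrite lee_fin mulr_ge0.
  - apply/measurable_EFinP; apply: measurable_funTS.
    exact: (measurableT_comp bF.1 me).
  - apply: measurable_funTS; apply/(measurable_restrictT _ mB).
    exact: measurable_funTS.
  move=> s; rewrite in_itv/= => s02.
  have [sr|sr] := boolP (normc (circle_val (expi s) - circle_val (expi t)) < r); last first.
    by rewrite mulr0 patchE; case: ifP => // _; rewrite adde_ge0.
  rewrite mulr1 patchE mem_set; last first.
    rewrite /ball /= distrC; apply: le_lt_trans (H3 s s02 (lt_le_trans sr rk3)) _.
    by rewrite ltr_pM2l.
  rewrite /G -EFinD lee_fin (le_trans (normc_le_ReIm _))// ReB ImB.
  by [].
apply: ge0_subset_integral => //=.
- apply/(measurable_restrictT _ mB); exact: measurable_funTS.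
- by move=> s _; rewrite patchE; case: ifP => // _; rewrite adde_ge0.
Qed.

Lemma circle_integral_sum (F : nat -> circle R -> R) n : (forall j, bounded_mfun (F j)) ->
  bounded_mfun (fun u => \sum_(j < n) F j u) /\
  \int[m]_u (\sum_(j < n) F j u) = \sum_(j < n) \int[m]_u F j u.
Proof.
move=> bF; elim: n => [|n [bS IS]].
  have E : (fun u => \sum_(j < 0) F j u) = (fun=> 0) by apply/funext => u; rewrite big_ord0.
  by rewrite big_ord0 E; split; [exact: bounded_mfun_cst|exact: circle_integral_cst].
have E : (fun u => \sum_(j < n.+1) F j u) = (fun u => \sum_(j < n) F j u + F n u).
  by apply/funext => u; rewrite big_ord_recr.
rewrite E; split; first exact: bounded_mfunD.
by rewrite circle_integralD// IS big_ord_recr.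
Qed.

Lemma sum_half_pow_le n : \sum_(j < n) (2 ^- j : R) <= 2.
Proof.
suff -> : \sum_(j < n) (2 ^- j : R) = 2 - 2 * 2 ^- n.
  by rewrite gerBl mulr_ge0// invr_ge0 exprn_ge0.
elim: n => [|n IH]; first by rewrite big_ord0 expr0 invr1 mulr1 subrr.
rewrite big_ord_recr /= IH exprS; field.
by rewrite expf_neq0.
Qed.

Lemma pow4E j : 4 ^+ j = (2 ^+ j) ^+ 2 :> R.
Proof. by rewrite exprAC -[2 ^+ 2]natrX. Qed.

(* In a Stolz angle of aperture [a] at [u], distances to [u] are at most
   [c = 1 + a] times distances to [z]. *)
Lemma poisson_dyadic z u v (c d k : R) n : normc z < 1 -> d = 1 - normc z ->
  1 <= c -> normc (circle_val v - circle_val u) <= c * normc (circle_val v - z) ->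
  0 < k -> k < 2 ^+ n * d ->
  poisson z v <= \sum_(j < n.+1) (8 * c ^+ 2 / d * 4 ^- j *
      (normc (circle_val v - circle_val u) < Num.min (2 ^+ j * d) k)%R%:R) +
    2 * d * c ^+ 2 / k ^+ 2.
Proof.
move=> z1 dE c1; set s := normc (circle_val v - circle_val u).
set y := normc (circle_val v - z) => sy k0 kn.
have d0 : 0 < d by rewrite dE subr_gt0.
have c0 : 0 < c by exact: lt_le_trans c1.
have dy : d <= y by rewrite dE /y -(normc_circle v) normc_sub_ge.
have y0 : 0 < y by exact: lt_le_trans dy.
have Py : poisson z v <= 2 * d / y ^+ 2.
  rewrite /poisson -/y ler_wpM2r ?invr_ge0 ?sqr_ge0//.
  have -> : 1 - normc z ^+ 2 = d * (1 + normc z) by rewrite dE; ring.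
  by rewrite mulrC ler_wpM2r ?(ltW d0)//; lra.
have Pl x : 0 < x -> x <= y -> poisson z v <= 2 * d / x ^+ 2.
  move=> x0 xy; apply: le_trans Py _; rewrite ler_wpM2l ?mulr_ge0 ?(ltW d0)//.
  rewrite lef_pV2 ?posrE ?exprn_gt0//; apply: lerXn2r => //; by rewrite nnegrE ltW.
have term_ge0 (j : nat) : 0 <= 8 * c ^+ 2 / d * 4 ^- j * (s < Num.min (2 ^+ j * d) k)%R%:R.
  by rewrite mulr_ge0// mulr_ge0 ?invr_ge0 ?exprn_ge0// divr_ge0 ?(ltW d0)// mulr_ge0 ?sqr_ge0.
have rest_ge0 : 0 <= 2 * d * c ^+ 2 / k ^+ 2.
  by rewrite divr_ge0 ?sqr_ge0// mulr_ge0 ?sqr_ge0// mulr_ge0// ltW.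
(* Far from u the kernel is bounded by the last term; nearer points lie in a dyadic ring. *)
have [ks|sk] := leP k s.
  rewrite -[leLHS]add0r; apply: lerD; first exact: sumr_ge0.
  have kc : k / c <= y by rewrite ler_pdivrMr// [y * c]mulrC (le_trans ks).
  apply: le_trans (Pl _ _ kc) _; first by rewrite divr_gt0.
  by rewrite le_eqVlt; apply/orP; left; apply/eqP; field; rewrite !gt_eqF.
have ex : exists j, s < 2 ^+ j * d by exists n; exact: lt_trans kn.
(* The ring of v: for j > 0 minimality gives s >= 2^(j-1) d, hence y >= 2^(j-1) d / c and a kernel
   of at most 8 c^2 / (4^j d). The single term j of the sum suffices. *)
case: (ex_minnP ex) => j sj jmin.
have jn : (j < n.+1)%N by rewrite ltnS jmin// (lt_trans sk).
rewrite -[leLHS]addr0; apply: lerD => //.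
rewrite (bigD1 (Ordinal jn))//= -[leLHS]addr0; apply: lerD; last exact: sumr_ge0.
rewrite lt_min sj sk mulr1.
case: j sj jmin jn => [|j] sj jmin jn.
  apply: le_trans (Pl _ d0 dy) _; rewrite expr0 invr1 mulr1.
  have -> : 2 * d / d ^+ 2 = 2 / d by field; rewrite gt_eqF.
  rewrite ler_wpM2r ?invr_ge0 ?(ltW d0)//.
  have : 1 <= c ^+ 2 by rewrite exprn_ege1.
  lra.
have js : 2 ^+ j * d <= s by rewrite leNgt; apply/negP => /jmin; rewrite ltnn.
have p0 : 0 < 2 ^+ j :> R by rewrite exprn_gt0.
have xc : 2 ^+ j * d / c <= y by rewrite ler_pdivrMr// [y * c]mulrC (le_trans js).
apply: le_trans (Pl _ _ xc) _; first by rewrite divr_gt0// mulr_gt0.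
have -> : 4 ^- j.+1 = (4 * (2 ^+ j) ^+ 2)^-1 :> R.
  by rewrite exprS pow4E.
by rewrite le_eqVlt; apply/orP; left; apply/eqP; field; rewrite !gt_eqF.
Qed.

(** In the ring j the kernel is of order 4^-j / d while the Lebesgue point condition gives an
    integral of order 2^j d, so the rings sum like 2^-j. The far part is O(d). *)
Lemma poisson_lebesgue_pt (T : circle R -> C) (K : R) u (a : R) : bounded_cmfun T ->
  (forall v, normc (T v) <= K) -> chord_lebesgue_pt T u -> 1 < a ->
  forall e : R, 0 < e -> exists2 dl : R, 0 < dl & forall z, normc z < 1 ->
    normc (z - circle_val u) < a * (1 - normc z) -> normc (z - circle_val u) < dl ->
    \int[m]_v (poisson z v * normc (T v - T u)) <= e.
Proof.
move=> bT TK lu a1 e e0.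
pose c := 1 + a; have c1 : 1 <= c by rewrite /c; lra.
have c0 : 0 < c by exact: lt_le_trans c1.
(* With the condition taken at e / (32 c^2), ring j contributes at most 8 c^2 e / (32 c^2) 2^-j =
   e/4 2^-j, in total e / 2. *)
have c20 : 0 < 32 * c ^+ 2 by rewrite mulr_gt0 ?exprn_gt0.
have [k k0 Hk] := lu _ (divr_gt0 e0 c20).
have K0 : 0 <= K by apply: le_trans (TK u).
pose B := 4 * c ^+ 2 * (2 * K + 1).
have B0 : 0 < B.
  by rewrite mulr_gt0 ?mulr_gt0 ?exprn_gt0//; apply: ltr_wpDl => //; rewrite mulr_ge0.
exists (e * k ^+ 2 / B); first by rewrite divr_gt0// mulr_gt0 ?exprn_gt0.
move=> z z1 za zd; pose d := 1 - normc z.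
have d0 : 0 < d by rewrite subr_gt0.
have dz : d < e * k ^+ 2 / B.
  by apply: le_lt_trans zd; rewrite /d -(normc_circle u) normcB normc_sub_ge.
have [n Hn] := exists_half_pow k d0.
have kn : k < 2 ^+ n * d by move: Hn; rewrite ltr_pdivrMr ?exprn_gt0// mulrC.
pose F v := normc (T v - T u).
have bF : bounded_mfun F by apply: bounded_mfun_normc; apply: bounded_cmfunB => //; exact: bounded_cmfun_cst.
have FK v : F v <= 2 * K.
  by rewrite /F (le_trans (le_normcD _ _))// normcN mulr_natl mulr2n lerD.
pose I (j : nat) v := 8 * c ^+ 2 / d * 4 ^- j *
   (F v * (normc (circle_val v - circle_val u) < Num.min (2 ^+ j * d) k)%R%:R).
have bI0 j : bounded_mfun (fun v => F v * (normc (circle_val v - circle_val u) < Num.min (2 ^+ j * d) k)%R%:R).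
  by apply: bounded_mfunM => //; exact: bounded_mfun_chord.
have bI j : bounded_mfun (I j) by apply: bounded_mfunM; [exact: bounded_mfun_cst|exact: bI0].
have [bS IS] := circle_integral_sum n.+1 bI.
pose rest := 2 * d * c ^+ 2 / k ^+ 2.
have rest0 : 0 <= rest.
  by rewrite divr_ge0 ?sqr_ge0// mulr_ge0 ?sqr_ge0// mulr_ge0// ltW.
have bound v : poisson z v * F v <= \sum_(j < n.+1) I j v + rest * (2 * K).
  have cv : normc (circle_val v - circle_val u) <= c * normc (circle_val v - z).
    apply: le_trans (normc_triangle _ z _) _; rewrite /c mulrDl mul1r lerD2l.
    apply: le_trans (ltW za) _; rewrite ler_wpM2l//; first lra.
    by rewrite -(normc_circle v) normc_sub_ge.
  have := poisson_dyadic z1 erefl c1 cv k0 kn.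
  move=> /(ler_wpM2r (normc_ge0 (T v - T u))) H; apply: le_trans H _.
  rewrite mulrDl mulr_suml; apply: lerD; last by rewrite ler_wpM2l// FK.
  by rewrite le_eqVlt; apply/orP; left; apply/eqP; apply: eq_bigr => j _; rewrite /I /F; ring.
apply: le_trans (le_circle_integral _ _ bound) _.
- by apply: bounded_mfunM => //; exact: bounded_mfun_poisson.
- by apply: bounded_mfunD => //; exact: bounded_mfun_cst.
rewrite circle_integralD//; last exact: bounded_mfun_cst.
rewrite circle_integral_cst IS.
have S1 : \sum_(j < n.+1) \int[m]_v I j v <= e / 2.
  apply: le_trans (_ : \sum_(j < n.+1) (e / 4 * 2 ^- j) <= _); last first.
    rewrite -mulr_sumr (_ : e / 2 = e / 4 * 2); last by field.
    by rewrite ler_wpM2l ?sum_half_pow_le// divr_ge0// ltW.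
  apply: ler_sum => j _; rewrite circle_integralZ//.
  have p0 : 0 < 2 ^+ j :> R by rewrite exprn_gt0.
  have r0 : 0 < Num.min (2 ^+ j * d) k by rewrite lt_min k0 mulr_gt0.
  have rk : Num.min (2 ^+ j * d) k <= k by rewrite ge_min lexx orbT.
  have H := Hk _ r0 rk.
  have H2 : Num.min (2 ^+ j * d) k <= 2 ^+ j * d by rewrite ge_min lexx.
  have H3 := le_trans H (ler_wpM2l (ltW (divr_gt0 e0 c20)) H2).
  have w0 : 0 <= 8 * c ^+ 2 / d * 4 ^- j.
    by rewrite mulr_ge0 ?invr_ge0 ?exprn_ge0// divr_ge0 ?(ltW d0)// mulr_ge0 ?sqr_ge0.
  apply: le_trans (ler_wpM2l w0 H3) _.
  rewrite pow4E.
  by rewrite le_eqVlt; apply/orP; left; apply/eqP; field; rewrite !gt_eqF.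
have S2 : rest * (2 * K) <= e / 2.
  move: dz; rewrite ltr_pdivlMr// => /ltW dB.
  apply: le_trans (_ : d * B / (2 * k ^+ 2) <= _); last first.
    by rewrite ler_pdivrMr ?mulr_gt0 ?exprn_gt0// (le_trans dB)//; lra.
  rewrite /rest /B -subr_ge0.
  have -> : d * (4 * c ^+ 2 * (2 * K + 1)) / (2 * k ^+ 2) - 2 * d * c ^+ 2 / k ^+ 2 * (2 * K) =
     2 * d * c ^+ 2 / k ^+ 2 by field; rewrite gt_eqF.
  exact: rest0.
lra.
Qed.

Lemma cauchy_boundary_value (T : circle R -> C) (K : R) : bounded_cmfun T ->
  (forall v, normc (T v) <= K) ->
  (forall n, fourier0 (fun u => T u * circle_val u ^+ n) = 0) ->
  boundary_value (cauchy T) T.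
Proof.
move=> bT TK T0; apply: filterS (ae_chord_lebesgue_pt bT) => u lu.
apply/nt_cvgP => a a1 e e0.
have e40 : 0 < e / 4 by rewrite divr_gt0.
have [d d0 Hd] := poisson_lebesgue_pt bT TK lu a1 e40.
exists d => // z z1 za zd; apply: le_lt_trans (cauchy_sub_le bT TK T0 (T u) z1) _.
have := Hd z z1 za zd; lra.
Qed.

(** The kernel is nonnegative with mean 1; the 2 is inherited from [normc_fourier0_le]. *)
Lemma cauchy_bounded (T : circle R -> C) (K : R) : bounded_cmfun T ->
  (forall v, normc (T v) <= K) ->
  (forall n, fourier0 (fun u => T u * circle_val u ^+ n) = 0) ->
  forall z, normc z < 1 -> normc (cauchy T z) <= 2 * K.
Proof.
move=> bT TK T0 z z1; have := cauchy_sub_le bT TK T0 0 z1; rewrite subr0 => /le_trans; apply.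
rewrite ler_wpM2l//.
have bP := bounded_mfun_poisson z1.
have PT : \int[m]_u poisson z u = 1.
  have := fourier0_poisson_cst 1 z1; rewrite /fourier0.
  under eq_Rintegral do rewrite mulr1 /=.
  by move=> [].
rewrite -[K]mulr1 -PT -circle_integralZ//; apply: le_circle_integral.
- by apply: bounded_mfunM => //; apply: bounded_mfun_normc; apply: bounded_cmfunB => //; exact: bounded_cmfun_cst.
- by apply: bounded_mfunM => //; exact: bounded_mfun_cst.
by move=> u; rewrite subr0 mulrC ler_wpM2r ?poisson_ge0.
Qed.

End fatou.

(** * The test family *)

Section borel_version.
Variable R : realType.
Local Notation C := R[i].
Implicit Types (z w h l : C) (f : C -> C) (s t : R) (u : circle R) (g : circle R -> C).
Local Notation m := (@circle_measure R).

(** For each rational q the set where k > q is a Borel set up to a Borel null set. [Z] collects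
    these countably many null sets; off it, every superlevel set is a countable union of Borel
    sets. *)
Lemma completed_measurable_version (k : circle R -> R) :
  (forall a : R, completed_algebra_gen m [set u | a < k u]) ->
  exists Z, [/\ measurable Z, m Z = 0%E & measurable_fun setT (k \_ (~` Z))].
Proof.
move=> hk.
(* An enumeration of the rationals; the default 0 at indices that code nothing only repeats a
   value. *)
pose q n : R := if @unpickle rat n is Some x then ratr x else 0.
have H n : exists BZ : set (circle R) * set (circle R), [/\ measurable BZ.1, measurable BZ.2,
    m BZ.2 = 0%E, BZ.1 `<=` [set u | q n < k u] & [set u | q n < k u] `<=` BZ.1 `|` BZ.2].
  have [B mB [N [Z [mZ Z0 NZ]] E]] := hk (q n).
  exists (B, Z); split => //=; rewrite -E; first exact: subsetUl.
  exact: setUS.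
have [BZ HBZ] := choice H.
pose Z := \bigcup_n (BZ n).2.
have mZ : measurable Z by apply: bigcupT_measurable => n; have [] := HBZ n.
exists Z; split => //.
  apply: measure_negligible => //; apply: negligible_bigcup => n.
  by have [_ mz z0 _ _] := HBZ n; apply/negligibleP.
apply/(measurable_restrictT _ (measurableC mZ)).
move=> mZC; apply: (measurability _ (RGenOInfty.measurableE R)) => //.
move=> _ [_ [a ->] <-].
rewrite (_ : _ `&` _ = \bigcup_(n in [set n | a <= q n]) ((BZ n).1 `\` Z)).
  apply: bigcup_measurable => n _; apply: measurableD => //.
  by have [] := HBZ n.
apply/seteqP; split => u /=.
  rewrite in_itv/= andbT => -[Zu aku].
  have [x] := rat_in_itvoo aku; rewrite in_itv/= => /andP[ax xk].
  have qx : q (pickle x) = ratr x by rewrite /q pickleK.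
  exists (pickle x) => /=; first by rewrite qx ltW.
  split => //; have [_ _ _ _ /(_ u)] := HBZ (pickle x).
  rewrite /= qx => /(_ xk)[//|Z2]; exfalso; apply: Zu; exists (pickle x) => //.
move=> [n /= aq [Bu Zu]]; split => //; rewrite in_itv/= andbT.
have [_ _ _ /(_ u Bu) /= qk _] := HBZ n; exact: le_lt_trans qk.
Qed.

(** [T] is set to 0 on the null set, so it is bounded by 1 everywhere but unimodular only almost
    everywhere. *)
Lemma borel_version (Theta : circle R -> circle R) : lebesgue_measurable_map Theta ->
  exists T : circle R -> C, [/\ bounded_cmfun T, forall u, normc (T u) <= 1 &
    exists Z, [/\ measurable Z, m Z = 0%E & forall u, ~ Z u -> T u = circle_val (Theta u)]].
Proof.
move=> mT.
have half (x : circle R -> R) a : measurable_fun setT x ->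
    completed_algebra_gen m [set u | a < x (Theta u)].
  move=> mx; apply: (mT [set v | a < x v]).
  rewrite (_ : [set _ | _] = setT `&` x @^-1` `]a, +oo[); first exact: mx.
  by rewrite setTI; apply/seteqP; split => v /=; rewrite in_itv/= andbT.
have [Z1 [mZ1 Z10 m1]] := completed_measurable_version (fun a => half _ a (@measurable_circle_Re R)).
have [Z2 [mZ2 Z20 m2]] := completed_measurable_version (fun a => half _ a (@measurable_circle_Im R)).
pose Z := Z1 `|` Z2.
have mZ : measurable Z by exact: measurableU.
pose T u : C := if u \in ~` Z then circle_val (Theta u) else 0.
have T1 u : normc (T u) <= 1.
  by rewrite /T; case: ifP => _; rewrite ?normc_circle// normc0.
exists T; split => //; last first.
  exists Z; split => //.
    apply: measure_negligible => //.
    by apply: negligibleU; apply/negligibleP.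
  by move=> u Zu; rewrite /T mem_set.
have restr (x : circle R -> R) Y : Y `<=` Z -> measurable_fun setT (x \_ (~` Y)) ->
    measurable_fun setT (x \_ (~` Z)).
  move=> YZ mx; rewrite (_ : x \_ (~` Z) = (x \_ (~` Y)) \_ (~` Z)).
    apply/(measurable_restrictT _ (measurableC mZ)); exact: measurable_funTS.
  apply/funext => u; rewrite !patchE; case: ifP => // uZ; rewrite ifT//.
  by move: uZ; rewrite !inE => uZ uY; apply: uZ; exact: YZ.
split; split.
- rewrite (_ : (fun _ => _) = (fun u => complex.Re (circle_val (Theta u))) \_ (~` Z)).
    by apply: (restr _ Z1) => //; exact: subsetUl.
  by apply/funext => u; rewrite /T patchE; case: ifP.
- by exists 1 => u; rewrite (le_trans (Re_le_normc _)).
- rewrite (_ : (fun _ => _) = (fun u => complex.Im (circle_val (Theta u))) \_ (~` Z)).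
    by apply: (restr _ Z2) => //; exact: subsetUr.
  by apply/funext => u; rewrite /T patchE; case: ifP.
- by exists 1 => u; rewrite (le_trans (Im_le_normc _)).
Qed.

Lemma bounded_mfun_dominated_cst (k : nat -> circle R -> R) (c B : R) :
  (forall n, bounded_mfun (k n)) -> (forall n u, `|k n u| <= B) ->
  (\forall u \ae m, k n u @[n --> \oo] --> c) ->
  \int[m]_u k n u @[n --> \oo] --> c.
Proof.
move=> bk kB kc.
have H : (\int[m]_u (k n u)%:E)%E @[n --> \oo] --> (\int[m]_u (c%:E))%E.
  have [] // := @dominated_convergence _ (circle R) R m setT measurableT
    (fun n u => (k n u)%:E) (fun=> c%:E) (fun=> B%:E)
    (fun n => (measurable_EFinP _ _).2 (bk n).1)
    ((measurable_EFinP _ _).2 (bounded_mfun_cst c).1) _ (bounded_mfun_integrable (bounded_mfun_cst B)).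
    by apply: filterS kc => u ku _; apply: cvg_EFin => //; exact: nearW.
  by apply: nearW => u n _; rewrite /= lee_fin.
have {}H : (\int[m]_u (k n u)%:E)%E @[n --> \oo] --> c%:E.
  by move: H; rewrite (EFin_circle_integral (bounded_mfun_cst c)) circle_integral_cst.
exact: (fine_cvg H).
Qed.

End borel_version.

Section smirnov_examples.
Variable R : realType.
Local Notation C := R[i].
Local Notation m := (@circle_measure R).

(** For functions bounded by 1 all the means of log+ are 0, and so is their limit. *)
Lemma smirnov_logp0 (f : C -> C) (g : circle R -> C) : holomorphic_disc f -> boundary_value f g ->
  (forall z, normc z < 1 -> normc (f z) <= 1) -> (forall u, normc (g u) <= 1) -> smirnov f.
Proof.
move=> hf bg f1 g1.
have mean0 r : 0 <= r < 1 -> logp_mean f r = 0%E.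
  move=> /andP[r0 r1]; rewrite /logp_mean; under eq_integral => u _.
    rewrite logp_le1; last by apply: f1; rewrite normc_rcircle.
    over.
  exact: integral0.
split; first by split => //; exists 0 => r /mean0 ->.
exists g => //.
rewrite (_ : (\int[m]_u (logp (normc (g u)))%:E)%E = 0%E); last first.
  by under eq_integral do rewrite logp_le1//; exact: integral0.
apply: cvg_near_cst; near=> r; apply: mean0.
apply/andP; split; near: r; last exact: nbhs_left_lt.
by apply: nbhs_left_ge.
Unshelve. all: by end_near. Qed.

Lemma smirnov_1 : smirnov (fun _ : C => 1) /\ boundary_value (fun _ : C => 1) (fun _ : circle R => 1).
Proof.
have b1 : boundary_value (fun _ : C => 1) (fun _ : circle R => 1).
  by apply: nearW => u; apply/nt_cvgP => a a1 e e0; exists 1 => // z _ _ _; rewrite subrr normc0.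
by split => //; apply: (smirnov_logp0 _ b1) => [z _|z _|u]; rewrite ?normc1//; exact: derivable_cst.
Qed.

Lemma smirnov_id : smirnov (fun z : C => z) /\ boundary_value (fun z : C => z) (@circle_val R).
Proof.
have b1 : boundary_value (fun z : C => z) (@circle_val R).
  by apply: nearW => u; apply/nt_cvgP => a a1 e e0; exists e.
split => //; apply: (smirnov_logp0 _ b1) => [|z /ltW//|u]; last by rewrite normc_circle.
exact: holomorphic_id.
Qed.

End smirnov_examples.

Section test_family.
Variable R : realType.
Local Notation C := R[i].
Local Notation m := (@circle_measure R).
Implicit Types (u : circle R) (x : 'cV[C]_2).

Definition test_family (K : R) u x : R :=
  Num.max (normc (x 0 0)) (K * normc (x 1 0 - circle_val u * x 0 0)).

Lemma test_family_interpolation (K : R) : 0 < K -> interpolation_family (test_family K).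
Proof.
move=> K0; split => [u|x].
  split => [x xn0|a x|x y].
  - have x00 : x 0 0 = 0.
      apply: eq0_normc; apply/le_anti; rewrite normc_ge0 andbT -xn0.
      by rewrite /test_family le_max lexx.
    have x10 : x 1 0 = 0.
      apply: eq0_normc; apply/le_anti; rewrite normc_ge0 andbT -(ler_pM2l K0) mulr0 -xn0.
      by rewrite /test_family x00 mulr0 subr0 le_max lexx orbT.
    apply/colP => i; rewrite mxE.
    by case: (unliftP 0 i) => [j ->|->]; rewrite ?x00// ord1 (_ : lift 0 0 = 1)//; exact: val_inj.
  - rewrite /test_family !mxE mulrCA -mulrBr !normcM mulrCA.
    by rewrite maxr_pMr.
  rewrite /test_family !mxE ge_max; apply/andP; split.
    by rewrite (le_trans (le_normcD _ _))// lerD// le_max lexx.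
  apply: le_trans (_ : K * (normc (x 1 0 - circle_val u * x 0 0) +
      normc (y 1 0 - circle_val u * y 0 0)) <= _).
    rewrite ler_wpM2l ?(ltW K0)//; apply: le_trans (le_normcD _ _).
    by rewrite le_eqVlt; apply/orP; left; apply/eqP; congr normc; ring.
  by rewrite mulrDr lerD// le_max lexx orbT.
have bE : bounded_mfun (fun u => test_family K u x).
  apply: bounded_mfun_max; first exact: bounded_mfun_cst.
  apply: bounded_mfunM; first exact: bounded_mfun_cst.
  apply: bounded_mfun_normc; apply: bounded_cmfunB; first exact: bounded_cmfun_cst.
  by apply: bounded_cmfunM; [exact: bounded_cmfun_circle|exact: bounded_cmfun_cst].
split; first by case: bE.
have [_ [M HM]] := bE.
apply: le_lt_trans (_ : \int[m]_u M%:E < +oo)%E; last first.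
  by rewrite (EFin_circle_integral (bounded_mfun_cst M)) ltry.
have M0 : 0 <= M by apply: le_trans (HM (circle1 R)).
apply: (@ge0_integral_le_ae _ _ _ m set0) => // u; rewrite lee_fin ?logp_ge0//.
move=> _; have := HM u; have E0 : 0 <= test_family K u x by rewrite le_max normc_ge0.
rewrite ger0_norm//; apply: le_trans.
(* The case y = 0 is log+ x <= x. *)
by have := logp_sub_le (lexx 0) E0; rewrite (logp_le1 ler01) !subr0.
Qed.

Definition vec2 (a b : C) : 'cV[C]_2 := \col_i (if i == 0 then a else b).

Lemma test_family_norm (K : R) : (interp_norm (test_family K) (vec2 1%R 0%R) <= 1)%E.
Proof.
apply: le_trans (_ : ess_sup m (fun u => (test_family K u (vec2 1%R (circle_val u)))%:E) <= _)%E.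
  apply: ereal_inf_lbound; exists (vec2 1), (fun u => vec2 1 (circle_val u)); split => //.
  - move=> i; rewrite (_ : (fun z => _) = if i == 0 then fun=> 1 else fun z => z).
      by case: ifP => _; [have [] := smirnov_1 R|have [] := smirnov_id R].
    by apply/funext => z; rewrite mxE; case: ifP.
  - move=> i; rewrite (_ : (fun z => _) = if i == 0 then fun=> 1 else fun z => z); last first.
      by apply/funext => z; rewrite mxE; case: ifP.
    rewrite (_ : (fun u : circle R => _) = if i == 0 then fun=> 1 else @circle_val R); last first.
      by apply/funext => z; rewrite mxE; case: ifP.
    by case: ifP => _; [have [] := smirnov_1 R|have [] := smirnov_id R].
apply/ess_supP; apply: nearW => u; rewrite lee_fin /test_family /vec2 !mxE /= mulr1 subrr normc0 mulr0.
by rewrite ge_max ler01 andbT le_eqVlt; apply/orP; left; apply/eqP; exact: normc1.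
Qed.

End test_family.

(** * Vanishing of the integrals of Theta u^n *)

Section orthogonality.
Variable R : realType.
Local Notation C := R[i].
Local Notation m := (@circle_measure R).
Implicit Types (u : circle R).

Lemma test_family_near_extremal (Theta : circle R -> circle R) (K dl : R) : 0 < dl ->
  (interp_norm (fun u => test_family K (Theta u)) (vec2 1%R 0%R) <= 1)%E ->
  exists (f1 f2 : C -> C) (g1 g2 : circle R -> C),
    [/\ smirnov f1 /\ smirnov f2, boundary_value f1 g1 /\ boundary_value f2 g2,
        f1 0 = 1 /\ f2 0 = 0 &
        \forall u \ae m, normc (g1 u) <= 1 + dl /\
          K * normc (g2 u - circle_val (Theta u) * g1 u) <= 1 + dl].
Proof.
move=> dl0 norm1.
have lt1 : (interp_norm (fun u => test_family K (Theta u)) (vec2 1%R 0%R) < (1 + dl)%:E)%E.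
  by apply: le_lt_trans norm1 _; rewrite lte_fin ltrDl.
have [e [f [g [sf bf f0 ->]]] edl] := ereal_inf_lt lt1.
exists (fun z => f z 0 0), (fun z => f z 1 0), (fun u => g u 0 0), (fun u => g u 1 0).
split; [by split|by split|by rewrite f0 !mxE|].
have := ltW edl => /ess_supP; apply: filterS => u.
by rewrite lee_fin /test_family ge_max => /andP[].
Qed.

(* Expanding the square, [f 0 = 1] and |f| <= 1 + e^2 force [f] to be within
   O(e) of 1 in L^2. *)
Lemma mean_dist_1_le (f : C -> C) (r e : R) : holomorphic_disc f -> 0 <= r < 1 ->
  0 < e -> e <= 1 -> f 0 = 1 -> (forall z, normc z < 1 -> normc (f z) <= 1 + e ^+ 2) ->
  \int[m]_u normc (1 - f (r%:C * circle_val u)) <= 2 * e.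
Proof.
move=> hf r01 e0 e1 f0 fe; have /andP[r0 r1] := r01.
have cf := bounded_cmfun_holomorphic hf r01; have [bre _] := cf.
(* For t = |1 - f| use t <= (e^2 + t^2) / (2 e) in place of the Cauchy-Schwarz inequality, with t^2
   <= 1 + (1 + e^2)^2 - 2 Re f. As Re f has mean 1, the mean of [B] is (3 e^2 + e^4) / (2 e) <= 2
   e. *)
pose B u := (2 * e)^-1 * (e ^+ 2 + (1 + (1 + e ^+ 2) ^+ 2) - 2 * complex.Re (f (r%:C * circle_val u))).
have bB : bounded_mfun B.
  apply: bounded_mfunM; first exact: bounded_mfun_cst.
  apply: bounded_mfunB; first exact: bounded_mfun_cst.
  by apply: bounded_mfunM => //; exact: bounded_mfun_cst.
apply: le_trans (le_circle_integral _ bB _) _.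
- by apply: bounded_mfun_normc; apply: bounded_cmfunB => //; exact: bounded_cmfun_cst.
- move=> u; rewrite /B [_^-1 * _]mulrC ler_pdivlMr ?mulr_gt0//.
  set z := _ * circle_val u; have z1 : normc z < 1 by rewrite /z normc_rcircle.
  have H1 : normc (1 - f z) ^+ 2 = 1 - 2 * complex.Re (f z) + normc (f z) ^+ 2.
    by rewrite !normc_sqr ReB ImB /=; ring.
  have H2 : normc (f z) ^+ 2 <= (1 + e ^+ 2) ^+ 2.
    by apply: lerXn2r; rewrite ?nnegrE ?addr_ge0 ?sqr_ge0// fe.
  have H3 : 0 <= (normc (1 - f z) - e) ^+ 2 by exact: sqr_ge0.
  rewrite sqrrB -mulr_natl in H3; lra.
rewrite circle_integralZ; last first.
  apply: bounded_mfunB; first exact: bounded_mfun_cst.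
  by apply: bounded_mfunM => //; exact: bounded_mfun_cst.
rewrite circle_integralB; [|exact: bounded_mfun_cst|by apply: bounded_mfunM => //; exact: bounded_mfun_cst].
rewrite circle_integral_cst circle_integralZ//.
have -> : \int[m]_u complex.Re (f (r%:C * circle_val u)) = 1.
  by have := mean_value hf r01; rewrite f0 /fourier0 => -[].
rewrite mulrC ler_pdivrMr ?mulr_gt0//.
have e2 : e ^+ 2 <= 1 by rewrite expr_le1// ltW.
have e4 : (e ^+ 2) ^+ 2 <= e ^+ 2 by rewrite expr2 ler_piMl ?sqr_ge0.
have -> : 2 * e * (2 * e) = 4 * e ^+ 2 by ring.
rewrite sqrrD expr1n mul1r -mulr_natl mulr1; lra.
Qed.

(** Taking the maximum with [c] turns an upper bound on the limiting defect into convergence to a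
    constant, so that no measurability of the boundary values is involved. *)
Lemma cvg_normc_defect (T g1 g2 : C) (f1 f2 : nat -> C) (c : R) : normc T <= 1 ->
  (forall e : R, 0 < e -> exists N, forall n, (N <= n)%N -> normc (f1 n - g1) < e) ->
  (forall e : R, 0 < e -> exists N, forall n, (N <= n)%N -> normc (f2 n - g2) < e) ->
  normc (T * g1 - g2) <= c ->
  Num.max (normc (T * f1 n - f2 n)) c @[n --> \oo] --> c.
Proof.
move=> T1 c1 c2 gc; apply/cvgrPdist_lt => e e0.
have e20 : 0 < e / 2 by rewrite divr_gt0.
have [N1 H1] := c1 _ e20; have [N2 H2] := c2 _ e20.
exists (maxn N1 N2) => // n /=; rewrite geq_max => /andP[n1 n2].
rewrite distrC ger0_norm ?subr_ge0 ?le_max ?lexx ?orbT// ltrBlDr gt_max.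
rewrite ltrDr e0 andbT.
rewrite (_ : _ - _ = (T * g1 - g2) + (T * (f1 n - g1) - (f2 n - g2))); last by ring.
apply: le_lt_trans (le_normcD _ _) _; rewrite addrC; apply: ltr_leD => //.
apply: le_lt_trans (le_normcD _ _) _; rewrite normcN normcM [ltRHS]splitr.
apply: ltrD; last exact: H2.
by apply: le_lt_trans (H1 n n1); rewrite ler_piMl.
Qed.

(** [T] is kept on the unit circle, while [f1] and [f2] are evaluated at a radius below 1, where
    they are continuous and the mean value property holds. Only the estimate of T f1 - f2 comes from
    the boundary, by dominated convergence. *)
Lemma fourier0_eq0 (Theta : circle R -> circle R) (T : circle R -> C) (Z : set (circle R)) n :
  bounded_cmfun T -> (forall u, normc (T u) <= 1) -> measurable Z -> m Z = 0%E ->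
  (forall u, ~ Z u -> T u = circle_val (Theta u)) ->
  (forall K : R, 0 < K ->
    (interp_norm (fun u => test_family K (Theta u)) (vec2 1%R 0%R) <= 1)%E) ->
  fourier0 (fun u => T u * circle_val u ^+ n) = 0.
Proof.
move=> bT T1 mZ Z0 TE norm1.
apply/eqP; rewrite -normc_eq0 eq_le normc_ge0 andbT.
apply/ler_addgt0Pl => e' e'0; rewrite addr0.
(* The total error is 4 e from 1 - f1 plus 6 e from T f1 - f2. *)
pose e := Num.min 1 (e' / 10).
have e0 : 0 < e by rewrite lt_min ltr01 divr_gt0.
have e1 : e <= 1 by rewrite ge_min lexx.
have ee' : 10 * e <= e' by have : e <= e' / 10 by [rewrite ge_min lexx orbT]; lra.
have d0 : 0 < e ^+ 2 by rewrite exprn_gt0.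
have d1 : e ^+ 2 <= e by rewrite expr2 ler_piMl// ltW.
have K0 : 0 < (e ^+ 2)^-1 by rewrite invr_gt0.
have [f1 [f2 [g1 [g2 [[s1 s2] [b1 b2] [f10 f20] gb]]]]] :=
  test_family_near_extremal d0 (norm1 _ K0).
have gb1 : \forall u \ae m, normc (g1 u) <= 1 + e ^+ 2.
  by apply: filterS gb => u [].
have TZ : \forall u \ae m, T u = circle_val (Theta u).
  by exists Z; split => // u; apply: contra_notP; exact: TE.
have gb2 : \forall u \ae m, normc (T u * g1 u - g2 u) <= 2 * e.
  apply: filterS2 gb TZ => u [_ H] ->; rewrite normcB.
  move: H; rewrite mulrC ler_pdivrMr// => /le_trans; apply.
  by rewrite mulrDl mul1r mulr_natl mulr2n lerD// (le_trans _ d1)// ler_piMl ?sqr_ge0// (le_trans d1).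
(* |g2| <= |T g1| + 2 e <= (1 + e^2) + 2 e <= 4. *)
have gb3 : \forall u \ae m, normc (g2 u) <= 4.
  apply: filterS3 gb1 gb2 TZ => u h1 h2 TuE.
  have := normc_sub_ge (g2 u) (T u * g1 u); rewrite normcB normcM.
  rewrite -(normcN (_ - _)) opprB in h2.
  have : normc (T u) * normc (g1 u) <= 1 + e ^+ 2 by rewrite TuE normc_circle mul1r.
  rewrite (normcB (T u * g1 u)) => ? ?; lra.
have hf1 : holomorphic_disc f1 by have [[]] := s1.
have hf2 : holomorphic_disc f2 by have [[]] := s2.
have f1B := smirnov_bounded s1 b1 (_ : 1 <= 1 + e ^+ 2) gb1.
have f2B := smirnov_bounded s2 b2 (_ : 1 <= 4) gb3.
pose h (f : C -> C) j u := f ((radius R j)%:C * circle_val u).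
have c1 j : bounded_cmfun (h f1 j) := bounded_cmfun_holomorphic hf1 (radius01 R j).
have c2 j : bounded_cmfun (h f2 j) := bounded_cmfun_holomorphic hf2 (radius01 R j).
have cn : bounded_cmfun (fun u => circle_val u ^+ n) by apply: bounded_cmfunX; exact: bounded_cmfun_circle.
pose D j u := T u * h f1 j u - h f2 j u.
have cD j : bounded_cmfun (D j) by apply: bounded_cmfunB => //; exact: bounded_cmfunM.
pose k j u := Num.max (normc (D j u)) (2 * e).
have bk j : bounded_mfun (k j) by apply: bounded_mfun_max; [exact: bounded_mfun_normc|exact: bounded_mfun_cst].
have rj j u : normc ((radius R j)%:C * circle_val u) < 1.
  by rewrite normc_rcircle ?radius_lt1// ltW// radius_gt0.
have kB j u : `|k j u| <= 8.
  rewrite ger0_norm; last by rewrite le_max normc_ge0.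
  rewrite /k ge_max; apply/andP; split; last by lra.
  rewrite /D (le_trans (le_normcD _ _))// normcN normcM.
  have A1 : normc (h f1 j u) <= 1 + e ^+ 2 by apply: f1B; rewrite ?lerDl ?sqr_ge0.
  have A2 : normc (h f2 j u) <= 4 by apply: f2B; rewrite ?ler1n.
  have A3 : normc (T u) * normc (h f1 j u) <= 1 * (1 + e ^+ 2) by apply: ler_pM.
  lra.
have ck : \int[m]_u k j u @[j --> \oo] --> 2 * e.
  apply: (bounded_mfun_dominated_cst bk kB).
  apply: filterS3 b1 b2 gb2 => u n1 n2 gu.
  by apply: (@cvg_normc_defect (T u) (g1 u) (g2 u) (h f1 ^~ u) (h f2 ^~ u)) => //;
    [exact: (nt_cvg_radius n1)|exact: (nt_cvg_radius n2)].
have /cvgrPdist_lt /(_ e e0) [j _ Hj] := ck.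
have kj : \int[m]_u k j u <= 3 * e.
  by have := Hj j (leqnn j); rewrite distrC => /ltr_normlW; lra.
(* T u^n = T (1 - f1) u^n + (T f1 - f2) u^n + f2 u^n, and the last term has mean 0 because f2(0) =
   0. *)
have E : fourier0 (fun u => T u * circle_val u ^+ n) =
  fourier0 (fun u => T u * (1 - h f1 j u) * circle_val u ^+ n) +
  fourier0 (fun u => D j u * circle_val u ^+ n).
  have r01 : 0 < radius R j < 1 by rewrite radius_gt0 radius_lt1.
  rewrite -[LHS]subr0 -(@mean_value_expn R f2 (radius R j) n hf2 f20 r01).
  rewrite -fourier0B; [|exact: bounded_cmfunM|exact: (bounded_cmfunM (c2 j) cn)].
  rewrite -fourier0D; [| |exact: bounded_cmfunM]; last first.
    by apply: bounded_cmfunM => //; apply: bounded_cmfunM => //; apply: bounded_cmfunB => //; exact: bounded_cmfun_cst.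
  by congr fourier0; apply/funext => u; rewrite /D /h; ring.
have nn u : normc (circle_val u ^+ n) = 1 by rewrite normcX normc_circle expr1n.
have B1 : normc (fourier0 (fun u => T u * (1 - h f1 j u) * circle_val u ^+ n)) <= 4 * e.
  have c1B : bounded_cmfun (fun u => 1 - h f1 j u) by apply: bounded_cmfunB => //; exact: bounded_cmfun_cst.
  apply: le_trans (normc_fourier0_le (k := fun u => normc (1 - h f1 j u)) _ _ _) _.
  - by apply: bounded_cmfunM => //; exact: bounded_cmfunM.
  - exact: bounded_mfun_normc.
  - by move=> u; rewrite normcM nn mulr1 normcM ler_piMl.
  have := @mean_dist_1_le f1 (radius R j) e hf1 (radius01 R j) e0 e1 f10 (f1B _).
  rewrite lerDl sqr_ge0 => /(_ isT) H; have : 4 * e = 2 * (2 * e) by ring.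
  by move=> ->; rewrite ler_wpM2l.
have B2 : normc (fourier0 (fun u => D j u * circle_val u ^+ n)) <= 6 * e.
  apply: le_trans (normc_fourier0_le (k := k j) _ _ _) _ => //.
  - exact: bounded_cmfunM.
  - by move=> u; rewrite normcM nn mulr1 /k le_max lexx.
  lra.
rewrite E; apply: le_trans (le_normcD _ _) _; lra.
Qed.

End orthogonality.

Theorem theorem3p4 (R : realType) (Theta : circle R -> circle R)
  (mTheta : lebesgue_measurable_map Theta)
  (invariance : forall (N : nat) (E : circle R -> 'cV[R[i]]_N -> R),
     (1 <= N)%N -> interpolation_family E ->
     forall x : 'cV[R[i]]_N,
       interp_norm E x = interp_norm (fun gamma => E (Theta gamma)) x) :
  (exists phi : R[i] -> R[i],
     inner_fun phi /\ boundary_value phi (fun gamma => circle_val (Theta gamma)))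
  /\ fourier0 (fun gamma => circle_val (Theta gamma)) = 0%R.
Proof.
have [T [bT T1 [Z [mZ Z0 TE]]]] := borel_version mTheta.
have norm1 (K : R) : 0 < K ->
    (interp_norm (fun u => test_family K (Theta u)) (vec2 1%R 0%R) <= 1)%E.
  move=> K0; rewrite -(invariance 2 (test_family K) isT (test_family_interpolation K0)).
  exact: test_family_norm.
have ortho n := fourier0_eq0 n bT T1 mZ Z0 TE norm1.
have bv : boundary_value (cauchy T) (fun u => circle_val (Theta u)).
  have TZ : \forall u \ae circle_measure, T u = circle_val (Theta u).
    by exists Z; split => // u; apply: contra_notP; exact: TE.
  by apply: filterS2 TZ (cauchy_boundary_value bT T1 ortho) => u <-.
split.
  exists (cauchy T); split => //; split.
  - exact: holomorphic_cauchy bT T1.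
  - by exists (2 * 1); exact: cauchy_bounded bT T1 ortho.
  by exists (fun u => circle_val (Theta u)) => //; apply: nearW => u; exact: normc_circle.
(* The case n = 0; [Theta] itself may fail to be Borel, so its integral is compared with that of [T]
   by [integral_eq_ae]. *)
rewrite -(ortho 0%N) /fourier0 /Rintegral.
by congr (fine _ +i* fine _); apply: (integral_eq_ae mZ Z0) => u /TE TuE; rewrite expr0 mulr1 TuE.
Qed.
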